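(* Let $k\in(0,\frac12)$. Then there exists a constant $c>0$ such that for every initial condition $x_0\in\mathbb R^4$ there exist a constant $C>0$ and a sequence of times $t_n$ increasing to infinity such that $\|\mu_\star-\mu_{t_n}\|_{TV}\ge C\exp(-ct_n^{k/(1-k)})$, where $\mu_\star$ is the unique invariant probability measure and $\mu_t$ is the law at time $t$ of the diffusion started at $x_0$.
   Context: Fix $\alpha,\gamma,T,T_\infty>0$ and an even $C^2$ function $V_1$ with $V_1(x)=\frac{|x|^{2k}}{2k}+R_1(x)$, $\sup_{|x|>1}\max_{m\le2}|R_1^{(m)}(x)|/|x|^{2k-1-m}<\infty$. The diffusion on $\mathbb R^4\ni(p_0,q_0,p_1,q_1)$ is $dq_i=p_idt$, $dp_0=-V_1'(q_0)dt+\alpha(q_1-q_0)dt-\gamma p_0dt+\sqrt{2\gamma T}dw_0$, $dp_1=-V_1'(q_1)dt+\alpha(q_0-q_1)dt+\sqrt{2\gamma T_\infty}dw_1$, $w_0,w_1$ independent Brownian motions. $\|\mu-\nu\|_{TV}=\sup_A|\mu(A)-\nu(A)|$. *)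

(* Defs.v *)
From HB Require Import structures.
From mathcomp Require Import all_boot all_order all_algebra.
From mathcomp Require Import all_classical all_reals all_analysis.
Set Implicit Arguments. Unset Strict Implicit. Unset Printing Implicit Defensive.
Import Order.TTheory GRing.Theory Num.Theory.
Import numFieldNormedType.Exports.
Local Open Scope classical_set_scope.
Local Open Scope ring_scope.

(* State space R^4, points written ((p0, q0), p1), q1), with the product
   (= Borel) sigma-algebra. *)
Definition state (R : realType) := (R * R * R * R)%type.

Definition tv_dist (R : realType) (d : measure_display) (S : measurableType d)
  (mu nu : set S -> \bar R) : \bar R :=
  ereal_sup [set (`|mu A - nu A|)%E | A in measurable].

Definition R1_of (R : realType) (k : R) (V1 : R -> R) : R -> R :=
  fun x => V1 x - `|x| `^ (2 * k) / (2 * k).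

Definition potential_hyp (R : realType) (k : R) (V1 : R -> R) : Prop :=
  (forall x, V1 (- x) = V1 x) /\
  (forall x, derivable V1 x 1) /\
  (forall x, derivable (derive1 V1) x 1) /\
  continuous (derive1 (derive1 V1)) /\
  exists K : R, forall x : R, 1 < `|x| ->
    `|R1_of k V1 x| <= K * `|x| `^ (2 * k - 1) /\
    `|derive1 (R1_of k V1) x| <= K * `|x| `^ (2 * k - 2) /\
    `|derive1 (derive1 (R1_of k V1)) x| <= K * `|x| `^ (2 * k - 3).

(* Driving noise on a probability space (Omega, P): an initial condition
   xi : Omega -> R^4 with law mu0, and two standard Brownian motions w0, w1
   (continuous paths on [0, oo), starting at 0), with (xi, w0, w1) mutually
   independent.  Independence and the Gaussian independent increments are
   expressed jointly by the product rule on all finite-dimensional cylinder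
   events of the increments over a time grid 0 = ts 0 < ts 1 < ... < ts n. *)
Definition driving_noise (R : realType) (d : measure_display)
  (Omega : measurableType d) (P : probability Omega R)
  (mu0 : set (state R) -> \bar R) (xi : Omega -> state R)
  (w0 w1 : R -> Omega -> R) : Prop :=
  measurable_fun setT xi /\
  (forall t, measurable_fun setT (w0 t)) /\
  (forall t, measurable_fun setT (w1 t)) /\
  (forall om, w0 0 om = 0 /\ w1 0 om = 0) /\
  (forall om, {within [set t : R | 0 <= t], continuous (fun t => w0 t om)} /\
              {within [set t : R | 0 <= t], continuous (fun t => w1 t om)}) /\
  (forall (n : nat) (ts : nat -> R) (A : set (state R)) (B C : nat -> set R),
     ts 0%N = 0 -> (forall i, (i < n)%N -> ts i < ts i.+1) ->
     measurable A -> (forall i, measurable (B i)) -> (forall i, measurable (C i)) ->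
     P (xi @^-1` A `&`
        \bigcap_(i in [set i | (i < n)%N])
          ((fun om => w0 (ts i.+1) om - w0 (ts i) om) @^-1` B i `&`
           (fun om => w1 (ts i.+1) om - w1 (ts i) om) @^-1` C i))
     = (mu0 A * \prod_(i < n)
          (normal_prob 0 (Num.sqrt (ts i.+1 - ts i)) (B i) *
           normal_prob 0 (Num.sqrt (ts i.+1 - ts i)) (C i)))%E).

(* (p0, q0, p1, q1) solves, pathwise for every omega and every t >= 0,
   the integral form of the SDE
     dq_i = p_i dt,
     dp0 = -V1'(q0) dt + alpha (q1 - q0) dt - gamma p0 dt + sqrt(2 gamma T) dw0,
     dp1 = -V1'(q1) dt + alpha (q0 - q1) dt + sqrt(2 gamma Tinf) dw1,
   with initial condition xi (the noise is additive, so no stochastic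
   integral is needed). *)
Definition is_solution (R : realType) (alpha gamma T Tinf : R) (V1 : R -> R)
  (d : measure_display) (Omega : measurableType d)
  (xi : Omega -> state R) (w0 w1 : R -> Omega -> R)
  (p0 q0 p1 q1 : R -> Omega -> R) : Prop :=
  (forall t, measurable_fun setT (p0 t) /\ measurable_fun setT (q0 t) /\
             measurable_fun setT (p1 t) /\ measurable_fun setT (q1 t)) /\
  forall om,
    {within [set t : R | 0 <= t], continuous (fun t => p0 t om)} /\
    {within [set t : R | 0 <= t], continuous (fun t => q0 t om)} /\
    {within [set t : R | 0 <= t], continuous (fun t => p1 t om)} /\
    {within [set t : R | 0 <= t], continuous (fun t => q1 t om)} /\
    p0 0 om = (xi om).1.1.1 /\ q0 0 om = (xi om).1.1.2 /\
    p1 0 om = (xi om).1.2 /\ q1 0 om = (xi om).2 /\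
    forall t, 0 <= t ->
      q0 t om = q0 0 om + Rintegral lebesgue_measure `[0, t] (fun s => p0 s om) /\
      q1 t om = q1 0 om + Rintegral lebesgue_measure `[0, t] (fun s => p1 s om) /\
      p0 t om = p0 0 om
        + Rintegral lebesgue_measure `[0, t]
            (fun s => - derive1 V1 (q0 s om) + alpha * (q1 s om - q0 s om)
                      - gamma * p0 s om)
        + Num.sqrt (2 * gamma * T) * w0 t om /\
      p1 t om = p1 0 om
        + Rintegral lebesgue_measure `[0, t]
            (fun s => - derive1 V1 (q1 s om) + alpha * (q0 s om - q1 s om))
        + Num.sqrt (2 * gamma * Tinf) * w1 t om.

Definition law_at (R : realType) (d : measure_display) (Omega : measurableType d)
  (P : probability Omega R) (p0 q0 p1 q1 : R -> Omega -> R) (t : R)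
  : set (state R) -> \bar R :=
  fun A => P ((fun om => (p0 t om, q0 t om, p1 t om, q1 t om)) @^-1` A).

Definition invariant_measure (R : realType) (alpha gamma T Tinf : R)
  (V1 : R -> R) (mu : probability (state R) R) : Prop :=
  forall (d : measure_display) (Omega : measurableType d) (P : probability Omega R)
         (xi : Omega -> state R) (w0 w1 p0 q0 p1 q1 : R -> Omega -> R),
    driving_noise P mu xi w0 w1 ->
    is_solution alpha gamma T Tinf V1 xi w0 w1 p0 q0 p1 q1 ->
    forall t, 0 <= t -> forall A, measurable A ->
      law_at P p0 q0 p1 q1 t A = mu A.

(* Main.v *)
(** Put Q = gamma q0 + p0 + p1.  The fast variables (p0, p1, q1 - q0) form a
    stable linear system driven by the noise and a bounded force, whereas
    Q' = - V1'(q0) - V1'(q1) + noise.  When Q is of size r, both positions are of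
    size r and the drift of Q is only O(r^(2k - 1)).

    The invariant measure has a heavy tail: cut a time interval of length about
    r^(2 - 2k) into N ~ r^(2k) cells of length h = r^(2 - 4k) and ask on each
    cell for an increment of the noise of order sqrt h, which beats the drift
    there.  This has probability at least exp (- l N) and lifts Q from r to 2r,
    so by invariance mu {Q >= 2r} >= exp (- 2 l r^(2k)) mu {Q >= r}, up to a control of
    the fast variables; iterating from r0 gives
    mu {Q >= r} >= kap0 exp (- Cst r^(2k)) for r = 2^n r0.

    The diffusion started at x0 has a lighter tail at small times: the drift of Q
    is nonpositive far out, so reaching r by time t = r^(2 - 2k) / Theta requires
    a displacement of order r of the noise, whose probability is at most
    exp (- c Theta r^(2k)).  For Theta large the event {Q >= r} separates the two
    laws by a multiple of exp (- Cst r^(2k)), and r^(2k) = (Theta t)^(k / (1 - k)). *)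

Require Import Defs.
From HB Require Import structures.
From mathcomp Require Import all_boot all_order all_algebra.
From mathcomp Require Import all_classical all_reals all_analysis.
From mathcomp Require Import measurable_realfun ring lra zify.
Import Order.TTheory GRing.Theory Num.Theory.
Import numFieldNormedType.Exports.
Local Open Scope classical_set_scope.
Local Open Scope ring_scope.

(** * Calculus on the half-line *)

(** The noise is additive, so every dynamical estimate is made for one fixed pair of driving paths,
    and probability enters only through events of such paths. Friction acts on p0 alone; the plain
    energy of the fast variables is not strictly dissipated, and cross terms with q1 - q0 restore
    the decay.

    A large Q says something about the positions only while the fast variables are small against Q.
    The doubling argument therefore transports sets of the form {Q >= r, energy <= (delta r)^2}. One
    climb multiplies the energy by at most 9/4, up to an error o(r^2), and the passage from r to 2r
    allows a factor 4. Controlling the energy requires a bound on the oscillation of the noise in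
    each cell. A bound of order sqrt (N h) ~ r^(1 - k) = o(r) is small enough for the climb, and its
    failure is exponentially rarer in N than the required increments.

    Invariance speaks of solutions whose initial law is mu, whereas the noise at hand comes with a
    Dirac start. Changing the initial law requires a solution that is measurable in the starting
    point and the noise together; Picard iteration provides it. *)

Lemma is_derive_addf (R : realType) (f g : R -> R) (x a b : R) :
  is_derive x 1 f a -> is_derive x 1 g b -> is_derive x 1 (fun y => f y + g y) (a + b).
Proof. exact: is_deriveD. Qed.

Lemma is_derive_subf (R : realType) (f g : R -> R) (x a b : R) :
  is_derive x 1 f a -> is_derive x 1 g b -> is_derive x 1 (fun y => f y - g y) (a - b).
Proof. exact: is_deriveB. Qed.

Lemma is_derive_cstf (R : realType) (c x : R) : is_derive x 1 (fun=> c) 0.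
Proof. exact: is_derive_cst. Qed.

Lemma is_derive_mulf (R : realType) (f g : R -> R) (x a b : R) :
  is_derive x 1 f a -> is_derive x 1 g b ->
  is_derive x 1 (fun y => f y * g y) (a * g x + f x * b).
Proof.
move=> fa gb; apply: is_derive_eq (is_deriveM fa gb) _.
by rewrite /GRing.scale/=; ring.
Qed.

Lemma is_derive_scalef (R : realType) (c : R) (f : R -> R) (x a : R) :
  is_derive x 1 f a -> is_derive x 1 (fun y => c * f y) (c * a).
Proof.
by move=> fa; apply: is_derive_eq (is_derive_mulf _ _ _ _ _ _ (is_derive_cstf _ c x) fa) _; ring.
Qed.

Lemma is_derive_continuous_at (R : realType) (f : R -> R) (x a : R) :
  is_derive x 1 f a -> {for x, continuous f}.
Proof.
by move=> /@ex_derive /derivable1_diffP/differentiable_continuous.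
Qed.

Lemma continuous_integrable_segment (R : realType) (g : R -> R) (a b : R) :
  continuous g -> (lebesgue_measure).-integrable `[a, b] (EFin \o g).
Proof.
move=> cg; apply: continuous_compact_integrable; first exact: segment_compact.
by apply: continuous_subspaceT.
Qed.

(** The primitive is based at -1, so that its two-sided derivative also exists at the endpoint 0. *)
Lemma antiderivative (R : realType) (g : R -> R) : continuous g ->
  exists G : R -> R, (forall t : R, 0 <= t -> is_derive (t : R) 1 G (g t)) /\
    forall t : R, 0 <= t -> Rintegral lebesgue_measure `[0, t] g = G t - G 0.
Proof.
move=> cg; exists (fun t : R => Rintegral lebesgue_measure `[-1, t] g); split.
  move=> t t0.
  have [||||dG G'] := @continuous_FTC1_closed R g (-1) t (t + 1).
  - by rewrite ltrDl.
  - exact: continuous_integrable_segment.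
  - by rewrite (lt_le_trans _ t0)// ltrN10.
  - exact: cg.
  - by rewrite -G'; rewrite derive1E; apply: DeriveDef.
move=> t t0; rewrite (@Rintegral_itvB _ _ _ _ 0)//.
- rewrite Rintegral_itv_obnd_cbnd//.
  apply: integrableS (continuous_integrable_segment _ _ 0 t cg) => //.
  by apply: subset_itvr; rewrite bnd_simp.
- exact: continuous_integrable_segment.
- by rewrite bnd_simp; lra.
Qed.

Lemma uniform_continuity_segment (R : realType) (g : R -> R) (a b e : R) :
  continuous g -> 0 < e -> exists2 d : R, 0 < d &
    forall u v : R, a <= u <= b -> `|v - u| < d -> `|g v - g u| < e.
Proof.
move=> cg e0.
have K : compact `[a, b]%classic by exact: segment_compact.
move/compact_near_coveringP : K => K.
have := K R (0^'+) (fun d u => forall v, `|v - u| < d -> `|g v - g u| < e) _.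
have H : forall x : R, `[a, b]%classic x ->
    \forall x' \near x & i \near (0 : R)^'+,
      forall v : R, `|v - x'| < i -> `|g v - g x'| < e.
  move=> x _.
  have e2 : 0 < e / 2 by lra.
  have /cvgrPdist_lt/(_ _ e2)/nbhs_ballP[d /= d0 Hd] := cg x.
  exists (ball x (d / 2), [set i : R | i < d / 2]) => /=.
    split; first by apply: nbhsx_ballx; lra.
    by apply: nbhs_right_lt; lra.
  move=> [x' i] /= [bx id] v vx.
  have h1 : `|g x - g x'| < e / 2.
    apply: Hd; move: bx; rewrite /ball /= => bx; lra.
  have h2 : `|g x - g v| < e / 2.
    apply: Hd; move: bx; rewrite /ball /= => bx.
    have -> : x - v = (x - x') - (v - x') by ring.
    apply: le_lt_trans (ler_normB _ _) _; lra.
  have -> : g v - g x' = (g x - g x') - (g x - g v) by ring.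
  apply: le_lt_trans (ler_normB _ _) _; lra.
move=> /(_ _ H) N.
near (0 : R)^'+ => d.
exists d; first by near: d; exact: nbhs_right_gt.
move=> u v uab; move: u uab v.
have : forall x, `[a, b]%classic x -> forall v, `|v - x| < d -> `|g v - g x| < e by near: d.
by move=> h u uab v; apply: h; rewrite /= in_itv.
Unshelve. all: by end_near. Qed.

Lemma MVT_right (R : realType) (f df : R -> R) (a b : R) : a <= b ->
  (forall x : R, a <= x <= b -> is_derive x 1 f (df x)) ->
  exists2 c, a <= c <= b & f b - f a = df c * (b - a).
Proof.
move=> ab fd.
have [||c cab ->] := @MVT_segment R f df a b ab.
- by move=> x; rewrite in_itv/= => /andP[ax xb]; apply: fd; rewrite !ltW.
- apply: derivable_within_continuous => x; rewrite in_itv/= => xab.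
  by have /@ex_derive := fd _ xab.
- by exists c => //; move: cab; rewrite in_itv.
Qed.

(** The function exp (c x) (f x - D / c) is nonincreasing. If it starts nonpositive it stays so and
    f t <= D / c; otherwise f t <= f 0. *)
Lemma exp_comparison (R : realType) (f df : R -> R) (c D t : R) :
  0 < c -> 0 <= t -> (forall x : R, 0 <= x <= t -> is_derive x 1 f (df x)) ->
  (forall x : R, 0 <= x <= t -> df x <= - c * f x + D) ->
  f t <= Num.max (f 0) (D / c).
Proof.
move=> c0 t0 fd dfle.
pose g := fun x : R => expR (c * x) * (f x - D / c).
pose dg := fun x : R => expR (c * x) * (c * (f x - D / c) + df x).
have gd (x : R) : 0 <= x <= t -> is_derive x 1 g (dg x).
  move=> /fd fdx; rewrite /g.
  have dc : is_derive x 1 (fun x : R => c * x) c.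
    by apply: is_derive_eq (is_derive_scalef _ c _ _ _ (is_derive_id x 1)) _; rewrite mulr1.
  have de : is_derive x 1 (fun x : R => expR (c * x)) (expR (c * x) * c).
    exact: (@is_derive1_comp _ expR (fun x : R => c * x)).
  have df' : is_derive x 1 (fun x : R => f x - D / c) (df x).
    by rewrite -[df x]subr0; apply: is_derive_subf => //; exact: is_derive_cstf.
  apply: is_derive_eq (is_derive_mulf _ _ _ _ _ _ de df') _.
  by rewrite /dg; ring.
have [x xt gE] := MVT_right _ _ _ _ _ t0 gd.
have : g t <= g 0.
  rewrite -subr_le0 gE subr0 mulr_le0_ge0// /dg.
  apply: mulr_ge0_le0; first exact: expR_ge0.
  have := dfle _ xt.
  have -> : c * (f x - D / c) = c * f x - D by field; rewrite gt_eqF.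
  lra.
rewrite /g mulr0 expR0 mul1r => h.
have [f0|f0] := lerP (f 0) (D / c).
  have : expR (c * t) * (f t - D / c) <= 0 by lra.
  by rewrite pmulr_rle0 ?expR_gt0// subr_le0.
have e1 : 1 <= expR (c * t) by rewrite -expR0 ler_expR mulr_ge0// ltW.
have [//|] := lerP (f t) (f 0) => ft.
have : f t - D / c <= expR (c * t) * (f t - D / c) by rewrite ler_peMl//; lra.
lra.
Qed.

Lemma last_time_below (R : realType) (f : R -> R) (a t : R) :
  continuous f -> 0 <= t -> f 0 <= a -> a < f t ->
  exists s : R, [/\ 0 <= s <= t, f s <= a & forall u : R, s < u <= t -> a < f u].
Proof.
move=> cf t0 f0 ft.
pose A := [set u : R | 0 <= u <= t /\ f u <= a].
have A0 : A 0 by split; rewrite // lexx.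
have hA : has_sup A by split; [exists 0 | exists t => u [/andP[]]].
have [s0 st] : 0 <= sup A /\ sup A <= t.
  split; first exact: (ub_le_sup hA.2 A0).
  by apply: ge_sup; [exists 0 | move=> u [/andP[]]].
exists (sup A); split; first by rewrite s0.
- rewrite leNgt; apply/negP => h.
  have e0 : 0 < f (sup A) - a by lra.
  have /cvgrPdist_lt/(_ _ e0)/nbhs_ballP[d /= d0 Hd] := cf (sup A).
  have [u Au su] := sup_adherent d0 hA.
  have us : u <= sup A by exact: (ub_le_sup hA.2 Au).
  have /Hd : ball (sup A) d u.
    by rewrite /ball /= ger0_norm; lra.
  case: Au => _ fu; rewrite ger0_norm; lra.
- move=> u /andP[su ut]; rewrite ltNge; apply/negP => fu.
  have : u <= sup A by apply: (ub_le_sup hA.2); split => //; apply/andP; split; lra.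
  lra.
Qed.

(** Reversing time by u -> t - u turns this into the last-time statement. *)
Lemma first_time_below (R : realType) (f : R -> R) (a t : R) :
  continuous f -> 0 <= t -> a < f 0 -> f t <= a ->
  exists s : R, [/\ 0 <= s <= t, f s <= a & forall u : R, 0 <= u < s -> a < f u].
Proof.
move=> cf t0 f0 ft.
have [||||s [st fs hs]] := @last_time_below R (fun u => f (t - u)) a t.
- move=> x; apply: continuous_comp; last exact: cf.
  by apply: continuousB; [exact: cvg_cst | exact: cvg_id].
- by [].
- by rewrite subr0.
- by rewrite subrr.
- exists (t - s); split => //; first by lra.
  by move=> u us; have := hs (t - u); rewrite subKr; apply; lra.
Qed.

Lemma Rintegral_clamp (R : realType) (g : R -> R) (t : R) :
  Rintegral lebesgue_measure `[0, t] (fun s => g (Num.max 0 s)) =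
  Rintegral lebesgue_measure `[0, t] g.
Proof.
apply: eq_Rintegral => s; rewrite inE/= in_itv/= => /andP[s0 _].
by rewrite max_r.
Qed.

(** Paths are continuous on the half-line only. Composing with [Num.max 0] gives continuous
    functions on the whole line, to which the calculus above applies, and integrals over [0, t] do
    not change. *)
Lemma continuous_clamp (R : realType) (w : R -> R) :
  {within [set t : R | 0 <= t], continuous w} ->
  continuous (fun t : R => w (Num.max 0 t)).
Proof.
move=> cw x.
have cm : continuous (fun t : R => Num.max 0 t).
  by move=> y; apply: continuous_max; [exact: cvg_cst|exact: cvg_id].
apply/cvgrPdist_lt => e e0.
have h0 : [set t : R | 0 <= t] (Num.max 0 x) by rewrite /= le_max lexx.
have /cvgrPdist_lt/(_ _ e0) := (@subspace_continuousP _ _ _ w).1 cw _ h0.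
rewrite near_withinE => h.
near=> t; have : 0 <= Num.max 0 t -> `|w (Num.max 0 x) - w (Num.max 0 t)| < e.
  by near: t; apply: (cm x _ h).
by apply; rewrite le_max lexx.
Unshelve. all: by end_near. Qed.

Lemma continuous_addf (R : realType) (f g : R -> R) :
  continuous f -> continuous g -> continuous (fun x => f x + g x).
Proof. by move=> cf cg x; apply: cvgD; [exact: cf|exact: cg]. Qed.

Lemma continuous_subf (R : realType) (f g : R -> R) :
  continuous f -> continuous g -> continuous (fun x => f x - g x).
Proof. by move=> cf cg x; apply: cvgB; [exact: cf|exact: cg]. Qed.

Lemma continuous_oppf (R : realType) (f : R -> R) :
  continuous f -> continuous (fun x => - f x).
Proof. by move=> cf x; apply: cvgN; exact: cf. Qed.

Lemma continuous_scalef (R : realType) (c : R) (f : R -> R) :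
  continuous f -> continuous (fun x => c * f x).
Proof. by move=> cf x; apply: cvgM; [exact: cvg_cst|exact: cf]. Qed.

Lemma continuous_compf (R : realType) (f g : R -> R) :
  continuous f -> continuous g -> continuous (fun x => f (g x)).
Proof. by move=> cf cg x; apply: (@continuous_comp _ _ _ g f x (cg x)); exact: cf. Qed.

(** * The potential *)

Lemma continuous_bounded_segment (R : realType) (g : R -> R) (a b : R) :
  continuous g -> exists2 M : R, 0 < M & forall x : R, a <= x <= b -> `|g x| <= M.
Proof.
move=> cg; have [ab|ba] := lerP a b; last first.
  by exists 1 => // x /andP[ax xb]; lra.
have cn : {within `[a, b], continuous (fun x => `|g x|)}.
  apply: continuous_subspaceT => x; apply: continuous_comp; first exact: cg.
  exact: norm_continuous.
have [c cab hc] := EVT_max ab cn.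
exists (`|g c| + 1) => [|x xab]; first by rewrite ltr_wpDl.
by rewrite (le_trans (hc x _)) ?in_itv// lerDl.
Qed.

Lemma derivable1_is_derive (R : realType) (f : R -> R) (x : R) :
  derivable f x 1 -> is_derive x 1 f (derive1 f x).
Proof. by move=> df; rewrite derive1E; apply: DeriveDef. Qed.

Lemma is_derive_compN (R : realType) (f : R -> R) (x a : R) :
  is_derive (- x) 1 f a -> is_derive x 1 (fun y => f (- y)) (- a).
Proof.
move=> fa.
have dn : is_derive x 1 (fun y : R => - y) (- 1).
  exact: is_deriveNid.
by apply: is_derive_eq (is_derive1_comp fa dn) _; rewrite mulrN1.
Qed.

Lemma powR_le1 (R : realType) (x a : R) : 1 < x -> a <= 0 -> x `^ a <= 1.
Proof. by move=> x1 a0; rewrite -[leRHS](powRr0 x) ler_powR// ltW. Qed.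

(** Beyond 1, V1' is x^(2k - 1) up to K x^(2k - 2), and V1'' is bounded since all exponents are
    negative. As V1 is even, V1' is odd and V1'' even, so the bounds pass to x < -1; compactness
    covers [-1, 1]. Bounded V1'' gives the Lipschitz constant, and beyond 1 + K the leading term
    dominates the error, whence the sign. *)
Lemma potential_facts (R : realType) (k : R) (V1 : R -> R) :
  0 < k -> k < 1 / 2 -> potential_hyp k V1 ->
  exists M L q : R, [/\ 0 < M, 0 < L, 1 < q,
    (forall x : R, `|derive1 V1 x| <= M) /\
    (forall x : R, 1 <= x -> `|derive1 V1 x| <= M * x `^ (2 * k - 1)) &
    (forall x : R, q <= x -> 0 <= derive1 V1 x) /\
    (forall x y : R, `|derive1 V1 x - derive1 V1 y| <= L * `|x - y|)].
Proof.
move=> k0 k1 [Ve [dV [ddV [cV [K0 hK]]]]].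
pose K : R := `|K0| + 1.
have K0' : 1 <= K by rewrite lerDr.
pose f : R -> R := derive1 V1; pose f' : R -> R := derive1 f.
rewrite -/f.
have fd (x : R) : is_derive x 1 V1 (f x) by exact: derivable1_is_derive.
have f'd (x : R) : is_derive x 1 f (f' x) by exact: derivable1_is_derive.
have fodd (x : R) : f (- x) = - f x.
  have h1 := is_derive_compN _ _ _ _ (fd (- x)).
  have h2 : is_derive x 1 V1 (- f (- x)).
    by apply: (near_eq_is_derive _ h1); near=> y; rewrite Ve.
  have := @derive_val _ _ _ _ _ _ _ h2.
  have -> := @derive_val _ _ _ _ _ _ _ (fd x).
  by move=> ->; rewrite opprK.
have f'even (x : R) : f' (- x) = f' x.
  have h1 := is_derive_compN _ _ _ _ (f'd (- x)).
  have h2 : is_derive x 1 (fun y => - f y) (- f' (- x)).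
    by apply: (near_eq_is_derive _ h1); near=> y; rewrite fodd.
  have h3 : is_derive x 1 (fun y => - f y) (- f' x) by exact: is_deriveN.
  have := @derive_val _ _ _ _ _ _ _ h2.
  have -> := @derive_val _ _ _ _ _ _ _ h3.
  by move=> /oppr_inj ->.
have near1 (x : R) : 1 < x -> \forall y \near x, 1 < y.
  by move=> x1; exact: lt_nbhsr.
have R1d (x : R) : 1 < x -> is_derive x 1 (R1_of k V1) (f x - x `^ (2 * k - 1)).
  move=> x1.
  have h : is_derive x 1 (fun y => V1 y - (2 * k)^-1 * y `^ (2 * k)) (f x - x `^ (2 * k - 1)).
    apply: is_derive_subf => //.
    have p := @is_derive1_powR R (2 * k) x (lt_trans ltr01 x1).
    apply: is_derive_eq (is_derive_scalef _ _ _ _ _ p) _.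
    by rewrite mulrA mulVf ?mul1r// gt_eqF// mulr_gt0.
  apply: (near_eq_is_derive _ h); near=> y.
  have y1 : 1 < y by near: y; exact: near1.
  by rewrite /R1_of ger0_norm ?(ltW (lt_trans ltr01 y1))// mulrC.
have R1dE (x : R) : 1 < x -> derive1 (R1_of k V1) x = f x - x `^ (2 * k - 1).
  by move=> x1; rewrite derive1E; exact: (@derive_val _ _ _ _ _ _ _ (R1d _ x1)).
have R1dd (x : R) : 1 < x -> derive1 (derive1 (R1_of k V1)) x =
    f' x - (2 * k - 1) * x `^ (2 * k - 2).
  move=> x1; rewrite derive1E.
  have h : is_derive x 1 (fun y => f y - y `^ (2 * k - 1))
      (f' x - (2 * k - 1) * x `^ (2 * k - 2)).
    apply: is_derive_subf => //.
    have p := @is_derive1_powR R (2 * k - 1) x (lt_trans ltr01 x1).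
    by apply: is_derive_eq p _; congr (_ * _ `^ _); ring.
  have h' : is_derive x 1 (derive1 (R1_of k V1))
      (f' x - (2 * k - 1) * x `^ (2 * k - 2)).
    apply: (near_eq_is_derive _ h); near=> y; rewrite R1dE//.
    by near: y; exact: near1.
  exact: (@derive_val _ _ _ _ _ _ _ h').
have b1 (x : R) : 1 < x -> `|f x - x `^ (2 * k - 1)| <= K * x `^ (2 * k - 2).
  move=> x1; have x0 : 0 < x by rewrite (lt_trans _ x1).
  have x1' : 1 < `|x| by rewrite ger0_norm// ltW.
  have [_ [h _]] := hK x x1'.
  rewrite -R1dE//; move: h; rewrite (ger0_norm (ltW x0)) => h.
  apply: (le_trans h); rewrite ler_wpM2r ?powR_ge0//.
  by rewrite (le_trans (ler_norm _))// lerDl.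
have b2 (x : R) : 1 < x -> `|f' x - (2 * k - 1) * x `^ (2 * k - 2)| <= K.
  move=> x1; have x0 : 0 < x by rewrite (lt_trans _ x1).
  have x1' : 1 < `|x| by rewrite ger0_norm// ltW.
  have [_ [_ h]] := hK x x1'.
  rewrite -R1dd//; move: h; rewrite (ger0_norm (ltW x0)) => h.
  apply: (le_trans h); apply: (@le_trans _ _ (K * x `^ (2 * k - 3))).
    rewrite ler_wpM2r ?powR_ge0// (le_trans (ler_norm _))// lerDl//.
  rewrite ler_piMr// ?(le_trans ler01)//.
  by apply: powR_le1 => //; lra.
have cf : continuous f by move=> x; exact: is_derive_continuous_at (f'd x).
have [B1 B10 hB1] := continuous_bounded_segment _ f (-1) 1 cf.
have [B2 B20 hB2] := continuous_bounded_segment _ f' (-1) 1 cV.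
have pw1 (x : R) : 1 < x -> x `^ (2 * k - 1) <= 1.
  by move=> x1; apply: powR_le1 => //; lra.
have fb (x : R) : 1 < x -> `|f x| <= (1 + K) * x `^ (2 * k - 1).
  move=> x1; have h := b1 _ x1.
  have : K * x `^ (2 * k - 2) <= K * x `^ (2 * k - 1).
    by rewrite ler_wpM2l ?(le_trans ler01)// ler_powR ?ltW//; lra.
  have -> : f x = (f x - x `^ (2 * k - 1)) + x `^ (2 * k - 1) by ring.
  move=> h2; apply: le_trans (ler_normD _ _) _.
  rewrite (ger0_norm (powR_ge0 x _)); lra.
have fb' (x : R) : 1 < x -> `|f x| <= 1 + K.
  move=> x1; apply: (le_trans (fb _ x1)).
  by rewrite ler_piMr ?pw1//; lra.
have f'b (x : R) : 1 < x -> `|f' x| <= 1 + K.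
  move=> x1; have h := b2 _ x1.
  have h2 : x `^ (2 * k - 2) <= 1 by apply: powR_le1 => //; lra.
  have h3 := powR_ge0 x (2 * k - 2).
  have -> : f' x = (f' x - (2 * k - 1) * x `^ (2 * k - 2)) + (2 * k - 1) * x `^ (2 * k - 2) by ring.
  apply: le_trans (ler_normD _ _) _; rewrite addrC lerD// normrM.
  rewrite (ger0_norm h3) (@ler0_norm _ (2 * k - 1)); last by lra.
  nra.
pose M : R := 1 + K + B1 + B2.
have glob (g : R -> R) B : 0 < B -> B <= B1 + B2 ->
    (forall x : R, `|g (- x)| = `|g x|) -> (forall x : R, 1 < x -> `|g x| <= 1 + K) ->
    (forall x : R, -1 <= x <= 1 -> `|g x| <= B) -> forall x : R, `|g x| <= M.
  move=> B0 BB ge gb gB x; have [x1|x1] := lerP x 1; last first.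
    by rewrite (le_trans (gb _ x1))// /M; lra.
  have [x2|x2] := lerP (-1) x.
    by rewrite (le_trans (gB x _)) ?x1 ?x2// /M; lra.
  by rewrite -ge (le_trans (gb (- x) _))// /M; lra.
have fM (x : R) : `|f x| <= M.
  apply: (glob f B1 B10 _ _ fb' hB1); first by lra.
  by move=> y; rewrite fodd normrN.
have f'M (x : R) : `|f' x| <= M.
  apply: (glob f' B2 B20 _ _ f'b hB2); first by lra.
  by move=> y; rewrite f'even.
exists M, M, (1 + K); split; rewrite /M; first by lra.
- by lra.
- by lra.
- split => // x; rewrite le_eqVlt => /predU1P[<-|x1]; last first.
    apply: (le_trans (fb _ x1)); rewrite ler_wpM2r ?powR_ge0//; lra.
  by rewrite powR1 mulr1; exact: fM.
- split.
    move=> x xK; have x1 : 1 < x by lra.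
    have x0 : 0 < x by lra.
    have := b1 _ x1; rewrite ler_norml => /andP[h _].
    have : K * x `^ (2 * k - 2) <= x `^ (2 * k - 1).
      have -> : x `^ (2 * k - 1) = x * x `^ (2 * k - 2).
        by rewrite -{2}(powRr1 (ltW x0)) -powRD ?(gt_eqF x0) ?implybT//; congr (_ `^ _); ring.
      by rewrite ler_wpM2r ?powR_ge0//; lra.
    lra.
  move=> x y; wlog xy : x y / y <= x.
    move=> H; case/orP: (le_total y x) => [/H//|/H].
    by rewrite distrC (distrC y).
  have [c cxy ->] := MVT_right _ f f' y x xy (fun z _ => f'd z).
  by rewrite normrM ler_wpM2r//; exact: f'M.
Unshelve. all: by end_near. Qed.

(** * Gaussian tails and oscillation of Brownian paths *)

(** Where |x| > a, the density of variance s^2 is at most sqrt 2 exp (- a^2 / (4 s^2)) times the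
    density of variance 2 s^2, whose integral is at most 1. *)
Lemma normal_tail (R : realType) (s a : R) : 0 < s -> 0 <= a ->
  (normal_prob 0 s [set x : R | (a < `|x|)%R] <=
   (2 * expR (- (a ^+ 2 / (4 * s ^+ 2))))%:E)%E.
Proof.
move=> s0 a0.
pose s' : R := Num.sqrt 2 * s.
have s2 : s' ^+ 2 = 2 * s ^+ 2 by rewrite exprMn sqr_sqrtr.
have s'0 : 0 < s' by rewrite mulr_gt0// sqrtr_gt0.
have mA : measurable [set x : R | a < `|x|].
  rewrite (_ : [set x : R | a < `|x|] = (@Num.norm R R) @^-1` `]a, +oo[%classic).
    by rewrite -[X in measurable X]setTI; exact: measurable_realfun.normr_measurable.
  by apply/seteqP; split => x /=; rewrite in_itv/= andbT.
pose c : R := 2 * expR (- (a ^+ 2 / (4 * s ^+ 2))).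
have c0 : 0 <= c by rewrite mulr_ge0// expR_ge0.
have dom (x : R) : a < `|x| -> normal_pdf 0 s x <= c * normal_pdf 0 s' x.
  move=> ax; rewrite !normal_pdfE ?gt_eqF//.
  rewrite /normal_peak /normal_fun !subr0 s2.
  have -> : Num.sqrt (2 * s ^+ 2 * pi *+ 2) = Num.sqrt 2 * Num.sqrt (s ^+ 2 * pi *+ 2).
    by rewrite -sqrtrM//; congr (Num.sqrt _); ring.
  rewrite invfM.
  set P := (Num.sqrt 2)^-1; set S := (Num.sqrt (_ *+ 2))^-1.
  have S0 : 0 <= S by rewrite invr_ge0.
  have P0 : 1 <= 2 * P.
    rewrite -ler_pdivrMr ?invr_gt0 ?sqrtr_gt0// invrK mul1r.
    rewrite -[leRHS]ger0_norm// -sqrtr_sqr ler_sqrt ?sqr_ge0//; lra.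
  have e1 : expR (- x ^+ 2 / (s ^+ 2 *+ 2)) <=
     expR (- (a ^+ 2 / (4 * s ^+ 2))) * expR (- x ^+ 2 / ((2 * s ^+ 2) *+ 2)).
    rewrite -expRD ler_expR.
    have -> : - x ^+ 2 / (s ^+ 2 *+ 2) =
       - (x ^+ 2 / (4 * s ^+ 2)) + - x ^+ 2 / ((2 * s ^+ 2) *+ 2).
      by field; rewrite gt_eqF.
    rewrite lerD2r lerN2 ler_pM2r ?invr_gt0 ?mulr_gt0 ?exprn_gt0//.
    by rewrite -(real_normK (num_real x)) ler_pXn2r ?nnegrE// ltW.
  apply: le_trans (ler_wpM2l S0 e1) _.
  set e := expR (- x ^+ 2 / _); set f := expR (- (_ / _)).
  have -> : c * (P * S * e) = (2 * P) * (S * (f * e)) by rewrite /c -/f; ring.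
  by apply: ler_peMl => //; rewrite !mulr_ge0// expR_ge0.
have m1 (r : R) : measurable_fun [set x : R | a < `|x|] (EFin \o normal_pdf 0 r).
  apply/measurable_EFinP; apply: (measurable_funS measurableT) => //.
  exact: measurable_normal_pdf.
rewrite /normal_prob.
apply: (@le_trans _ _ (\int[lebesgue_measure]_(x in [set x : R | (a < `|x|)%R])
    (c%:E * (normal_pdf 0 s' x)%:E))%E).
  apply: ge0_le_integral => //.
  - by move=> x _; rewrite lee_fin normal_pdf_ge0.
  - exact: m1.
  - by apply: measurable_funeM; exact: m1.
rewrite ge0_integralZl_EFin//.
- rewrite -[leRHS]mule1 lee_pmul2l//.
    exact: (probability_le1 (normal_prob 0 s') mA).
  by rewrite lte_fin mulr_gt0// expR_gt0.
- by move=> x _; rewrite lee_fin normal_pdf_ge0.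
- exact: m1.
Qed.

(** By scaling, the mass of [A s, (A + 1) s] is bounded below by a number [q] independent of s: the
    interval has length s and the density there is at least q / s. *)
Lemma normal_right_tail (R : realType) (A : R) : 0 <= A ->
  exists2 l : R, 0 < l & forall s : R, 0 < s ->
    ((expR (- l))%:E <= normal_prob 0 s [set x : R | (A * s <= x)%R])%E.
Proof.
move=> A0.
pose q : R := (Num.sqrt (pi *+ 2))^-1 * expR (- ((A + 1) ^+ 2 / 2)).
have q0 : 0 < q.
  by rewrite mulr_gt0 ?expR_gt0// invr_gt0 sqrtr_gt0 mulrn_wgt0// pi_gt0.
exists (`|ln q| + 1) => [|s s0]; first by rewrite ltr_wpDl.
have mA : measurable [set x : R | A * s <= x].
  rewrite (_ : [set x : R | _] = `[A * s, +oo[%classic)//.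
  by apply/seteqP; split => x /=; rewrite in_itv/= andbT.
have lq : expR (- (`|ln q| + 1)) <= q.
  rewrite -[leRHS]lnK ?posrE// ler_expR lerNl.
  by rewrite (le_trans (ler_norm _))// normrN lerDl.
apply: (@le_trans _ _ q%:E); first by rewrite lee_fin.
have bd (x : R) : A * s <= x <= (A + 1) * s -> q / s <= normal_pdf 0 s x.
  move=> /andP[x1 x2]; rewrite normal_pdfE ?gt_eqF// /normal_peak /normal_fun subr0.
  rewrite -mulrnAr sqrtrM ?sqr_ge0// sqrtr_sqr gtr0_norm// invfM.
  rewrite [X in _ <= X * _]mulrC /q -[leRHS]mulrA -mulrA ler_wpM2l ?invr_ge0//.
  rewrite [leLHS]mulrC ler_pM2l ?invr_gt0// ler_expR mulNr lerN2.
  rewrite ler_pdivrMr ?mulrn_wgt0 ?exprn_gt0//.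
  have -> : (A + 1) ^+ 2 / 2 * (s ^+ 2 *+ 2) = ((A + 1) * s) ^+ 2 by field.
  have xp : 0 <= x by apply: le_trans x1; rewrite mulr_ge0// ltW.
  by rewrite ler_pXn2r ?nnegrE// mulr_ge0 ?ltW//; lra.
have sub : `[A * s, (A + 1) * s]%classic `<=` [set x : R | A * s <= x].
  by move=> x /=; rewrite in_itv/= => /andP[].
apply: (@le_trans _ _ (normal_prob 0 s `[A * s, (A + 1) * s]%classic)); last first.
  by apply: le_measure; rewrite ?inE.
pose I : set R := `[A * s, (A + 1) * s]%classic.
apply: (@le_trans _ _ (\int[lebesgue_measure]_(x in I) (q / s)%:E)%E).
  rewrite integral_cst/I//= lebesgue_measure_itv/= lte_fin ltr_pM2r//.
  rewrite ltrDl ltr01 -EFinB -EFinM lee_fin.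
  have -> : q / s * ((A + 1) * s - A * s) = q by field; rewrite gt_eqF.
  by [].
apply: ge0_le_integral => //.
- exact: measurable_itv.
- by move=> x _; rewrite lee_fin divr_ge0// ltW.
- apply/measurable_EFinP; apply: (measurable_funS measurableT) => //.
  exact: measurable_normal_pdf.
Qed.

(** A dyadic point of level m is reached from s through one increment of each level at most. The
    thresholds a / 4 (3/4)^j for j <= m add up to a (1 - (3/4)^(m+1)) < a for a > 0, and continuity
    extends the bound from dyadic points to every u. *)
Lemma chaining (R : realType) (w : R -> R) (s h a : R) :
  continuous w -> 0 < h -> 0 <= a ->
  (forall m i : nat, (i < 2 ^ m)%N ->
    `|w (s + h * (i.+1%:R / 2 ^+ m)) - w (s + h * (i%:R / 2 ^+ m))|
      <= a / 4 * (3 / 4) ^+ m) ->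
  forall u : R, s <= u <= s + h -> `|w u - w s| <= a.
Proof.
move=> cw h0 a0 inc.
have grid (m i : nat) : (i <= 2 ^ m)%N ->
    `|w (s + h * (i%:R / 2 ^+ m)) - w s| <= a * (1 - (3 / 4) ^+ m.+1).
  elim: m i => [|m IH] i.
    rewrite expn0 expr0 expr1 leq_eqVlt => /predU1P[->|].
      have := inc 0%N 0%N isT.
      by rewrite !expr0 mul0r mulr0 addr0 mulr1 => /le_trans; apply; lra.
    rewrite ltnS leqn0 => /eqP->; rewrite mul0r mulr0 addr0 subrr normr0.
    by apply: mulr_ge0 => //; lra.
  move=> im.
  have pw : 0 <= a * (3 / 4 : R) ^+ m.+1 by rewrite mulr_ge0// exprn_ge0//; lra.
  have half j : (j.*2%:R / 2 ^+ m.+1 : R) = j%:R / 2 ^+ m.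
    rewrite -muln2 natrM exprS invfM mulrACA [2%:R * _]mulrC.
    by rewrite -mulrA [2^-1 * _]mulrCA mulrA; field; rewrite expf_neq0.
  have := odd_double_half i; case: (boolP (odd i)) => oi.
    rewrite add1n => ij; rewrite -ij in im *.
    have jm : (i./2 < 2 ^ m)%N by rewrite expnS mul2n ltn_double in im; lia.
    have i1 := IH _ (ltnW jm).
    have i2 : ((i./2).*2 < 2 ^ m.+1)%N by lia.
    have := inc m.+1 _ i2; rewrite half.
    set x := w (s + _ * (_.+1%:R / _)); set y := w (s + _) in i1 * => h1.
    have -> : x - w s = (x - y) + (y - w s) by ring.
    apply: le_trans (ler_normD _ _) _.
    apply: (le_trans (lerD h1 i1)).
    by rewrite [(3 / 4) ^+ m.+2]exprS; lra.
  rewrite add0n => ij; rewrite -ij half in im *.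
  have jm : (i./2 <= 2 ^ m)%N by rewrite expnS mul2n leq_double in im.
  apply: (le_trans (IH _ jm)); rewrite [(3 / 4) ^+ m.+2]exprS; lra.
move=> u /andP[su uh]; rewrite leNgt; apply/negP => hu.
have e0 : 0 < `|w u - w s| - a by lra.
have /cvgrPdist_lt/(_ _ e0)/nbhs_ballP[d /= d0 Hd] := cw u.
have [m hm] : exists m : nat, h / 2 ^+ m < d.
  have c : (fun m : nat => h * (1 / 2 : R) ^+ m) @ \oo --> (0 : R).
    rewrite -[X in _ --> X](mulr0 h); apply: cvgM; first exact: cvg_cst.
    apply: cvg_expr.
    by rewrite ger0_norm; lra.
  have /cvgrPdist_lt/(_ _ d0)[m _ Hm] := c.
  exists m; have := Hm m (leqnn _); rewrite sub0r normrN.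
  have hm : 0 <= h * (1 / 2 : R) ^+ m.
    by rewrite mulr_ge0 ?exprn_ge0 ?(ltW h0)//; lra.
  by rewrite (ger0_norm hm) expr_div_n expr1n mul1r.
have p2 : 0 < (2 : R) ^+ m by rewrite exprn_gt0.
pose i := Num.truncn ((u - s) / h * 2 ^+ m).
have q0 : 0 <= (u - s) / h * 2 ^+ m by rewrite mulr_ge0 ?divr_ge0 ?subr_ge0// ltW.
have /andP[i1 i2] := truncn_itv q0.
have im : (i <= 2 ^ m)%N.
  rewrite -(ler_nat R) (le_trans i1)// natrX ler_piMl ?(ltW p2)//.
  by rewrite ler_pdivrMr// mul1r; lra.
have := grid m i im.
set x := s + _ => gx.
have : ball u d x.
  rewrite /ball/= ltr_norml.
  have e : u - s = h / 2 ^+ m * ((u - s) / h * 2 ^+ m) by field; rewrite !gt_eqF.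
  have ex : x - s = h / 2 ^+ m * i%:R by rewrite /x; field; rewrite gt_eqF.
  have hp : 0 < h / 2 ^+ m by rewrite divr_gt0.
  have l1 : x - s <= u - s by rewrite e ex ler_pM2l.
  have l2 : u - s < x - s + h / 2 ^+ m.
    have : h / 2 ^+ m * ((u - s) / h * 2 ^+ m) < h / 2 ^+ m * i.+1%:R.
      by rewrite ltr_pM2l.
    have -> : (i.+1%:R : R) = i%:R + 1 by rewrite -natr1.
    by rewrite -e mulrDr mulr1 -ex.
  lra.
move=> /Hd h1.
have : `|w u - w s| <= `|w u - w x| + `|w x - w s|.
  have -> : w u - w s = (w u - w x) + (w x - w s) by ring.
  exact: ler_normD.
have : 0 <= a * (3 / 4 : R) ^+ m.+1 by rewrite mulr_ge0// exprn_ge0//; lra.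
lra.
Qed.

(** Only the law of each single increment is recorded: the chaining argument combines increments by
    the union bound. *)
Definition gaussian_increments (R : realType) (d : measure_display)
    (Omega : measurableType d) (P : probability Omega R) (w : R -> Omega -> R) :=
  [/\ forall t, measurable_fun setT (w t),
      forall om, {within [set t : R | 0 <= t], continuous (fun t => w t om)} &
      forall (s t : R) (B : set R), 0 <= s -> s < t -> measurable B ->
        P ((fun om => w t om - w s om) @^-1` B) =
        normal_prob 0 (Num.sqrt (t - s)) B].

(** Put b = a^2 / (64 h). At level m there are 2^m increments of variance h / 2^m, and the Gaussian
    exponent at the chaining threshold is b (9/8)^m >= b + b m / 8 >= b + 2 m, by Bernoulli and b >=
    16. The hypothesis with 1024 = 16 * 64 is exactly b >= 16. Level m then contributes at most 2
    exp (- b) / 2^m. *)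
Lemma oscillation_tail (R : realType) (d : measure_display)
    (Omega : measurableType d) (P : probability Omega R) (w : R -> Omega -> R)
    (s h a : R) :
  gaussian_increments R d Omega P w -> 0 <= s -> 0 < h -> 0 <= a ->
  1024 * h <= a ^+ 2 ->
  exists E : set Omega, [/\ measurable E,
    (P E <= (4 * expR (- (a ^+ 2 / (64 * h))))%:E)%E &
    forall om, ~ E om -> forall u : R, s <= u <= s + h ->
      `|w u om - w s om| <= a].
Proof.
move=> [mw cw gw] s0 h0 a0 ah.
pose pt (m i : nat) : R := s + h * (i%:R / 2 ^+ m).
have p2 (m : nat) : 0 < (2 : R) ^+ m by rewrite exprn_gt0.
have pt0 m i : 0 <= pt m i.
  by rewrite addr_ge0// mulr_ge0 ?divr_ge0 ?(ltW h0)// ltW.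
pose am (m : nat) : R := a / 4 * (3 / 4) ^+ m.
have am0 m : 0 <= am m by rewrite mulr_ge0 ?divr_ge0 ?exprn_ge0//; lra.
pose Bad m i : set Omega :=
  (fun om => w (pt m i.+1) om - w (pt m i) om) @^-1` [set x : R | am m < `|x|].
pose B m := \big[setU/set0]_(i < 2 ^ m) Bad m i.
have mA m : measurable [set x : R | am m < `|x|].
  rewrite (_ : [set x : R | _] = (@Num.norm R R) @^-1` `]am m, +oo[%classic).
    by rewrite -[X in measurable X]setTI; exact: measurable_realfun.normr_measurable.
  by apply/seteqP; split => x /=; rewrite in_itv/= andbT.
have mBad m i : measurable (Bad m i).
  rewrite /Bad -[X in measurable X]setTI.
  by apply: measurable_funB.
have mB m : measurable (B m) by apply: bigsetU_measurable => i _.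
exists (\bigcup_m B m); split.
- exact: bigcup_measurable.
- pose b : R := a ^+ 2 / (64 * h).
  have b16 : 16 <= b by rewrite /b ler_pdivlMr ?mulr_gt0//; lra.
  have PBad m i : (P (Bad m i) <= (2 * expR (- b) * expR (- (2 * m%:R)))%:E)%E.
    have ptd : pt m i.+1 - pt m i = h / 2 ^+ m.
      by rewrite /pt -natr1; field; rewrite gt_eqF.
    have hp : 0 < h / 2 ^+ m by rewrite divr_gt0.
    rewrite gw//; last by rewrite -subr_gt0 ptd.
    rewrite ptd; apply: le_trans (normal_tail _ _ _ _ _) _ => //.
      by rewrite sqrtr_gt0.
    rewrite lee_fin -mulrA ler_pM2l// -expRD ler_expR sqr_sqrtr ?(ltW hp)//.
    have -> : am m ^+ 2 / (4 * (h / 2 ^+ m)) = b * (9 / 8) ^+ m.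
      have -> : (9 / 8 : R) ^+ m = ((3 / 4) ^+ m) ^+ 2 * 2 ^+ m.
        have -> : (9 / 8 : R) = (3 / 4) ^+ 2 * 2 by field.
        by rewrite exprMn -!exprM mulnC.
      rewrite /am /b; move: ((3 / 4) ^+ m) (p2 m) => X.
      by move: (2 ^+ m) => Y Y0; field; rewrite !gt_eqF.
    have bern : 1 + m%:R / 8 <= (9 / 8 : R) ^+ m.
      elim: m {ptd hp} => [|m IH]; first by rewrite mul0r addr0 expr0.
      rewrite exprS -natr1.
      have : (0 : R) <= m%:R by [].
      nra.
    have : (0 : R) <= m%:R by [].
    nra.
  (* The form 0 + eps / 2^(m+1) is the one summed by [epsilon_trick]. *)
  have PB m : (P (B m) <= (0 + (4 * expR (- b) / (2 ^ m.+1)%:R)%:E))%E.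
    apply: (@le_trans _ _ (\sum_(i < 2 ^ m) P (Bad m i))%E).
      by apply: Boole_inequality => i _.
    apply: (@le_trans _ _ (\sum_(i < 2 ^ m) (2 * expR (- b) * expR (- (2 * m%:R)))%:E)%E).
      by apply: lee_sum => i _.
    rewrite sumEFin add0e lee_fin sumr_const card_ord -[leLHS]mulr_natr !natrX exprS.
    have e2 : (2 : R) ^+ m <= expR m%:R.
      rewrite -[m%:R]mulr1 expRM_natl lerXn2r ?nnegrE ?expR_ge0//.
      by have := @expR_ge1Dx R 1; lra.
    have -> : expR (- (2 * m%:R)) = (expR m%:R)^-1 * (expR m%:R)^-1 :> R.
      by rewrite -!expRN -expRD; congr expR; ring.
    move: (expR m%:R) (expR_gt0 (- b)) (2 ^+ m) (p2 m) e2 => X B0 Y Y0 YX.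
    have X0 : 0 < X by apply: lt_le_trans YX.
    have -> : 2 * expR (- b) * (X^-1 * X^-1) * Y = 2 * expR (- b) / Y * ((Y / X) * (Y / X)).
      by field; rewrite !gt_eqF.
    have -> : 4 * expR (- b) / (2 * Y) = 2 * expR (- b) / Y by field; rewrite gt_eqF.
    have YX1 : Y / X <= 1 by rewrite ler_pdivrMr// mul1r.
    have YX0 : 0 <= Y / X by rewrite divr_ge0 ?ltW.
    apply: ler_piMr; first by rewrite divr_ge0 ?mulr_ge0 ?ltW.
    by rewrite mulr_ile1.
  apply: le_trans (generalized_Boole_inequality _ _ _) _ => //.
    exact: bigcup_measurable.
  apply: (@le_trans _ _ (\sum_(m <oo) (0 + (4 * expR (- b) / (2 ^ m.+1)%:R)%:E))%E).
    by apply: lee_nneseries => // m _; exact: PB.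
  apply: le_trans (epsilon_trick _ _ _) _ => //.
  by rewrite eseries0// add0e.
- move=> om nE u /andP[su uh].
  have cl (v : R) : 0 <= v -> Num.max 0 v = v by move=> v0; exact/max_r.
  have := @chaining R (fun t => w (Num.max 0 t) om) s h a _ h0 a0 _ u.
  rewrite !cl//; last exact: le_trans su.
  apply; last by rewrite su.
    exact: continuous_clamp (cw om).
  move=> m i im; rewrite -/(pt m i) -/(pt m i.+1) !cl// leNgt; apply/negP => hm.
  apply: nE; exists m => //; rewrite /B.
  by rewrite -bigcup_mkord; exists i.
Qed.

(** * Lyapunov function of the fast variables *)

(** Here y stands for q1 - q0. The first three terms are the energy of the coupled pair without the
    potential. Differentiating - a p0 y produces - a alpha y^2; differentiating - (a / 2) p1 y
    produces - (a / 2) p1^2 at the price of + (a / 2) alpha y^2. The weight of the second term is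
    halved so that half of the dissipation in y survives. *)
Definition lyapunov (R : realType) (alpha a p0 p1 y : R) : R :=
  p0 ^+ 2 / 2 + p1 ^+ 2 / 2 + alpha * y ^+ 2 / 2 - a * (p0 * y) - a / 2 * (p1 * y).

Lemma lyapunov_coercive (R : realType) (alpha a p0 p1 y : R) :
  0 < alpha -> 0 < a -> 2 * a <= 1 -> 4 * a <= alpha ->
  (p0 ^+ 2 + p1 ^+ 2 + alpha * y ^+ 2) / 4 <= lyapunov R alpha a p0 p1 y /\
  lyapunov R alpha a p0 p1 y <= p0 ^+ 2 + p1 ^+ 2 + alpha * y ^+ 2.
Proof.
move=> al0 a0 a1 a4; rewrite /lyapunov.
have h1 : `|a * (p0 * y)| <= a * (p0 ^+ 2 / 2) + a * (y ^+ 2 / 2).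
  rewrite normrM (ger0_norm (ltW a0)) -mulrDr ler_pM2l// ler_norml.
  by have := sqr_ge0 (p0 - y); have := sqr_ge0 (p0 + y); nra.
have h2 : `|a / 2 * (p1 * y)| <= a / 2 * (p1 ^+ 2 / 2) + a / 2 * (y ^+ 2 / 2).
  rewrite normrM (ger0_norm _) ?divr_ge0 ?(ltW a0)// -mulrDr ler_pM2l ?divr_gt0// ler_norml.
  by have := sqr_ge0 (p1 - y); have := sqr_ge0 (p1 + y); nra.
move: h1 h2; rewrite !ler_norml => /andP[h1 h2] /andP[h3 h4].
have s0 := sqr_ge0 p0; have s1 := sqr_ge0 p1; have s2 := sqr_ge0 y.
have e1 : 2 * a * p0 ^+ 2 <= p0 ^+ 2 by rewrite ler_piMl.
have e2 : 2 * a * p1 ^+ 2 <= p1 ^+ 2 by rewrite ler_piMl.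
have e3 : 4 * a * y ^+ 2 <= alpha * y ^+ 2 by rewrite ler_wpM2r.
split; lra.
Qed.
Lemma young_sqr (R : realType) (e x z : R) : 0 < e ->
  x * z <= e * x ^+ 2 + z ^+ 2 / (4 * e).
Proof.
move=> e0; rewrite -subr_ge0.
have -> : e * x ^+ 2 + z ^+ 2 / (4 * e) - x * z = (2 * e * x - z) ^+ 2 / (4 * e).
  by field; rewrite gt_eqF.
by rewrite divr_ge0 ?sqr_ge0 ?mulr_ge0// ltW.
Qed.

(** The quadratic part of the derivative is negative definite for small a; the forcing terms [g0],
    [g1], [g2] are absorbed by Young's inequality. There is an error in dy as well because a rough
    part of the momenta will be split off, and then y' is no longer exactly p1 - p0. *)
Lemma lyapunov_decay (R : realType) (alpha gamma : R) : 0 < alpha -> 0 < gamma ->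
  exists a c K : R, [/\ 0 < a /\ 2 * a <= 1, 4 * a <= alpha, 0 < c, 0 < K &
   forall p0 p1 y g0 g1 g2 b : R, `|g0| <= b -> `|g1| <= b -> `|g2| <= b ->
    let dp0 := alpha * y - gamma * p0 + g0 in
    let dp1 := - alpha * y + g1 in
    let dy := p1 - p0 + g2 in
    p0 * dp0 + p1 * dp1 + alpha * (y * dy) - a * (dp0 * y + p0 * dy)
      - a / 2 * (dp1 * y + p1 * dy) <=
    - c * lyapunov R alpha a p0 p1 y + K * b ^+ 2].
Proof.
move=> al0 g0.
pose S : R := gamma ^+ 2 / alpha.
have S0 : 0 < S by rewrite divr_gt0// exprn_gt0.
(* With a = 1 / D, each summand of D yields one smallness condition: 2 a <= 1, 4 a <= alpha, a <=
   gamma, and a (3/2 + 2 S) <= gamma / 2. *)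
pose D : R := 2 + 4 / alpha + 1 / gamma + (3 / 2 + 2 * S) * 2 / gamma.
have q1 : 0 < 4 / alpha by rewrite divr_gt0.
have q2 : 0 < 1 / gamma by rewrite divr_gt0.
have q3 : 0 < (3 / 2 + 2 * S) * 2 / gamma by rewrite divr_gt0//; lra.
have D1 : 2 <= D by rewrite /D; lra.
have D0 : 0 < D by lra.
pose a : R := D^-1.
have a0 : 0 < a by rewrite invr_gt0.
have a2' : 2 * a <= 1 by rewrite ler_pdivrMr ?mul1r.
have a1 : a <= 1 by lra.
have aD (x : R) : x <= D -> a * x <= 1 by move=> h; rewrite mulrC ler_pdivrMr// mul1r.
have a4 : 4 * a <= alpha.
  have : a * (4 / alpha) <= 1 by apply: aD; rewrite /D; lra.
  by rewrite mulrA ler_pdivrMr// mul1r mulrC.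
have ag : a <= gamma.
  have : a * (1 / gamma) <= 1 by apply: aD; rewrite /D; lra.
  by rewrite mulrA ler_pdivrMr// mul1r mulr1.
have aS : a * (3 / 2 + 2 * S) <= gamma / 2.
  have : a * ((3 / 2 + 2 * S) * 2 / gamma) <= 1 by apply: aD; rewrite /D; lra.
  by rewrite mulrA ler_pdivrMr// mul1r; lra.
pose K : R := 4 / gamma + 8 / a + 2 * (alpha + 2) ^+ 2 / (a * alpha).
exists a, (a / 4), K; split => //.
- by rewrite divr_gt0.
- by rewrite /K !addr_gt0 ?divr_gt0 ?mulr_gt0 ?exprn_gt0//; lra.
move=> p0 p1 y f0 f1 f2 b f0b f1b f2b; cbv zeta.
have b0 : 0 <= b by rewrite (le_trans _ f0b).
have [_ hub] := lyapunov_coercive R alpha a p0 p1 y al0 a0 a2' a4.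
(* [G0], [G1], [G2] are the coefficients of p0, p1 and y in the forcing terms. *)
pose G0 : R := f0 - a * f2.
pose G1 : R := f1 - a / 2 * f2.
pose G2 : R := alpha * f2 - a * f0 - a / 2 * f1.
rewrite [leLHS](_ : _ =
   - (gamma - a) * p0 ^+ 2 - a * alpha / 2 * y ^+ 2 - a / 2 * p1 ^+ 2
   + y * (a * gamma * p0) + p1 * (- (a / 2) * p0) + p0 * G0 + p1 * G1 + y * G2); last first.
  by rewrite /G0 /G1 /G2; field.
have af (x f : R) : 0 <= x -> x <= 1 -> `|f| <= b -> `|x * f| <= b.
  move=> x0 x1 fb; rewrite normrM (ger0_norm x0).
  by rewrite (le_trans _ fb)// ler_piMl.
have a2 : a / 2 <= 1 by lra.
have a20 : 0 <= a / 2 by lra.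
have sq (g B : R) : 0 <= B -> `|g| <= B -> g ^+ 2 <= B ^+ 2.
  by move=> B0 gB; rewrite -(real_normK (num_real g)) lerXn2r ?nnegrE.
have G0b : G0 ^+ 2 <= (2 * b) ^+ 2.
  apply: sq; first by rewrite mulr_ge0.
  by apply: le_trans (ler_normB _ _) _; have := af _ _ (ltW a0) a1 f2b; lra.
have G1b : G1 ^+ 2 <= (2 * b) ^+ 2.
  apply: sq; first by rewrite mulr_ge0.
  by apply: le_trans (ler_normB _ _) _; have := af _ _ a20 a2 f2b; lra.
have G2b : G2 ^+ 2 <= ((alpha + 2) * b) ^+ 2.
  apply: sq; first by rewrite mulr_ge0//; lra.
  apply: le_trans (ler_normB _ _) _.
  have h1 := af _ _ a20 a2 f1b.
  have h2 : `|alpha * f2| <= alpha * b by rewrite normrM gtr0_norm// ler_pM2l.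
  have h3 := af _ _ (ltW a0) a1 f0b.
  have := ler_normB (alpha * f2) (a * f0).
  by lra.
have H1 := @young_sqr R (a * alpha / 8) y (a * gamma * p0) ltac:(by rewrite divr_gt0// mulr_gt0).
have E1 : (a * gamma * p0) ^+ 2 / (4 * (a * alpha / 8)) = 2 * (a * S) * p0 ^+ 2.
  by rewrite /S; field; rewrite !gt_eqF.
have H2 := @young_sqr R (a / 8) p1 (- (a / 2) * p0) ltac:(by rewrite divr_gt0).
have E2 : (- (a / 2) * p0) ^+ 2 / (4 * (a / 8)) = a / 2 * p0 ^+ 2.
  by field; rewrite gt_eqF.
have H3 := @young_sqr R (gamma / 4) p0 G0 ltac:(by rewrite divr_gt0).
have E3 : G0 ^+ 2 / (4 * (gamma / 4)) <= 4 / gamma * b ^+ 2.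
  have -> : 4 / gamma * b ^+ 2 = (2 * b) ^+ 2 / (4 * (gamma / 4)) by field; rewrite gt_eqF.
  by rewrite ler_pM2r// invr_gt0 mulr_gt0 ?divr_gt0.
have H4 := @young_sqr R (a / 8) p1 G1 ltac:(by rewrite divr_gt0).
have E4 : G1 ^+ 2 / (4 * (a / 8)) <= 8 / a * b ^+ 2.
  have -> : 8 / a * b ^+ 2 = (2 * b) ^+ 2 / (4 * (a / 8)) by field; rewrite gt_eqF.
  by rewrite ler_pM2r// invr_gt0 mulr_gt0 ?divr_gt0.
have H5 := @young_sqr R (a * alpha / 8) y G2 ltac:(by rewrite divr_gt0// mulr_gt0).
have E5 : G2 ^+ 2 / (4 * (a * alpha / 8)) <= 2 * (alpha + 2) ^+ 2 / (a * alpha) * b ^+ 2.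
  have -> : 2 * (alpha + 2) ^+ 2 / (a * alpha) * b ^+ 2 =
    ((alpha + 2) * b) ^+ 2 / (4 * (a * alpha / 8)) by field; rewrite !gt_eqF.
  by rewrite ler_pM2r// invr_gt0 mulr_gt0 ?divr_gt0 ?mulr_gt0.
have H6 : a * (3 / 2 + 2 * S) * p0 ^+ 2 <= gamma / 2 * p0 ^+ 2.
  by rewrite ler_wpM2r ?sqr_ge0.
have H7 : a * p0 ^+ 2 <= gamma * p0 ^+ 2 by rewrite ler_wpM2r ?sqr_ge0.
have H8 : a / 4 * lyapunov R alpha a p0 p1 y <= a / 4 * (p0 ^+ 2 + p1 ^+ 2 + alpha * y ^+ 2).
  by rewrite ler_pM2l// divr_gt0.
have KE : K * b ^+ 2 = 4 / gamma * b ^+ 2 + 8 / a * b ^+ 2 + 2 * (alpha + 2) ^+ 2 / (a * alpha) * b ^+ 2.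
  by rewrite /K !mulrDl.
rewrite E1 in H1; rewrite E2 in H2; rewrite KE mulNr.
move: (4 / gamma * b ^+ 2) (8 / a * b ^+ 2) (2 * (alpha + 2) ^+ 2 / _ * _) E3 E4 E5 => k1 k2 k3 E3 E4 E5.
have {}H3 := le_trans H3 (lerD (lexx _) E3).
have {}H4 := le_trans H4 (lerD (lexx _) E4).
have {}H5 := le_trans H5 (lerD (lexx _) E5).
lra.
Qed.

(** The intermediate point is strictly interior: around an exit time of the slow variable, the
    hypotheses on the force hold only strictly after or strictly before that time. *)
Lemma MVT_strict (R : realType) (f df : R -> R) (a b : R) : a < b ->
  (forall x : R, a <= x <= b -> is_derive x 1 f (df x)) ->
  exists2 c, a < c < b & f b - f a = df c * (b - a).
Proof.
move=> ab fd.
have [||c cab ->] := @MVT R f df a b ab.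
- by move=> x; rewrite in_itv/= => /andP[ax xb]; apply: fd; rewrite !ltW.
- apply: derivable_within_continuous => x; rewrite in_itv/= => xab.
  by have /@ex_derive := fd _ xab.
- by exists c => //; move: cab; rewrite in_itv.
Qed.

(** The integral equation for a single sample, with force [f] and noise amplitudes [s0], [s1]. In
    this form the estimates apply to solutions on any probability space. *)
Record path_solution (R : realType) (alpha gamma s0 s1 : R) (f : R -> R)
    (w0 w1 p0 q0 p1 q1 : R -> R) : Prop := PathSolution {
  ps_w0 : {within [set t : R | 0 <= t], continuous w0};
  ps_w1 : {within [set t : R | 0 <= t], continuous w1};
  ps_p0 : {within [set t : R | 0 <= t], continuous p0};
  ps_q0 : {within [set t : R | 0 <= t], continuous q0};
  ps_p1 : {within [set t : R | 0 <= t], continuous p1};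
  ps_q1 : {within [set t : R | 0 <= t], continuous q1};
  ps_eq : forall t, 0 <= t ->
    [/\ q0 t = q0 0 + Rintegral lebesgue_measure `[0, t] p0,
        q1 t = q1 0 + Rintegral lebesgue_measure `[0, t] p1,
        p0 t = p0 0 + Rintegral lebesgue_measure `[0, t]
          (fun s => - f (q0 s) + alpha * (q1 s - q0 s) - gamma * p0 s) + s0 * w0 t &
        p1 t = p1 0 + Rintegral lebesgue_measure `[0, t]
          (fun s => - f (q1 s) + alpha * (q0 s - q1 s)) + s1 * w1 t] }.

Lemma integral_equation_derive (R : realType) (g : R -> R) (x0 : R) (x w : R -> R) :
  continuous (fun t : R => g (Num.max 0 t)) ->
  (forall t : R, 0 <= t -> x t = x0 + Rintegral lebesgue_measure `[0, t] g + w t) ->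
  exists A : R -> R, forall t : R, 0 <= t ->
    x t = A t + w t /\ is_derive t 1 A (g t).
Proof.
move=> cg xE; have [G [dG GE]] := antiderivative _ _ cg.
exists (fun t => (x0 - G 0) + G t) => t t0; split.
  by rewrite xE// -Rintegral_clamp GE//; ring.
have -> : g t = g (Num.max 0 t) by rewrite max_r.
apply: is_derive_eq (is_derive_addf _ _ _ _ _ _ (is_derive_cstf _ _ _) (dG _ t0)) _.
by rewrite add0r.
Qed.

(** Each momentum minus its noise term is a primitive of a continuous function. The functions [A0],
    [A1], [B0], [B1] agree with these differences and with the positions for t >= 0, and are
    differentiable from both sides even at 0. *)
Lemma path_solution_smooth (R : realType) (alpha gamma s0 s1 : R) (f : R -> R)
    (w0 w1 p0 q0 p1 q1 : R -> R) :
  continuous f ->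
  path_solution R alpha gamma s0 s1 f w0 w1 p0 q0 p1 q1 ->
  exists A0 A1 B0 B1 : R -> R, forall t : R, 0 <= t ->
    [/\ q0 t = B0 t /\ q1 t = B1 t, p0 t = A0 t + s0 * w0 t, p1 t = A1 t + s1 * w1 t,
      is_derive t 1 B0 (p0 t) /\ is_derive t 1 B1 (p1 t) &
      is_derive t 1 A0 (- f (q0 t) + alpha * (q1 t - q0 t) - gamma * p0 t) /\
      is_derive t 1 A1 (- f (q1 t) + alpha * (q0 t - q1 t))].
Proof.
move=> cf [cw0 cw1 cp0 cq0 cp1 cq1 eqs].
have [|B0 hB0] := @integral_equation_derive R p0 (q0 0) q0 (fun=> 0) (continuous_clamp _ _ cp0).
  by move=> t t0; have [-> _ _ _] := eqs t t0; rewrite addr0.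
have [|B1 hB1] := @integral_equation_derive R p1 (q1 0) q1 (fun=> 0) (continuous_clamp _ _ cp1).
  by move=> t t0; have [_ -> _ _] := eqs t t0; rewrite addr0.
have c0 := continuous_clamp _ _ cq0; have c1 := continuous_clamp _ _ cq1.
have [||A0 hA0] := @integral_equation_derive R
    (fun s => - f (q0 s) + alpha * (q1 s - q0 s) - gamma * p0 s) (p0 0) p0
    (fun t => s0 * w0 t).
- apply: continuous_subf; first apply: continuous_addf.
  + exact/continuous_oppf/(continuous_compf _ f _ cf c0).
  + exact/continuous_scalef/continuous_subf.
  + exact/continuous_scalef/(continuous_clamp _ _ cp0).
- by move=> t t0; have [_ _ <- _] := eqs t t0.
have [||A1 hA1] := @integral_equation_derive R
    (fun s => - f (q1 s) + alpha * (q0 s - q1 s)) (p1 0) p1 (fun t => s1 * w1 t).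
- apply: continuous_addf.
  + exact/continuous_oppf/(continuous_compf _ f _ cf c1).
  + exact/continuous_scalef/continuous_subf.
- by move=> t t0; have [_ _ _ <-] := eqs t t0.
exists A0, A1, B0, B1 => t t0.
have [e1 d1] := hB0 t t0; have [e2 d2] := hB1 t t0.
have [e3 d3] := hA0 t t0; have [e4 d4] := hA1 t t0.
by split => //; split => //; [rewrite e1 addr0|rewrite e2 addr0].
Qed.

(** v t is the integral of w over [t, t + 1]. Both v - w and the derivative of v are thus bounded by
    the oscillation of w over a unit window. *)
Lemma moving_average (R : realType) (w : R -> R) :
  {within [set t : R | 0 <= t], continuous w} ->
  exists v : R -> R, forall t : R, 0 <= t ->
    is_derive t 1 v (w (t + 1) - w t) /\
    exists2 u, t <= u <= t + 1 & v t = w u.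
Proof.
move=> /continuous_clamp cw; have [H [dH _]] := antiderivative _ _ cw.
exists (fun t => H (t + 1) - H t) => t t0.
have t10 : 0 <= t + 1 by lra.
have wt : w t = w (Num.max 0 t) by rewrite max_r.
have wt1 : w (t + 1) = w (Num.max 0 (t + 1)) by rewrite max_r.
split.
  rewrite wt wt1; apply: is_derive_subf; last exact: dH.
  have d1 : is_derive t 1 (fun t : R => t + 1) 1.
    apply: is_derive_eq (is_derive_addf _ _ _ _ _ _ (is_derive_id _ _) (is_derive_cstf _ _ _)) _.
    by rewrite addr0.
  by apply: is_derive_eq (@is_derive1_comp _ H (fun t : R => t + 1) t _ _ (dH _ t10) d1) _; rewrite mulr1.
have tt1 : t <= t + 1 by rewrite lerDl.
have dH' (x : R) : t <= x <= t + 1 -> is_derive x 1 H (w (Num.max 0 x)).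
  by move=> /andP[tx _]; apply: dH; exact: le_trans tx.
have [u tu ->] := MVT_right _ H (fun x => w (Num.max 0 x)) t (t + 1) tt1 dH'.
exists u => //; rewrite max_r; last by case/andP: tu => /(le_trans t0).
by rewrite addrAC subrr add0r mulr1.
Qed.

(** For a quadratic form L, 3/2 L(x) + 3 L(z) - L(x + z) = L(x - 2 z) / 2. The factor 3/2 is chosen
    because the inequality is used twice and (3/2)^2 = 9/4 must stay below 4. *)
Lemma lyapunov_add (R : realType) (alpha a p0 p1 y v0 v1 z : R) :
  0 < alpha -> 0 < a -> 2 * a <= 1 -> 4 * a <= alpha ->
  lyapunov R alpha a (p0 + v0) (p1 + v1) (y + z) <=
  3 / 2 * lyapunov R alpha a p0 p1 y + 3 * lyapunov R alpha a v0 v1 z.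
Proof.
move=> al0 a0 a1 a4.
have [h _] := lyapunov_coercive R alpha a (p0 - 2 * v0) (p1 - 2 * v1) (y - 2 * z) al0 a0 a1 a4.
rewrite -subr_ge0.
have -> : 3 / 2 * lyapunov R alpha a p0 p1 y + 3 * lyapunov R alpha a v0 v1 z -
    lyapunov R alpha a (p0 + v0) (p1 + v1) (y + z) =
    lyapunov R alpha a (p0 - 2 * v0) (p1 - 2 * v1) (y - 2 * z) / 2.
  by rewrite /lyapunov; field.
rewrite divr_ge0//; apply: le_trans h.
by rewrite divr_ge0// !addr_ge0 ?sqr_ge0// mulr_ge0 ?sqr_ge0// ltW.
Qed.

Lemma norm_mulr_le (R : realType) (c x b : R) : 0 <= c -> `|x| <= b -> `|c * x| <= c * b.
Proof. by move=> c0 xb; rewrite normrM (ger0_norm c0) ler_wpM2l. Qed.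

Lemma is_derive_lyapunov (R : realType) (alpha a : R) (P0 P1 Y : R -> R)
    (t d0 d1 dy : R) :
  is_derive t 1 P0 d0 -> is_derive t 1 P1 d1 -> is_derive t 1 Y dy ->
  is_derive t 1 (fun x => lyapunov R alpha a (P0 x) (P1 x) (Y x))
    (P0 t * d0 + P1 t * d1 + alpha * (Y t * dy) - a * (d0 * Y t + P0 t * dy)
      - a / 2 * (d1 * Y t + P1 t * dy)).
Proof.
move=> h0 h1 h2.
pose e := fun x : R => (2^-1) * (P0 x * P0 x) + (2^-1) * (P1 x * P1 x)
  + (alpha / 2) * (Y x * Y x) - a * (P0 x * Y x) - a / 2 * (P1 x * Y x).
have -> : (fun x => lyapunov R alpha a (P0 x) (P1 x) (Y x)) = e.
  by apply/funext => x; rewrite /lyapunov /e; field.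
have sc (c : R) (F G : R -> R) (dF dG : R) : is_derive t 1 F dF -> is_derive t 1 G dG ->
    is_derive t 1 (fun x => c * (F x * G x)) (c * (dF * G t + F t * dG)).
  by move=> hF hG; apply: is_derive_scalef; exact: is_derive_mulf.
have ad := is_derive_addf R; have su := is_derive_subf R.
have h := su _ _ _ _ _ (su _ _ _ _ _ (ad _ _ _ _ _ (ad _ _ _ _ _ (sc 2^-1 _ _ _ _ h0 h0)
  (sc 2^-1 _ _ _ _ h1 h1)) (sc (alpha / 2) _ _ _ _ h2 h2)) (sc a _ _ _ _ h0 h2))
  (sc (a / 2) _ _ _ _ h1 h2).
apply: is_derive_eq h _.
by field.
Qed.

(* The noise is removed from the equation by subtracting w minus its moving
   average, which leaves a differentiable forcing of size O(1 + m). *)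
Lemma stable_bound (R : realType) (alpha gamma s0 s1 M : R) :
  0 < alpha -> 0 < gamma -> 0 < s0 -> 0 < s1 -> 0 < M ->
  exists a C : R, [/\ 0 < a, 2 * a <= 1, 4 * a <= alpha, 0 < C &
   forall (f w0 w1 p0 q0 p1 q1 : R -> R) (tau m : R),
    continuous f -> (forall x, `|f x| <= M) ->
    path_solution R alpha gamma s0 s1 f w0 w1 p0 q0 p1 q1 ->
    0 <= m ->
    (forall u v : R, 0 <= u -> u <= v <= u + 1 -> v <= tau + 1 ->
      `|w0 v - w0 u| <= m /\ `|w1 v - w1 u| <= m) ->
    forall t : R, 0 <= t <= tau ->
      lyapunov R alpha a (p0 t) (p1 t) (q1 t - q0 t) <=
      9 / 4 * lyapunov R alpha a (p0 0) (p1 0) (q1 0 - q0 0) + C * (1 + m) ^+ 2].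
Proof.
move=> al0 g0 s00 s10 M0.
have [a [c [K [[a0 a2] a4 c0 K0 decay]]]] := lyapunov_decay R alpha gamma al0 g0.
(* B (1 + m) bounds the forcing: M comes from the force, gamma (s0 + s1) from friction acting on the
   part split off, and s0 + s1 from the derivative of the moving averages and from the error in y'.
   V (1 + m)^2 bounds the energy of the part split off. *)
pose B : R := M + (gamma + 1) * (s0 + s1).
pose V : R := s0 ^+ 2 + s1 ^+ 2.
have B0 : 0 < B by rewrite /B addr_gt0// mulr_gt0// addr_gt0.
have V0 : 0 < V by rewrite addr_gt0// exprn_gt0.
(* [lyapunov_add] is applied at time 0 and again at time t, so the part split off contributes 3/2 *
   3 + 3 = 15/2 times V. *)
pose C : R := 3 / 2 * (K * B ^+ 2 / c) + 15 / 2 * V.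
have KB : 0 < K * B ^+ 2 / c by rewrite divr_gt0// mulr_gt0// exprn_gt0.
exists a, C; split => //; first by rewrite /C; lra.
move=> f w0 w1 p0 q0 p1 q1 tau m cf fM ps m0 osc t /andP[t0 tt].
have [A0 [A1 [B0' [B1' sm]]]] := path_solution_smooth _ _ _ _ _ _ _ _ _ _ _ _ cf ps.
have [v0 hv0] := moving_average _ _ (ps_w0 _ _ _ _ _ _ _ _ _ _ _ _ ps).
have [v1 hv1] := moving_average _ _ (ps_w1 _ _ _ _ _ _ _ _ _ _ _ _ ps).
have near_avg (x : R) : 0 <= x <= tau -> `|w0 x - v0 x| <= m /\ `|w1 x - v1 x| <= m.
  move=> /andP[x0 xt].
  have [_ [u0 /andP[xu0 u0x] ->]] := hv0 x x0.
  have [_ [u1 /andP[xu1 u1x] ->]] := hv1 x x0.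
  by split; rewrite distrC; [have [] := osc x u0 x0 ltac:(clear - xu0 u0x; lra) ltac:(clear - u0x xt; lra)
                            |have [] := osc x u1 x0 ltac:(clear - xu1 u1x; lra) ltac:(clear - u1x xt; lra)].
pose P0 : R -> R := fun x => A0 x + s0 * v0 x.
pose P1 : R -> R := fun x => A1 x + s1 * v1 x.
pose Y : R -> R := fun x => B1' x - B0' x.
have split_Z (x : R) : 0 <= x ->
    [/\ p0 x = P0 x + s0 * (w0 x - v0 x), p1 x = P1 x + s1 * (w1 x - v1 x) &
        q1 x - q0 x = Y x].
  by move=> x0; have [[-> ->] -> -> _ _] := sm x x0; rewrite /P0 /P1; split => //; ring.
have VB (x : R) : 0 <= x <= tau ->
    lyapunov R alpha a (s0 * (w0 x - v0 x)) (s1 * (w1 x - v1 x)) 0 <= V * (1 + m) ^+ 2.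
  move=> xt; have [h0 h1] := near_avg x xt.
  have [_ h] := lyapunov_coercive R alpha a (s0 * (w0 x - v0 x)) (s1 * (w1 x - v1 x)) 0 al0 a0 a2 a4.
  apply: (le_trans h); rewrite expr0n mulr0 addr0 !exprMn /V mulrDl.
  have sq (z : R) : `|z| <= m -> z ^+ 2 <= (1 + m) ^+ 2.
    move=> zm; rewrite -(real_normK (num_real z)) lerXn2r ?nnegrE//; clear - zm m0; lra.
  by rewrite lerD// ler_pM2l ?exprn_gt0// sq.
pose L := fun x : R => lyapunov R alpha a (P0 x) (P1 x) (Y x).
pose dL := fun x : R =>
  let d0 := - f (q0 x) + alpha * (q1 x - q0 x) - gamma * p0 x + s0 * (w0 (x + 1) - w0 x) in
  let d1 := - f (q1 x) + alpha * (q0 x - q1 x) + s1 * (w1 (x + 1) - w1 x) in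
  let dy := p1 x - p0 x in
  P0 x * d0 + P1 x * d1 + alpha * (Y x * dy) - a * (d0 * Y x + P0 x * dy)
      - a / 2 * (d1 * Y x + P1 x * dy).
have dLP (x : R) : 0 <= x <= t -> is_derive x 1 L (dL x).
  move=> /andP[x0 xt]; have [_ _ _ [dB0 dB1] [dA0 dA1]] := sm x x0.
  have [dv0 _] := hv0 x x0; have [dv1 _] := hv1 x x0.
  have e0 := is_derive_addf _ _ _ _ _ _ dA0 (is_derive_scalef _ s0 _ _ _ dv0).
  have e1 := is_derive_addf _ _ _ _ _ _ dA1 (is_derive_scalef _ s1 _ _ _ dv1).
  have e2 := is_derive_subf _ _ _ _ _ _ dB1 dB0.
  exact: (is_derive_lyapunov R alpha a P0 P1 Y x _ _ _ e0 e1 e2).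
pose b : R := B * (1 + m).
have dLle (x : R) : 0 <= x <= t -> dL x <= - c * L x + K * b ^+ 2.
  move=> /andP[x0 xt].
  have xtau : 0 <= x <= tau by apply/andP; split => //; lra.
  have [h0 h1] := near_avg x xtau.
  have [i0 i1] := osc x (x + 1) x0 ltac:(clear; lra) ltac:(clear - xt tt; lra).
  have [Zp0 Zp1 Zy] := split_Z x x0.
  pose f0 : R := - f (q0 x) - gamma * (s0 * (w0 x - v0 x)) + s0 * (w0 (x + 1) - w0 x).
  pose f1 : R := - f (q1 x) + s1 * (w1 (x + 1) - w1 x).
  pose f2 : R := s1 * (w1 x - v1 x) - s0 * (w0 x - v0 x).
  have j0 := norm_mulr_le _ _ _ _ (ltW s00) i0.
  have j1 := norm_mulr_le _ _ _ _ (ltW s10) i1.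
  have k0 := norm_mulr_le _ _ _ _ (ltW s00) h0.
  have k1 := norm_mulr_le _ _ _ _ (ltW s10) h1.
  have l0 := norm_mulr_le _ _ _ _ (ltW g0) k0.
  have n0 := fM (q0 x); have n1 := fM (q1 x).
  have gs0 : 0 < gamma * s0 by rewrite mulr_gt0.
  have gs1 : 0 < gamma * s1 by rewrite mulr_gt0.
  have bs : [/\ 0 <= gamma * s0 * m, 0 <= gamma * s1 * m, 0 <= M * m, 0 <= s0 * m & 0 <= s1 * m].
    by split; rewrite !mulr_ge0// ltW.
  have bE : b = M + gamma * s0 + gamma * s1 + s0 + s1 + M * m + gamma * s0 * m +
      gamma * s1 * m + s0 * m + s1 * m by rewrite /b /B; ring.
  have f0b : `|f0| <= b.
    apply: le_trans (ler_normD _ _) _.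
    have := ler_normB (- f (q0 x)) (gamma * (s0 * (w0 x - v0 x))).
    by rewrite normrN bE; clear - n0 l0 j0 bs gs0 gs1 s00 s10 M0; case: bs; lra.
  have f1b : `|f1| <= b.
    by apply: le_trans (ler_normD _ _) _; rewrite normrN bE; clear - n1 j1 bs gs0 gs1 s00 s10 M0; case: bs; lra.
  have f2b : `|f2| <= b.
    by apply: le_trans (ler_normB _ _) _; rewrite bE; clear - k0 k1 bs gs0 gs1 s00 s10 M0; case: bs; lra.
  have := decay (P0 x) (P1 x) (Y x) f0 f1 f2 b f0b f1b f2b.
  rewrite /dL /L -Zy; cbv zeta.
  have -> : - f (q0 x) + alpha * (q1 x - q0 x) - gamma * p0 x + s0 * (w0 (x + 1) - w0 x)
     = alpha * (q1 x - q0 x) - gamma * P0 x + f0 by rewrite /f0 Zp0; ring.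
  have -> : - f (q1 x) + alpha * (q0 x - q1 x) + s1 * (w1 (x + 1) - w1 x)
     = - alpha * (q1 x - q0 x) + f1 by rewrite /f1; ring.
  by have -> : p1 x - p0 x = P1 x - P0 x + f2 by rewrite /f2 Zp0 Zp1; ring.
have Lt : L t <= Num.max (L 0) (K * B ^+ 2 / c * (1 + m) ^+ 2).
  have := exp_comparison R L dL c (K * b ^+ 2) t c0 t0 dLP dLle.
  by have -> : K * b ^+ 2 / c = K * B ^+ 2 / c * (1 + m) ^+ 2 by rewrite /b; ring.
have L0 : L 0 <= 3 / 2 * lyapunov R alpha a (p0 0) (p1 0) (q1 0 - q0 0) + 3 * (V * (1 + m) ^+ 2).
  have z0 : 0 <= (0 : R) <= tau by apply/andP; split => //; lra.
  have [-> -> ->] := split_Z 0 (lexx _).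
  set V0' := s0 * _; set V1' := s1 * _.
  have := lyapunov_add R alpha a (P0 0 + V0') (P1 0 + V1') (Y 0) (- V0') (- V1') 0 al0 a0 a2 a4.
  rewrite !addrK addr0 => /le_trans; apply; rewrite lerD2l ler_pM2l//.
  by have := VB 0 z0; rewrite -/V0' -/V1' /lyapunov !sqrrN !mulr0.
have tb : 0 <= t <= tau by rewrite t0.
have [Zp0 Zp1 Zy] := split_Z t t0.
rewrite {1}Zp0 {1}Zp1 {1}Zy -[Y t]addr0.
apply: (le_trans (lyapunov_add _ _ _ _ _ _ _ _ _ al0 a0 a2 a4)); rewrite -/(L t).
have VBt := VB t tb.
pose S : R := lyapunov R alpha a (p0 0) (p1 0) (q1 0 - q0 0).
have S0 : 0 <= S.
  have [h _] := lyapunov_coercive R alpha a (p0 0) (p1 0) (q1 0 - q0 0) al0 a0 a2 a4.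
  by apply: le_trans h; rewrite divr_ge0// !addr_ge0 ?sqr_ge0// mulr_ge0 ?sqr_ge0// ltW.
have X0 : 0 <= (1 + m) ^+ 2 by rewrite sqr_ge0.
rewrite -/S in L0 *.
rewrite /C; move: (K * B ^+ 2 / c) KB Lt => k KB Lt.
move: ((1 + m) ^+ 2) X0 Lt L0 VBt => X X0 Lt L0 VBt.
have VX : 0 <= V * X by rewrite mulr_ge0// ltW.
have KX : 0 <= k * X by rewrite mulr_ge0// ltW.
move: (lyapunov _ _ _ _ _ 0) VBt => W VBt.
move: Lt L0; rewrite le_max => /orP[h1|h1] h2; clear - h1 h2 VX KX S0 X0 KB VBt; lra.
Qed.

(** * Slow variable *)

(** In the sum gamma q0 + p0 + p1 the friction - gamma p0 cancels with gamma q0', and the two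
    coupling terms cancel each other. *)
Lemma slow_variable (R : realType) (alpha gamma s0 s1 : R) (f : R -> R)
    (w0 w1 p0 q0 p1 q1 : R -> R) :
  continuous f ->
  path_solution R alpha gamma s0 s1 f w0 w1 p0 q0 p1 q1 ->
  exists D : R -> R, forall t : R, 0 <= t ->
    gamma * q0 t + p0 t + p1 t = D t + (s0 * w0 t + s1 * w1 t) /\
    is_derive t 1 D (- f (q0 t) - f (q1 t)).
Proof.
move=> cf ps.
have [A0 [A1 [B0 [B1 sm]]]] := path_solution_smooth _ _ _ _ _ _ _ _ _ _ _ _ cf ps.
exists (fun t => gamma * B0 t + A0 t + A1 t) => t t0.
have [[e0 e1] e2 e3 [dB0 dB1] [dA0 dA1]] := sm t t0; split.
  by rewrite e0 e2 e3; ring.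
have h := is_derive_addf _ _ _ _ _ _ (is_derive_addf _ _ _ _ _ _
  (is_derive_scalef _ gamma _ _ _ dB0) dA0) dA1.
by apply: is_derive_eq h _; ring.
Qed.

Lemma continuous_slow_variable (R : realType) (alpha gamma s0 s1 : R) (f : R -> R)
    (w0 w1 p0 q0 p1 q1 : R -> R) :
  path_solution R alpha gamma s0 s1 f w0 w1 p0 q0 p1 q1 ->
  continuous (fun t : R => gamma * q0 (Num.max 0 t) + p0 (Num.max 0 t) + p1 (Num.max 0 t)).
Proof.
case=> _ _ cp0 cq0 cp1 _ _.
apply: continuous_addf; last exact: (continuous_clamp _ _ cp1).
apply: continuous_addf; last exact: (continuous_clamp _ _ cp0).
exact/continuous_scalef/(continuous_clamp _ _ cq0).
Qed.

(** After the last time at which Q <= r, both positions exceed q, so the force is nonnegative and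
    the drift cannot raise Q. The noise changes by less than 2 * (r / 2) since then. *)
Lemma slow_variable_upper (R : realType) (alpha gamma s0 s1 : R) (f : R -> R)
    (w0 w1 p0 q0 p1 q1 : R -> R) (q zeta r t : R) :
  0 < gamma -> continuous f -> (forall x, q <= x -> 0 <= f x) ->
  path_solution R alpha gamma s0 s1 f w0 w1 p0 q0 p1 q1 ->
  0 <= t -> gamma * (q + zeta) + 2 * zeta <= r ->
  (forall u : R, 0 <= u <= t ->
    [/\ `|p0 u| <= zeta, `|p1 u| <= zeta & `|q1 u - q0 u| <= zeta]) ->
  gamma * q0 0 + p0 0 + p1 0 <= r ->
  (forall u : R, 0 <= u <= t -> `|s0 * w0 u + s1 * w1 u| < r / 2) ->
  gamma * q0 t + p0 t + p1 t < 2 * r.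
Proof.
move=> g0 cf fpos ps t0 rq Zb Q0 Wb.
have [D hD] := slow_variable _ _ _ _ _ _ _ _ _ _ _ _ cf ps.
have cQ := continuous_slow_variable _ _ _ _ _ _ _ _ _ _ _ _ ps.
pose Q := fun t : R => gamma * q0 t + p0 t + p1 t.
have Qm (u : R) : 0 <= u -> gamma * q0 (Num.max 0 u) + p0 (Num.max 0 u) + p1 (Num.max 0 u) = Q u.
  by move=> u0; rewrite max_r.
have [Qt|Qt] := lerP (Q t) r.
  have h := Wb t; have z := Zb t.
  have tt : 0 <= t <= t by rewrite t0 lexx.
  have := Wb t tt; have := normr_ge0 (s0 * w0 t + s1 * w1 t).
  by rewrite /Q in Qt; lra.
have [||s [/andP[s0' st] Qs above]] := last_time_below R _ r t cQ t0.
- by rewrite Qm.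
- by rewrite Qm.
rewrite Qm// in Qs.
have {}st : s < t.
  by rewrite lt_neqAle st andbT; apply/eqP => e; rewrite e in Qs; lra.
have [|c cst DE] := MVT_strict R D (fun u => - f (q0 u) - f (q1 u)) s t st.
  by move=> x /andP[sx xt]; have [] := hD x (le_trans s0' sx).
have /andP[sc ct] := cst.
have c0 : 0 <= c by lra.
have := above c; rewrite sc (ltW ct) Qm// => /(_ isT) Qc.
have cc : 0 <= c <= t by rewrite c0 ltW.
have [] := Zb c cc; rewrite !ler_norml => /andP[a1 a2] /andP[a3 a4] /andP[a5 a6].
have qq0 : q + zeta <= q0 c.
  have : gamma * (q + zeta) <= gamma * q0 c by rewrite /Q in Qc; lra.
  by rewrite ler_pM2l.
have f0 : 0 <= f (q0 c) by apply: fpos; lra.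
have f1 : 0 <= f (q1 c) by apply: fpos; lra.
have DD : D t - D s <= 0.
  rewrite DE mulr_le0_ge0//; [lra|rewrite subr_ge0; exact: ltW].
have [e1 _] := hD t t0; have [e2 _] := hD s s0'.
have ss : 0 <= s <= t by rewrite s0' ltW.
have tt : 0 <= t <= t by rewrite t0 lexx.
have := Wb s ss; have := Wb t tt; rewrite !ltr_norml => /andP[b1 b2] /andP[b3 b4].
by move: Qs; rewrite /Q e1 e2; lra.
Qed.

(** The bound F on the force is known only while Q > theta, so the estimate is bootstrapped: it is
    still valid up to the first time at which Q <= theta, and there it gives Q > theta, a
    contradiction. *)
Lemma slow_variable_lower (R : realType) (alpha gamma s0 s1 : R) (f : R -> R)
    (w0 w1 p0 q0 p1 q1 : R -> R) (theta F t : R) :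
  continuous f ->
  path_solution R alpha gamma s0 s1 f w0 w1 p0 q0 p1 q1 ->
  0 <= t ->
  (forall u : R, 0 <= u <= t -> theta < gamma * q0 u + p0 u + p1 u ->
    `|f (q0 u)| + `|f (q1 u)| <= F) ->
  theta < gamma * q0 0 + p0 0 + p1 0 ->
  (forall u : R, 0 <= u <= t ->
    theta < gamma * q0 0 + p0 0 + p1 0 + (s0 * w0 u + s1 * w1 u) - F * u) ->
  w0 0 = 0 -> w1 0 = 0 ->
  gamma * q0 0 + p0 0 + p1 0 + (s0 * w0 t + s1 * w1 t) - F * t <=
    gamma * q0 t + p0 t + p1 t.
Proof.
move=> cf ps t0 fb Q0 Wb w00 w10.
have [D hD] := slow_variable _ _ _ _ _ _ _ _ _ _ _ _ cf ps.
have cQ := continuous_slow_variable _ _ _ _ _ _ _ _ _ _ _ _ ps.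
pose Q := fun t : R => gamma * q0 t + p0 t + p1 t.
have Qm (u : R) : 0 <= u -> gamma * q0 (Num.max 0 u) + p0 (Num.max 0 u) + p1 (Num.max 0 u) = Q u.
  by move=> u0; rewrite max_r.
have low (u : R) : 0 <= u <= t -> (forall v : R, 0 <= v < u -> theta < Q v) ->
    Q 0 + (s0 * w0 u + s1 * w1 u) - F * u <= Q u.
  move=> /andP[u0 ut] hv.
  have [e1 _] := hD u u0; have [e2 _] := hD 0 (lexx _).
  rewrite /Q e1 e2 w00 w10 !mulr0 !addr0.
  suff : - (F * u) <= D u - D 0 by lra.
  move: u0; rewrite le_eqVlt => /predU1P[<-|u0]; first by rewrite mulr0 oppr0 subrr.
  have [|c /andP[c0 cu] ->] := MVT_strict R D (fun u => - f (q0 u) - f (q1 u)) 0 u u0.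
    by move=> x /andP[x0 _]; have [] := hD x x0.
  have cc : 0 <= c <= t by apply/andP; split; lra.
  have := fb c cc (hv c _); rewrite (ltW c0) cu => /(_ isT) h.
  rewrite subr0 -mulNr ler_pM2r//.
  have := ler_norm (f (q0 c)); have := ler_norm (f (q1 c)); lra.
have tt : 0 <= t <= t by rewrite t0 lexx.
apply: (low t tt).
move=> v /andP[v0 vt]; rewrite ltNge; apply/negP => Qv.
have [||s [/andP[s0' sv] Qs above]] := first_time_below R _ theta v cQ v0.
- by rewrite Qm.
- by rewrite Qm.
rewrite Qm// in Qs.
have st : 0 <= s <= t by apply/andP; split; lra.
have : theta < Q 0 + (s0 * w0 s + s1 * w1 s) - F * s by exact: Wb.
move: Qs; rewrite leNgt => /negP Qs h2; apply: Qs; apply: (lt_le_trans h2); apply: (low s st).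
move=> u /andP[u0 us]; have := above u; rewrite u0 us Qm//; exact.
Qed.

(** * Picard iteration *)

Lemma geometric_increments_cvg (R : realType) (u : nat -> R) (C : R) :
  (forall n, `|u n.+1 - u n| <= C * (1 / 2) ^+ n) ->
  cvgn u /\ forall n, `|u n - limn u| <= 2 * C * (1 / 2) ^+ n.
Proof.
move=> du.
have C0 : 0 <= C by have := du 0%N; rewrite expr0 mulr1; exact: le_trans.
have dist (n m : nat) : `|u (n + m)%N - u n| <= 2 * C * (1 / 2) ^+ n - 2 * C * (1 / 2) ^+ (n + m).
  elim: m => [|m IH]; first by rewrite addn0 !subrr normr0.
  have -> : u (n + m.+1)%N - u n = (u (n + m).+1 - u (n + m)%N) + (u (n + m)%N - u n).
    by rewrite addnS; ring.
  apply: le_trans (ler_normD _ _) _; apply: (le_trans (lerD (du _) IH)).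
  by rewrite addnS [(1 / 2) ^+ (n + m).+1]exprS; lra.
have pos (n : nat) : 0 <= C * (1 / 2 : R) ^+ n.
  by rewrite mulr_ge0// exprn_ge0//; lra.
have distle (n m : nat) : (n <= m)%N -> `|u m - u n| <= 2 * C * (1 / 2) ^+ n.
  by move=> nm; have := dist n (m - n)%N; rewrite subnKC//; have := pos m; lra.
have small : (fun n : nat => 2 * C * (1 / 2 : R) ^+ n) @ \oo --> (0 : R).
  rewrite -[X in _ --> X](mulr0 (2 * C)); apply: cvgM; first exact: cvg_cst.
  by apply: cvg_expr; rewrite ger0_norm; lra.
have cu : cvgn u.
  apply/cauchy_cvgP/cauchy_ballP => e e0.
  have e2 : 0 < e / 2 by lra.
  have /cvgrPdist_lt/(_ _ e2)[N _ HN] := small.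
  have hN (m : nat) : (N <= m)%N -> `|u N - u m| < e / 2.
    move=> Nm; have := distle N m Nm; have := HN N (leqnn N).
    rewrite sub0r normrN distrC => h1 h2; apply: (le_lt_trans h2).
    by apply: le_lt_trans h1; exact: ler_norm.
  exists ([set x | `|u N - x| < e / 2], [set x | `|u N - x| < e / 2]) => /=.
    by split; exists N => // m /= Nm; exact: hN.
  move=> [x y] /= [hx hy]; rewrite /ball/=.
  have -> : x - y = (u N - y) - (u N - x) by ring.
  by apply: le_lt_trans (ler_normB _ _) _; lra.
split=> // n; rewrite distrC.
have cl : (fun m => `|u m - u n|) @ \oo --> `|limn u - u n|.
  by apply: cvg_norm; apply: cvgB => //; exact: cvg_cst.
apply: (cvgr_to_le cl); near=> m; apply: distle; near: m; exact: nbhs_infty_ge.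
Unshelve. all: by end_near. Qed.

Lemma riemann_sum_cvg (R : realType) (h : R -> R) (t : R) : continuous h -> 0 <= t ->
  (fun n : nat => \sum_(0 <= i < n.+1) t / n.+1%:R * h (t / n.+1%:R * i%:R)) @ \oo -->
    Rintegral lebesgue_measure `[0, t] h.
Proof.
move=> ch t0; have [G [dG GE]] := antiderivative _ _ ch.
rewrite GE//; apply/cvgrPdist_lt => e e0.
pose e' : R := e / (t + 1).
have e'0 : 0 < e' by rewrite divr_gt0//; lra.
have [d d0 hd] := uniform_continuity_segment R h 0 t e' ch e'0.
near=> n.
have n0 : 0 < (n.+1%:R : R) by rewrite ltr0n.
have nd : t / n.+1%:R < d.
  rewrite ltr_pdivrMr// -ltr_pdivrMl// mulrC.
  have : t / d < n%:R by near: n; exact: nbhs_infty_gtr.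
  by move/lt_le_trans; apply; rewrite ler_nat.
set k := t / n.+1%:R in nd *.
have k0 : 0 <= k by rewrite divr_ge0// ltW.
have -> : G t - G 0 = \sum_(0 <= i < n.+1) (G (k * i.+1%:R) - G (k * i%:R)).
  rewrite (@telescope_sumr _ _ _ (fun i => G (k * i%:R)))//.
  by rewrite mulr0 /k divfK// gt_eqF.
rewrite -sumrB; apply: le_lt_trans (ler_norm_sum _ _ _) _.
apply: (@le_lt_trans _ _ (\sum_(0 <= i < n.+1) k * e')); last first.
  rewrite big_const_nat subn0 iter_addr_0 -mulr_natr /k /e'.
  have -> : t / n.+1%:R * (e / (t + 1)) * n.+1%:R = t / (t + 1) * e.
    by field; rewrite !gt_eqF//; lra.
  rewrite gtr_pMl// ltr_pdivrMr; lra.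
rewrite !big_mkord; apply: ler_sum => i _.
have ki : 0 <= k * i%:R by rewrite mulr_ge0.
have kit : k * i.+1%:R <= t.
  rewrite /k mulrAC ler_pdivrMr// ler_wpM2l// ler_nat; exact: ltn_ord.
have kk : k * i%:R <= k * i.+1%:R by rewrite ler_wpM2l// ler_nat.
have dG' (x : R) : k * i%:R <= x <= k * i.+1%:R -> is_derive x 1 G (h x).
  by move=> /andP[xi _]; apply: dG; exact: le_trans xi.
have [x /andP[x1 x2] ->] := MVT_right R G h _ _ kk dG'.
have -> : h x * (k * i.+1%:R - k * i%:R) - k * h (k * i%:R) = k * (h x - h (k * i%:R)).
  by rewrite -natr1; ring.
rewrite normrM (ger0_norm k0) ler_wpM2l// ltW// hd//.
  by rewrite ki (le_trans kk).
rewrite ger0_norm ?subr_ge0//; apply: le_lt_trans nd.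
have : x <= k * i%:R + k by rewrite -natr1 in x2; rewrite mulrDr mulr1 in x2.
lra.
Unshelve. all: by end_near. Qed.

(** The integral is a pointwise limit of left Riemann sums, each a finite sum of measurable
    functions of the sample. *)
Lemma measurable_Rintegral_path (R : realType) (d : measure_display)
    (Omega : measurableType d) (h : R -> Omega -> R) (t : R) :
  (forall om, continuous (fun s => h s om)) ->
  (forall s, measurable_fun setT (h s)) -> 0 <= t ->
  measurable_fun setT
    (fun om => Rintegral lebesgue_measure `[0, t] (fun s => h s om)).
Proof.
move=> ch mh t0.
apply: (@measurable_fun_cvg _ _ _ _ (fun (n : nat) om =>
   \sum_(0 <= i < n.+1) t / n.+1%:R * h (t / n.+1%:R * i%:R) om)).
  move=> n; apply: measurable_sum => i.
  by apply: measurable_funM => //; exact: measurable_cst.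
by move=> om _; exact: riemann_sum_cvg.
Qed.

Section Picard.
Variables (R : realType) (I : finType) (F : (I -> R) -> I -> R) (Lam : R).
Hypothesis Lam_gt0 : 0 < Lam.
Hypothesis F_lip : forall (u v : I -> R) (c : R),
  (forall j, `|u j - v j| <= c) -> forall i, `|F u i - F v i| <= Lam * c.
Hypothesis F_cont : forall x : I -> R -> R, (forall j, continuous (x j)) ->
  forall i, continuous (fun s => F (fun j => x j s) i).

(** Time is clamped at 0, so that all iterates are continuous functions on the whole line. *)
Definition picard_step (g x : I -> R -> R) : I -> R -> R := fun i t =>
  g i (Num.max 0 t) +
  Rintegral lebesgue_measure `[0, Num.max 0 t] (fun s => F (fun j => x j s) i).

Definition picard_iter (g : I -> R -> R) (n : nat) : I -> R -> R :=
  iter n (picard_step g) (fun i t => g i (Num.max 0 t)).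

Definition picard_limit (g : I -> R -> R) : I -> R -> R := fun i t =>
  limn (fun n => picard_iter g n i t).

Lemma continuous_clamped_primitive (h : R -> R) : continuous h ->
  continuous (fun t : R => Rintegral lebesgue_measure `[0, Num.max 0 t] h).
Proof.
move=> ch; have [G [dG GE]] := antiderivative _ _ ch.
have m0 (t : R) : 0 <= Num.max 0 t by rewrite le_max lexx.
have -> : (fun t : R => Rintegral lebesgue_measure `[0, Num.max 0 t] h) =
    (fun t => G (Num.max 0 t) - G 0) by apply/funext => t; rewrite GE.
apply: continuous_subf; last by move=> x; exact: cvg_cst.
move=> x; apply: (@continuous_comp _ _ _ (fun t : R => Num.max 0 t) G).
  by apply: continuous_max; [exact: cvg_cst|exact: cvg_id].
exact: is_derive_continuous_at (dG _ (m0 x)).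
Qed.

Variable g : I -> R -> R.
Hypothesis g_cont : forall i, continuous (fun t : R => g i (Num.max 0 t)).

Lemma picard_iter_continuous n i : continuous (picard_iter g n i).
Proof.
elim: n i => [|n IH] i /=; first exact: g_cont.
by apply: continuous_addf => //; exact/continuous_clamped_primitive/F_cont.
Qed.

Lemma Rintegral_dist (h k : R -> R) (c dc : R -> R) (t : R) :
  continuous h -> continuous k -> 0 <= t ->
  (forall s : R, 0 <= s -> is_derive s 1 c (dc s)) -> 0 <= c 0 ->
  (forall s : R, 0 <= s <= t -> `|h s - k s| <= dc s) ->
  `|Rintegral lebesgue_measure `[0, t] h - Rintegral lebesgue_measure `[0, t] k| <= c t.
Proof.
move=> ch ck t0 dcE c0 hk.
have [G [dG GE]] := antiderivative _ _ ch; have [H [dH HE]] := antiderivative _ _ ck.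
rewrite GE// HE// ler_norml.
have d1 (s : R) : 0 <= s <= t -> is_derive s 1 (fun x => c x - (G x - H x)) (dc s - (h s - k s)).
  move=> /andP[s0 _]; apply: is_derive_subf; first exact: dcE.
  by apply: is_derive_subf; [exact: dG|exact: dH].
have d2 (s : R) : 0 <= s <= t -> is_derive s 1 (fun x => c x - (H x - G x)) (dc s - (k s - h s)).
  move=> /andP[s0 _]; apply: is_derive_subf; first exact: dcE.
  by apply: is_derive_subf; [exact: dH|exact: dG].
have [x xt e1] := MVT_right R _ _ _ _ t0 d1.
have [y yt e2] := MVT_right R _ _ _ _ t0 d2.
have := hk x xt; have := hk y yt; rewrite !ler_norml => /andP[a1 a2] /andP[a3 a4].
have b1 : 0 <= (dc x - (h x - k x)) * (t - 0) by rewrite subr0 mulr_ge0//; lra.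
have b2 : 0 <= (dc y - (k y - h y)) * (t - 0) by rewrite subr0 mulr_ge0//; lra.
lra.
Qed.

(** In the norm weighted by exp (- 2 Lam t) one Picard step halves distances. The iteration hence
    converges on all of [0, tau] at once, without gluing short intervals. *)
Lemma picard_iter_increments (tau : R) : 0 <= tau -> exists2 D : R, 0 <= D &
  forall n i (t : R), t <= tau ->
    `|picard_iter g n.+1 i t - picard_iter g n i t| <= D * (1 / 2) ^+ n.
Proof.
move=> tau0.
have /choice[Di hD] : forall i, exists D : R, 0 < D /\ forall t, 0 <= t <= tau ->
    `|picard_iter g 1 i t - picard_iter g 0 i t| <= D.
  move=> i.
  have [|D D0 hD] := continuous_bounded_segment R
    (fun t => picard_iter g 1 i t - picard_iter g 0 i t) 0 tau.
    by apply: continuous_subf; exact: picard_iter_continuous.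
  by exists D.
pose D0 : R := \sum_i Di i.
have DiD i : Di i <= D0.
  rewrite /D0 (bigD1 i)//= lerDl; apply: sumr_ge0 => j _; exact: ltW (hD j).1.
have D00 : 0 <= D0 by apply: sumr_ge0 => j _; exact: ltW (hD j).1.
have key n i (t : R) : 0 <= t <= tau ->
    `|picard_iter g n.+1 i t - picard_iter g n i t| <= D0 * (1 / 2) ^+ n * expR (2 * Lam * t).
  elim: n i t => [|n IH] i t /andP[t0 tt].
    rewrite expr0 mulr1; apply: (le_trans ((hD i).2 t _)); first by rewrite t0.
    apply: (le_trans (DiD i)); rewrite ler_peMr// -expR0 ler_expR.
    by rewrite !mulr_ge0// ltW.
  have step m s : 0 <= s -> picard_iter g m.+1 i s = g i s +
      Rintegral lebesgue_measure `[0, s] (fun s => F (fun j => picard_iter g m j s) i).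
    by move=> s0; rewrite /= /picard_step max_r.
  rewrite (step n.+1)// (step n)// opprD addrACA subrr add0r.
  pose c := fun s : R => D0 * (1 / 2) ^+ n.+1 * expR (2 * Lam * s).
  pose dc := fun s : R => Lam * (D0 * (1 / 2) ^+ n * expR (2 * Lam * s)).
  apply: (@Rintegral_dist _ _ c dc) => //.
  - by apply: F_cont => j; exact: picard_iter_continuous.
  - by apply: F_cont => j; exact: picard_iter_continuous.
  - move=> s s0.
    have l : is_derive s 1 (fun x : R => 2 * Lam * x) (2 * Lam).
      by apply: is_derive_eq (is_derive_scalef _ _ _ _ _ (is_derive_id s 1)) _; rewrite mulr1.
    have e := @is_derive1_comp R expR (fun x : R => 2 * Lam * x) s _ _ (is_derive_expR _) l.
    apply: is_derive_eq (is_derive_scalef _ (D0 * (1 / 2) ^+ n.+1) _ _ _ e) _.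
    by rewrite /dc exprS; field.
  - by rewrite /c !mulr_ge0 ?expR_ge0// exprn_ge0//; lra.
  - move=> s /andP[s0 st]; apply: F_lip => j; apply: IH.
    by rewrite s0 (le_trans st).
exists (D0 * expR (2 * Lam * tau)) => [|n i t tt]; first by rewrite mulr_ge0 ?expR_ge0.
have cl m : picard_iter g m i t = picard_iter g m i (Num.max 0 t).
  by case: m => [|m] /=; rewrite ?/picard_step (max_r (_ : 0 <= Num.max 0 t))// le_max lexx.
rewrite (cl n.+1) (cl n); apply: (le_trans (key n i _ _)).
  by rewrite le_max lexx ge_max tau0.
have hp : 0 <= (1 / 2 : R) ^+ n by rewrite exprn_ge0//; lra.
rewrite mulrAC; apply: ler_wpM2r => //; apply: ler_wpM2l => //.
by rewrite ler_expR ler_pM2l ?mulr_gt0// ge_max tau0.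
Qed.

Lemma picard_limit_uniform (tau : R) : 0 <= tau -> exists2 D : R, 0 <= D &
  forall n i (t : R), t <= tau ->
    picard_iter g ^~ i ^~ t @ \oo --> picard_limit g i t /\
    `|picard_iter g n i t - picard_limit g i t| <= D * (1 / 2) ^+ n.
Proof.
move=> /picard_iter_increments[D D0 hD]; exists (2 * D) => [|n i t tt].
  by rewrite mulr_ge0.
by have [cu hu] := geometric_increments_cvg R (fun n => picard_iter g n i t) D
  (fun n => hD n i t tt).
Qed.

Lemma half_pow_small (c e : R) : 0 < e -> exists n : nat, c * (1 / 2) ^+ n < e.
Proof.
move=> e0.
have small : (fun n : nat => c * (1 / 2 : R) ^+ n) @ \oo --> (0 : R).
  rewrite -[X in _ --> X](mulr0 c); apply: cvgM; first exact: cvg_cst.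
  by apply: cvg_expr; rewrite ger0_norm; lra.
have /cvgrPdist_lt/(_ _ e0)[N _ HN] := small.
exists N; have := HN N (leqnn N); rewrite sub0r normrN.
exact: le_lt_trans (ler_norm _).
Qed.

Lemma picard_limit_continuous i : continuous (picard_limit g i).
Proof.
move=> x; apply/cvgrPdist_lt => e e0.
pose tau : R := Num.max 0 (x + 1).
have tau0 : 0 <= tau by rewrite le_max lexx.
have [D D0 hD] := picard_limit_uniform tau tau0.
have e3 : 0 < e / 3 by lra.
have [n hn] := half_pow_small D (e / 3) e3.
have /cvgrPdist_lt/(_ _ e3) := @picard_iter_continuous n i x.
move=> near_n; near=> y.
have xt : x <= tau by rewrite le_max lerDl ler01 orbT.
have yt : y <= tau.
  have : y < x + 1 by near: y; apply: lt_nbhsl; rewrite ltrDl.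
  by move=> /ltW h; rewrite le_max h orbT.
have h1 := (hD n i x xt).2; have h2 := (hD n i y yt).2.
have h3 : `|picard_iter g n i x - picard_iter g n i y| < e / 3 by near: y.
move: h1 h3; set a := picard_iter g n i x; set b := picard_limit g i x.
set a' := picard_iter g n i y in h2 *; set b' := picard_limit g i y in h2 *.
move=> h1 h3.
have -> : b - b' = (a - a') - (a - b) + (a' - b') by ring.
apply: le_lt_trans (ler_normD _ _) _.
have := ler_normB (a - a') (a - b); lra.
Unshelve. all: by end_near. Qed.

Lemma picard_limitE i (t : R) : 0 <= t ->
  picard_limit g i t = g i t +
    Rintegral lebesgue_measure `[0, t] (fun s => F (fun j => picard_limit g j s) i).
Proof.
move=> t0.
have [D D0 hD] := picard_limit_uniform t t0.
have cX : continuous (fun s => F (fun j => picard_limit g j s) i).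
  by apply: F_cont => j; exact: picard_limit_continuous.
set J := Rintegral _ _ _; apply/eqP; rewrite -subr_eq0 -normr_le0 leNgt.
apply/negP => e0.
have [n hn] := half_pow_small (D + Lam * D * t) _ e0.
have h1 := (hD n.+1 i t (lexx _)).2.
have cn : continuous (fun s => F (fun j => picard_iter g n j s) i).
  by apply: F_cont => j; exact: picard_iter_continuous.
have h2 : `|Rintegral lebesgue_measure `[0, t] (fun s => F (fun j => picard_iter g n j s) i) - J|
    <= Lam * (D * (1 / 2) ^+ n) * t.
  apply: (@Rintegral_dist _ _ (fun s => Lam * (D * (1 / 2) ^+ n) * s)
      (fun=> Lam * (D * (1 / 2) ^+ n))) => //.
  - move=> s _; apply: is_derive_eq (is_derive_scalef _ _ _ _ _ (is_derive_id s 1)) _.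
    by rewrite mulr1.
  - by rewrite mulr0.
  - by move=> s /andP[s0 st]; apply: F_lip => j; exact: (hD n j s st).2.
have e1 : picard_iter g n.+1 i t = g i t +
    Rintegral lebesgue_measure `[0, t] (fun s => F (fun j => picard_iter g n j s) i).
  by rewrite /= /picard_step max_r.
move: hn h1 h2; rewrite e1; set K := Rintegral _ _ _; set X := picard_limit _ _ _.
move=> hn h1 h2.
have : `|X - (g i t + J)| <= `|g i t + K - X| + `|K - J|.
  have -> : X - (g i t + J) = (K - J) - (g i t + K - X) by ring.
  by rewrite [leRHS]addrC; exact: ler_normB.
have : D * (1 / 2 : R) ^+ n.+1 <= D * (1 / 2 : R) ^+ n.
  rewrite exprS ler_wpM2l//.
  have : 0 <= (1 / 2 : R) ^+ n by rewrite exprn_ge0//; lra.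
  lra.
lra.
Qed.

End Picard.

(** Every iterate is measurable in the sample by induction, the integral included, and so is the
    pointwise limit. This is the reason for an explicit iteration instead of an abstract fixed
    point. *)
Lemma measurable_picard_limit (R : realType) (I : finType) (F : (I -> R) -> I -> R)
    (Lam : R) (d : measure_display) (Omega : measurableType d)
    (g : Omega -> I -> R -> R) :
  0 < Lam ->
  (forall (u v : I -> R) (c : R), (forall j, `|u j - v j| <= c) ->
    forall i, `|F u i - F v i| <= Lam * c) ->
  (forall x : I -> R -> R, (forall j, continuous (x j)) ->
    forall i, continuous (fun s => F (fun j => x j s) i)) ->
  (forall x : Omega -> I -> R, (forall j, measurable_fun setT (x ^~ j)) ->
    forall i, measurable_fun setT (fun om => F (x om) i)) ->
  (forall om i, continuous (fun t : R => g om i (Num.max 0 t))) ->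
  (forall i t, measurable_fun setT (fun om => g om i (Num.max 0 t))) ->
  forall i t, measurable_fun setT (fun om => picard_limit R I F (g om) i t).
Proof.
move=> L0 Fl Fc Fm gc gm i t.
apply: (@measurable_fun_cvg _ _ _ _ (fun n om => picard_iter R I F (g om) n i t)).
  move=> n; elim: n i t => [|n IH] i t /=; first exact: gm.
  apply: measurable_funD; first exact: gm.
  apply: (@measurable_Rintegral_path R d Omega
    (fun s om => F (fun j => picard_iter R I F (g om) n j s) i)).
  - move=> om; apply: (Fc _) => j.
    exact: (picard_iter_continuous R I F Fc (g om) (gc om) n j).
  - by move=> s; apply: (Fm _) => j; exact: IH.
  - by rewrite le_max lexx.
move=> om _.
have tau0 : 0 <= Num.max 0 t by rewrite le_max lexx.
have [D D0 hD] := picard_limit_uniform R I F Lam L0 Fl Fc (g om) (gc om) _ tau0.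
by have [] := hD 0%N i t; first by rewrite le_max lexx orbT.
Qed.

(** * Solution flow and invariance *)

Lemma is_solution_path (R : realType) (alpha gamma T Tinf : R) (V1 : R -> R)
    (d : measure_display) (Omega : measurableType d) (P : probability Omega R)
    (mu0 : set (state R) -> \bar R)
    (xi : Omega -> state R) (w0 w1 p0 q0 p1 q1 : R -> Omega -> R) :
  driving_noise P mu0 xi w0 w1 ->
  is_solution alpha gamma T Tinf V1 xi w0 w1 p0 q0 p1 q1 ->
  forall om, path_solution R alpha gamma
    (Num.sqrt (2 * gamma * T)) (Num.sqrt (2 * gamma * Tinf)) (derive1 V1)
    (w0 ^~ om) (w1 ^~ om) (p0 ^~ om) (q0 ^~ om) (p1 ^~ om) (q1 ^~ om).
Proof.
move=> [_ [_ [_ [_ [cw _]]]]] [_ sol] om.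
have [cw0 cw1] := cw om.
have [cp0 [cq0 [cp1 [cq1 [_ [_ [_ [_ eqs]]]]]]]] := sol om.
by split => // t t0; have [e1 [e2 [e3 e4]]] := eqs t t0.
Qed.

(** The grids in the definition of the noise start at 0. For 0 < s the grid 0 < s < t is used with
    no constraint on its first cell; for s = 0 a single cell is used. *)
Lemma driving_noise_increments (R : realType) (d : measure_display)
    (Omega : measurableType d) (P : probability Omega R)
    (x0 : state R) (xi : Omega -> state R) (w0 w1 : R -> Omega -> R) :
  driving_noise P (@dirac _ (state R) x0 R) xi w0 w1 ->
  gaussian_increments R d Omega P w0 /\ gaussian_increments R d Omega P w1.
Proof.
move=> [_ [mw0 [mw1 [w00 [cw law]]]]].
have pT (s t : R) : normal_prob 0 (Num.sqrt (t - s)) [set: R] = 1%E.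
  exact: (@probability_setT _ _ _ (normal_prob 0 (Num.sqrt (t - s)))).
pose inc (w : R -> Omega -> R) (s t : R) (om : Omega) : R := w t om - w s om.
have main (s t : R) (B C : set R) : 0 <= s -> s < t -> measurable B -> measurable C ->
    P (inc w0 s t @^-1` B `&` inc w1 s t @^-1` C) =
    (normal_prob 0 (Num.sqrt (t - s)) B * normal_prob 0 (Num.sqrt (t - s)) C)%E.
  move=> s0 st mB mC; move: s0; rewrite le_eqVlt => /predU1P[s0|s0].
    pose ts (i : nat) : R := i%:R * t.
    have ts0 : ts 0%N = 0 by rewrite /ts mul0r.
    have ts1 : ts 1%N = t by rewrite /ts mul1r.
    have tsi (i : nat) : (i < 1)%N -> ts i < ts i.+1.
      by rewrite ltnS leqn0 => /eqP->; rewrite ts0 ts1 s0.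
    have := law 1%N ts setT (fun=> B) (fun=> C) ts0 tsi measurableT (fun=> mB) (fun=> mC).
    rewrite big_ord1 /= ts0 ts1 -s0 diracT mul1e => <-.
    congr (P _); rewrite preimage_setT setTI; apply/seteqP; split => om /=.
      by move=> [h1 h2] i /=; rewrite ltnS leqn0 => /eqP->; rewrite ts0 ts1.
    by move=> /(_ 0%N (ltnSn _)); rewrite ts0 ts1.
  pose ts (i : nat) : R := if i == 0%N then 0 else if i == 1%N then s else t.
  have tsi (i : nat) : (i < 2)%N -> ts i < ts i.+1 by case: i => [|[|i]].
  pose B' (i : nat) := if i == 0%N then setT else B.
  pose C' (i : nat) := if i == 0%N then setT else C.
  have mB' i : measurable (B' i) by rewrite /B'; case: eqP.
  have mC' i : measurable (C' i) by rewrite /C'; case: eqP.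
  have := law 2%N ts setT B' C' erefl tsi measurableT mB' mC'.
  rewrite big_ord_recr big_ord1 /= /B' /C' /= /ts /= diracT mul1e !pT !mul1e => <-.
  congr (P _); rewrite preimage_setT setTI; apply/seteqP; split => om /=.
    by move=> [h1 h2] [|[|i]].
  by move=> /(_ 1%N (ltnSn _)).
split; split => //.
- by move=> om; case: (cw om).
- move=> s t B s0 st mB; have := main s t B setT s0 st mB measurableT.
  by rewrite preimage_setT setIT pT mule1.
- by move=> om; case: (cw om).
- move=> s t B s0 st mB; have := main s t setT B s0 st measurableT mB.
  by rewrite preimage_setT setTI pT mul1e.
Qed.

(** The first boolean tells positions ([true]) from momenta ([false]), the second is the index of
    the particle. *)
Definition langevin_drift (R : realType) (alpha gamma : R) (f : R -> R)
    (u : bool * bool -> R) (i : bool * bool) : R :=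
  match i with
  | (true, b) => u (false, b)
  | (false, false) => - f (u (true, false)) +
      alpha * (u (true, true) - u (true, false)) - gamma * u (false, false)
  | (false, true) => - f (u (true, true)) + alpha * (u (true, false) - u (true, true))
  end.

Lemma langevin_drift_lipschitz (R : realType) (alpha gamma L : R) (f : R -> R) :
  0 < alpha -> 0 < gamma -> 0 < L -> (forall x y, `|f x - f y| <= L * `|x - y|) ->
  forall (u v : bool * bool -> R) (c : R), (forall j, `|u j - v j| <= c) ->
  forall i, `|langevin_drift R alpha gamma f u i - langevin_drift R alpha gamma f v i|
    <= (1 + L + 2 * alpha + gamma) * c.
Proof.
move=> al0 g0 L0 fL u v c uv i.
have c0 : 0 <= c by rewrite (le_trans _ (uv (true, true))).
have Lc : 0 <= L * c by rewrite mulr_ge0// ltW.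
have ac : 0 <= alpha * c by rewrite mulr_ge0// ltW.
have gc : 0 <= gamma * c by rewrite mulr_ge0// ltW.
have fc j : `|f (u j) - f (v j)| <= L * c.
  by apply: (le_trans (fL _ _)); rewrite ler_pM2l.
have gu j : `|gamma * (u j - v j)| <= gamma * c by rewrite norm_mulr_le// ltW.
have au j k : `|alpha * ((u j - v j) - (u k - v k))| <= alpha * (2 * c).
  apply: norm_mulr_le; first exact: ltW.
  apply: le_trans (ler_normB _ _) _.
  by have := uv j; have := uv k; lra.
case: i => [] [] b /=.
- by have := uv (false, b); lra.
case: b.
- have -> : - f (u (true, true)) + alpha * (u (true, false) - u (true, true)) -
    (- f (v (true, true)) + alpha * (v (true, false) - v (true, true))) =
    alpha * ((u (true, false) - v (true, false)) - (u (true, true) - v (true, true)))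
    - (f (u (true, true)) - f (v (true, true))) by ring.
  apply: le_trans (ler_normB _ _) _.
  by have := fc (true, true); have := au (true, false) (true, true); lra.
- have -> : - f (u (true, false)) + alpha * (u (true, true) - u (true, false)) -
      gamma * u (false, false) -
    (- f (v (true, false)) + alpha * (v (true, true) - v (true, false)) -
      gamma * v (false, false)) =
    alpha * ((u (true, true) - v (true, true)) - (u (true, false) - v (true, false)))
    - (f (u (true, false)) - f (v (true, false)))
    - gamma * (u (false, false) - v (false, false)) by ring.
  apply: le_trans (ler_normB _ _) _.
  have := ler_normB (alpha * ((u (true, true) - v (true, true)) - (u (true, false) - v (true, false))))
     (f (u (true, false)) - f (v (true, false))).
  by have := fc (true, false); have := au (true, true) (true, false);
     have := gu (false, false); lra.
Qed.

(** The starting point is a coordinate of the sample space [state R * Omega]; any initial law can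
    then be imposed by choosing the measure on the first factor. *)
Lemma langevin_flow (R : realType) (alpha gamma T Tinf L : R) (V1 : R -> R)
    (d : measure_display) (Omega : measurableType d) (w0 w1 : R -> Omega -> R) :
  0 < alpha -> 0 < gamma -> 0 < L ->
  (forall x y, `|derive1 V1 x - derive1 V1 y| <= L * `|x - y|) ->
  continuous (derive1 V1) ->
  (forall t, measurable_fun setT (w0 t)) -> (forall t, measurable_fun setT (w1 t)) ->
  (forall om, w0 0 om = 0 /\ w1 0 om = 0) ->
  (forall om, {within [set t : R | 0 <= t], continuous (fun t => w0 t om)} /\
              {within [set t : R | 0 <= t], continuous (fun t => w1 t om)}) ->
  exists p0 q0 p1 q1 : R -> state R * Omega -> R,
    is_solution alpha gamma T Tinf V1 fst
      (fun t z => w0 t z.2) (fun t z => w1 t z.2) p0 q0 p1 q1.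
Proof.
move=> al0 g0 L0 fL cf mw0 mw1 w00 cw.
pose s0 : R := Num.sqrt (2 * gamma * T); pose s1 : R := Num.sqrt (2 * gamma * Tinf).
pose F := langevin_drift R alpha gamma (derive1 V1).
pose Lam : R := 1 + L + 2 * alpha + gamma.
have Lam0 : 0 < Lam by rewrite /Lam; lra.
have FL : forall (u v : bool * bool -> R) (c : R), (forall j, `|u j - v j| <= c) ->
    forall i, `|F u i - F v i| <= Lam * c by exact: langevin_drift_lipschitz.
have Fc : forall x : bool * bool -> R -> R, (forall j, continuous (x j)) ->
    forall i, continuous (fun s => F (fun j => x j s) i).
  move=> x cx [[] b]; first exact: cx.
  case: b => /=.
    apply: continuous_addf; first exact/continuous_oppf/(continuous_compf _ _ _ cf (cx _)).
    exact/continuous_scalef/continuous_subf.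
  apply: continuous_subf; last exact/continuous_scalef.
  apply: continuous_addf; first exact/continuous_oppf/(continuous_compf _ _ _ cf (cx _)).
  exact/continuous_scalef/continuous_subf.
have mf : measurable_fun setT (derive1 V1) by exact: continuous_measurable_fun.
have Fm : forall x : state R * Omega -> bool * bool -> R, (forall j, measurable_fun setT (x ^~ j)) ->
    forall i, measurable_fun setT (fun om => F (x om) i).
  move=> x mx [[] b]; first exact: mx.
  have mfx j : measurable_fun setT (fun om => derive1 V1 (x om j)).
    exact: (measurableT_comp mf (mx j)).
  case: b => /=.
    apply: measurable_funD; first exact: measurableT_comp.
    by apply: measurable_funM => //; exact: measurable_funB.
  apply: measurable_funB; last exact: measurable_funM.
  apply: measurable_funD; first exact: measurableT_comp.
  by apply: measurable_funM => //; exact: measurable_funB.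
pose g (z : state R * Omega) (i : bool * bool) (t : R) : R :=
  match i with
  | (false, false) => z.1.1.1.1 + s0 * w0 t z.2
  | (true, false) => z.1.1.1.2
  | (false, true) => z.1.1.2 + s1 * w1 t z.2
  | (true, true) => z.1.2
  end.
have cst (c : R) : continuous (fun _ : R => c) by move=> x; exact: cvg_cst.
have gc z i : continuous (fun t : R => g z i (Num.max 0 t)).
  case: i => [[] []] /=; try exact: cst; apply: continuous_addf; try exact: cst;
    apply: continuous_scalef.
  - exact: (continuous_clamp _ _ (cw z.2).2).
  - exact: (continuous_clamp _ _ (cw z.2).1).
have gm i t : measurable_fun setT (fun z => g z i (Num.max 0 t)).
  case: i => [[] []] /=.
  - exact: (measurableT_comp measurable_snd measurable_fst).
  - exact: (measurableT_comp (measurableT_comp measurable_snd measurable_fst)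
      (measurableT_comp measurable_fst measurable_fst)).
  - apply: measurable_funD.
      exact: (measurableT_comp measurable_snd (measurableT_comp measurable_fst measurable_fst)).
    by apply: measurable_funM => //; exact: (measurableT_comp (mw1 _) measurable_snd).
  - apply: measurable_funD.
      exact: (measurableT_comp measurable_fst (measurableT_comp measurable_fst
        (measurableT_comp measurable_fst measurable_fst))).
    by apply: measurable_funM => //; exact: (measurableT_comp (mw0 _) measurable_snd).
pose X (i : bool * bool) (t : R) (z : state R * Omega) := picard_limit R _ F (g z) i t.
have mX i t : measurable_fun setT (X i t).
  exact: (measurable_picard_limit R _ F Lam _ _ g Lam0 FL Fc Fm gc gm).
have cX z i : continuous (X i ^~ z).
  exact: (picard_limit_continuous R _ F Lam Lam0 FL Fc (g z) (gc z)).
have XE z i t : 0 <= t -> X i t z = g z i t +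
    Rintegral lebesgue_measure `[0, t] (fun s => F (fun j => X j s z) i).
  exact: (picard_limitE R _ F Lam Lam0 FL Fc (g z) (gc z)).
have X0 z i : X i 0 z = g z i 0.
  by rewrite XE// set_itv1 Rintegral_set1 addr0.
exists (X (false, false)), (X (true, false)), (X (false, true)), (X (true, true)).
split; first by move=> t; split; [|split; [|split]]; exact: mX.
move=> z; do 4 (split; first exact: continuous_subspaceT (cX z _)).
have [w0z w1z] := w00 z.2.
rewrite !X0 /= w0z w1z !mulr0 !addr0; do 4 split => //.
move=> t t0; rewrite !(XE z _ t t0) /=; split => //; split => //.
by split; rewrite addrAC.
Qed.

(* The law of the given noise is transported to the product of the state space
   and Omega, where the equation can be started from the invariant measure. *)
Lemma invariant_transfer (R : realType) (alpha gamma T Tinf L : R) (V1 : R -> R)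
    (mustar : probability (state R) R) (d : measure_display)
    (Omega : measurableType d) (P : probability Omega R) (x0 : state R)
    (xi : Omega -> state R) (w0 w1 : R -> Omega -> R)
    (G G' : set (state R)) (E : set Omega) (t : R) :
  0 < alpha -> 0 < gamma -> 0 < L ->
  (forall x y, `|derive1 V1 x - derive1 V1 y| <= L * `|x - y|) ->
  continuous (derive1 V1) ->
  invariant_measure alpha gamma T Tinf V1 mustar ->
  driving_noise P (@dirac _ (state R) x0 R) xi w0 w1 ->
  measurable G -> measurable G' -> measurable E -> 0 <= t ->
  (forall om (p0 q0 p1 q1 : R -> R), E om -> G (p0 0, q0 0, p1 0, q1 0) ->
    path_solution R alpha gamma
      (Num.sqrt (2 * gamma * T)) (Num.sqrt (2 * gamma * Tinf)) (derive1 V1)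
      (w0 ^~ om) (w1 ^~ om) p0 q0 p1 q1 -> G' (p0 t, q0 t, p1 t, q1 t)) ->
  (mustar G * P E <= mustar G')%E.
Proof.
move=> al0 g0 L0 fL cf inv noise mG mG' mE t0 step.
have [mxi [mw0 [mw1 [w00 [cw law]]]]] := noise.
have [p0 [q0 [p1 [q1 sol]]]] := langevin_flow R alpha gamma T Tinf L V1 d Omega w0 w1
  al0 g0 L0 fL cf mw0 mw1 w00 cw.
pose P' : probability (state R * Omega)%type R := (mustar \x P)%E.
have P'E (A : set (state R)) (B : set Omega) : measurable A -> measurable B ->
    P' (A `*` B) = (mustar A * P B)%E.
  by move=> mA mB; exact: product_measure1E.
pose w0' (s : R) (z : state R * Omega) := w0 s z.2.
pose w1' (s : R) (z : state R * Omega) := w1 s z.2.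
have noise' : driving_noise P' mustar fst w0' w1'.
  split; first exact: measurable_fst.
  split; first by move=> s; exact: (measurableT_comp (mw0 s) measurable_snd).
  split; first by move=> s; exact: (measurableT_comp (mw1 s) measurable_snd).
  split; first by move=> z; exact: w00.
  split; first by move=> z; exact: cw.
  move=> n ts A B C ts0 tsi mA mB mC.
  (* With the whole space as initial event the given product rule describes the noise alone; its
     independence from the new initial condition comes from the product measure. *)
  have := law n ts setT B C ts0 tsi measurableT mB mC.
  rewrite diracT mul1e preimage_setT setTI => <-.
  set cyl := (X in P X); have mcyl : measurable cyl.
    apply: bigcap_measurableType => i _; apply: measurableI;
      rewrite -[X in measurable X]setTI.
    - by apply: (measurable_funB (mw0 _) (mw0 _)).
    - by apply: (measurable_funB (mw1 _) (mw1 _)).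
  rewrite -(P'E A cyl mA mcyl); congr (P' _).
rewrite -P'E// -(inv _ _ P' fst w0' w1' p0 q0 p1 q1 noise' sol t t0 G' mG').
rewrite /law_at; apply: le_measure.
- by rewrite inE; exact: measurableX.
- rewrite inE -[X in measurable X]setTI.
  have [mp0 [mq0 [mp1 mq1]]] := sol.1 t.
  have m : measurable_fun setT (fun z => (p0 t z, q0 t z, p1 t z, q1 t z)).
    by do 3 (apply: measurable_fun_pair => //).
  exact: m.
- move=> z [/= Gz Ez].
  have path := is_solution_path R alpha gamma T Tinf V1 _ _ P' _ _ _ _ _ _ _ _ noise' sol z.
  apply: (step z.2 (p0 ^~ z) (q0 ^~ z) (p1 ^~ z) (q1 ^~ z)) => //.
  have [_ [_ [_ [_ [-> [-> [-> [-> _]]]]]]]] := sol.2 z.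
  by case: z.1 Gz {path Ez} => [[[]]].
Qed.

(** * Tail of the invariant measure *)

(** By independence the 2 N increments are all large with probability at least exp (- 2 l N). Some
    oscillation is too large with probability at most 8 (N + 1) exp (- (2 l + 33) N), which is at
    most half of that; what remains exceeds exp (- (2 l + 1) N). *)
Lemma noise_event (R : realType) (A : R) : 0 <= A ->
  exists l kappa : R, [/\ 0 < l, 0 < kappa &
  forall (d : measure_display) (Omega : measurableType d)
    (P : probability Omega R) (x0 : state R)
    (xi : Omega -> state R) (w0 w1 : R -> Omega -> R) (N : nat) (h : R),
  driving_noise P (@dirac _ (state R) x0 R) xi w0 w1 -> (0 < N)%N -> 0 < h ->
  exists E : set Omega, [/\ measurable E, ((expR (- (l * N%:R)))%:E <= P E)%E &
    forall om, E om ->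
      (forall i : nat, (i < N)%N ->
        A * Num.sqrt h <= w0 (i.+1%:R * h) om - w0 (i%:R * h) om /\
        A * Num.sqrt h <= w1 (i.+1%:R * h) om - w1 (i%:R * h) om) /\
      (forall (j : nat) (u : R), (j <= N)%N -> j%:R * h <= u <= j%:R * h + h ->
        `|w0 u om - w0 (j%:R * h) om| <= kappa * Num.sqrt N%:R * Num.sqrt h /\
        `|w1 u om - w1 (j%:R * h) om| <= kappa * Num.sqrt N%:R * Num.sqrt h)]].
Proof.
move=> A0; have [l l0 hl] := normal_right_tail R A A0.
(* The summand 1024 meets the requirement of [oscillation_tail]; the exponent a^2 / (64 h) becomes
   (16 + 2 l + 17) N = (2 l + 33) N. *)
pose kk : R := 1024 + 64 * (2 * l + 17).
have kk0 : 0 < kk by rewrite /kk; lra.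
exists (2 * l + 1), (Num.sqrt kk); split; rewrite ?sqrtr_gt0//; first by lra.
move=> d Omega P x0 xi w0 w1 N h noise N0 h0.
have [gi0 gi1] := driving_noise_increments R d Omega P x0 xi w0 w1 noise.
have [mxi [mw0 [mw1 [w00 [cw law]]]]] := noise.
have NR : 1 <= (N%:R : R) by rewrite ler1n.
pose a : R := Num.sqrt kk * Num.sqrt N%:R * Num.sqrt h.
have a0 : 0 <= a by rewrite /a !mulr_ge0 ?sqrtr_ge0.
have a2 : a ^+ 2 = kk * N%:R * h.
  by rewrite /a !exprMn !sqr_sqrtr ?(ltW kk0) ?(ltW h0)//.
have ah : 1024 * h <= a ^+ 2.
  rewrite a2 ler_pM2r// (le_trans _ (_ : kk * 1 <= kk * N%:R))//; last by rewrite ler_pM2l.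
  by rewrite /kk; lra.
pose eps : R := expR (- ((2 * l + 33) * N%:R)).
have epsE : 4 * expR (- (a ^+ 2 / (64 * h))) = 4 * eps.
  congr (4 * expR (- _)); rewrite a2 /kk; field; rewrite gt_eqF//.
have jh0 (j : nat) : 0 <= j%:R * h by rewrite mulr_ge0// ltW.
have osc (w : R -> Omega -> R) : gaussian_increments R d Omega P w ->
    exists E : nat -> set Omega, forall j, [/\ measurable (E j),
      (P (E j) <= (4 * eps)%:E)%E &
      forall om, ~ E j om -> forall u : R, j%:R * h <= u <= j%:R * h + h ->
        `|w u om - w (j%:R * h) om| <= a].
  move=> gi; suff /choice[E hE] : forall j : nat, exists E : set Omega, [/\ measurable E,
      (P E <= (4 * eps)%:E)%E &
      forall om, ~ E om -> forall u : R, j%:R * h <= u <= j%:R * h + h ->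
        `|w u om - w (j%:R * h) om| <= a] by exists E.
  by move=> j; rewrite -epsE; exact: oscillation_tail.
have [E0 hE0] := osc w0 gi0; have [E1 hE1] := osc w1 gi1.
(* One cell more than the climb uses: unit windows that start before N h may end after it. *)
pose Bad := \big[setU/set0]_(j < N.+1) (E0 j `|` E1 j).
have mBad : measurable Bad.
  by apply: bigsetU_measurable => j _; apply: measurableU; [case: (hE0 j)|case: (hE1 j)].
have PBad : (P Bad <= (8 * eps * N.+1%:R)%:E)%E.
  apply: (@le_trans _ _ (\sum_(j < N.+1) P (E0 j `|` E1 j))%E).
    apply: (@Boole_inequality _ _ _ P (fun j => E0 j `|` E1 j)) => j _.
    by apply: measurableU; [case: (hE0 j)|case: (hE1 j)].
  apply: (@le_trans _ _ (\sum_(j < N.+1) (8 * eps)%:E)%E).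
    apply: lee_sum => j _.
    have [m0 p0 _] := hE0 j; have [m1 p1 _] := hE1 j.
    apply: (le_trans (@measureU2 _ _ _ P _ _ m0 m1)).
    have -> : 8 * eps = 4 * eps + 4 * eps by ring.
    by rewrite EFinD leeD.
  by rewrite sumEFin sumr_const card_ord mulr_natr.
pose ts (i : nat) : R := i%:R * h.
have tsE i : ts i.+1 - ts i = h by rewrite /ts -natr1; ring.
pose B : set R := [set x : R | A * Num.sqrt h <= x].
have mB : measurable B.
  rewrite (_ : B = `[A * Num.sqrt h, +oo[%classic)//.
  by apply/seteqP; split => x /=; rewrite in_itv/= andbT.
pose Rect := \bigcap_(i in [set i | (i < N)%N])
  ((fun om => w0 (ts i.+1) om - w0 (ts i) om) @^-1` B `&`
   (fun om => w1 (ts i.+1) om - w1 (ts i) om) @^-1` B).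
have mRect : measurable Rect.
  apply: bigcap_measurableType => i _; apply: measurableI;
    rewrite -[X in measurable X]setTI.
  - by apply: (measurable_funB (mw0 _) (mw0 _)).
  - by apply: (measurable_funB (mw1 _) (mw1 _)).
have PRect : ((expR (- (2 * l * N%:R)))%:E <= P Rect)%E.
  have tsi (i : nat) : (i < N)%N -> ts i < ts i.+1.
    by move=> _; rewrite -subr_gt0 tsE.
  have ts0 : ts 0%N = 0 by rewrite /ts mul0r.
  have := law N ts setT (fun=> B) (fun=> B) ts0 tsi measurableT (fun=> mB) (fun=> mB).
  rewrite preimage_setT setTI -/Rect diracT mul1e => ->.
  under eq_bigr do rewrite tsE.
  have sh : 0 < Num.sqrt h by rewrite sqrtr_gt0.
  have := hl (Num.sqrt h) sh; rewrite -/B.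
  have : normal_prob 0 (Num.sqrt h) B \is a fin_num by exact: fin_num_measure.
  move: (normal_prob 0 (Num.sqrt h) B) => [q| |]// _ lq.
  rewrite lee_fin in lq.
  rewrite -EFinM prodEFin prodr_const card_ord lee_fin.
  have -> : expR (- (2 * l * N%:R)) = (expR (- l) * expR (- l)) ^+ N.
    by rewrite -expRD -expRM_natl; congr expR; ring.
  by rewrite lerXn2r ?nnegrE ?mulr_ge0 ?expR_ge0 ?ler_pM ?expR_ge0// (le_trans (expR_ge0 _) lq).
exists (Rect `\` Bad); split.
- exact: measurableD.
- have mE : measurable (Rect `\` Bad) by exact: measurableD.
  have le1 : (P Rect <= P (Rect `\` Bad) + P Bad)%E.
    apply: le_trans (@measureU2 _ _ _ P _ _ mE mBad).
    apply: le_measure; rewrite ?inE//; first exact: measurableU.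
    by move=> om Ro; have [|nb] := pselect (Bad om); [right|left].
  have f1 : P (Rect `\` Bad) \is a fin_num by exact: fin_num_measure.
  have f2 : P Bad \is a fin_num by exact: fin_num_measure.
  move: (le_trans PRect le1) PBad.
  move: (P (Rect `\` Bad)) (P Bad) f1 f2 => [x| |]// [y| |]// _ _.
  rewrite -EFinD !lee_fin => h1 h2.
  pose z : R := expR (- (2 * l * N%:R)).
  have e1 : eps = z * expR (- (33 * N%:R)).
    by rewrite /eps /z -expRD; congr expR; ring.
  have e2 : expR (- ((2 * l + 1) * N%:R)) = z * expR (- N%:R).
    by rewrite /z -expRD; congr expR; ring.
  have z0 : 0 < z by exact: expR_gt0.
  have e3 : expR (- (33 * N%:R)) * (1 + 33 * N%:R) <= 1 :> R.
    rewrite expRN ler_pdivrMl ?expR_gt0// mulr1; exact: expR_ge1Dx.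
  have e4 : expR (- N%:R) * (1 + N%:R) <= 1 :> R.
    rewrite expRN ler_pdivrMl ?expR_gt0// mulr1; exact: expR_ge1Dx.
  have e5 : 8 * expR (- (33 * N%:R)) * N.+1%:R <= 1 / 2 :> R.
    rewrite -natr1; have := @expR_gt0 R (- (33 * N%:R)).
    nra.
  have e6 : expR (- N%:R) <= 1 / 2 :> R.
    by have := @expR_gt0 R (- N%:R); nra.
  rewrite e2; rewrite -/z in h1; rewrite e1 in h2.
  have e7 : z * (8 * expR (- (33 * N%:R)) * N.+1%:R) <= z * (1 / 2) by rewrite ler_pM2l.
  have e8 : z * expR (- N%:R) <= z * (1 / 2) by rewrite ler_pM2l.
  lra.
- move=> om [Ro nb]; split.
    by move=> i iN; have [] := Ro i iN.
  move=> j u jN ju.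
  have nE : ~ (E0 j `|` E1 j) om.
    move=> hj; apply: nb; rewrite /Bad -(bigcup_mkord _ (fun j => E0 j `|` E1 j)).
    by exists j.
  have [_ _ h0'] := hE0 j; have [_ _ h1'] := hE1 j.
  by split; [apply: h0'|apply: h1'] => // hh; apply: nE; [left|right].
Qed.

(** * Propagation of fronts by invariance *)

Definition slow (R : realType) (gamma : R) (x : state R) : R :=
  gamma * x.1.1.2 + x.1.1.1 + x.1.2.

Definition fast_energy (R : realType) (alpha a : R) (x : state R) : R :=
  lyapunov R alpha a x.1.1.1 x.1.2 (x.2 - x.1.1.2).

Definition grid_controlled (R : realType) (A m h : R) (N : nat) (w : R -> R) :=
  (forall i : nat, (i < N)%N -> A * Num.sqrt h <= w (i.+1%:R * h) - w (i%:R * h)) /\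
  (forall (j : nat) (u : R), (j <= N)%N -> j%:R * h <= u <= j%:R * h + h ->
     `|w u - w (j%:R * h)| <= m).

Lemma grid_cell (R : realType) (h u : R) (N : nat) : 0 < h -> 0 <= u ->
  u <= N%:R * h + h -> exists2 j : nat, (j <= N)%N & j%:R * h <= u <= j%:R * h + h.
Proof.
move=> h0 u0 uN; have q0 : 0 <= u / h by rewrite divr_ge0// ltW.
have /andP[i1 i2] := truncn_itv q0.
have [jN|Nj] := leqP (Num.truncn (u / h)) N.
  exists (Num.truncn (u / h)) => //.
  rewrite -ler_pdivlMr// i1 /=.
  have : u < (Num.truncn (u / h)).+1%:R * h by rewrite -ltr_pdivrMr.
  have -> : ((Num.truncn (u / h)).+1%:R : R) = (Num.truncn (u / h))%:R + 1 by rewrite -natr1.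
  by rewrite mulrDl mul1r => /ltW.
exists N => //; rewrite uN andbT -ler_pdivlMr// (le_trans _ i1)// ler_nat.
exact: ltnW.
Qed.

(** The increments of the complete cells before u are added up; the incomplete cell costs at most
    one increment and one oscillation. *)
Lemma grid_controlled_lower (R : realType) (A m h u : R) (N : nat) (w : R -> R) :
  0 <= A -> 0 < h -> w 0 = 0 -> grid_controlled R A m h N w ->
  0 <= u -> u <= N%:R * h -> A * Num.sqrt h * (u / h - 1) - m <= w u.
Proof.
move=> A0 h0 w0 [inc osc] u0 uN.
have As0 : 0 <= A * Num.sqrt h by rewrite mulr_ge0// sqrtr_ge0.
have grid (j : nat) : (j <= N)%N -> j%:R * (A * Num.sqrt h) <= w (j%:R * h).
  elim: j => [|j IH] jN; first by rewrite !mul0r w0.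
  have := inc j jN; have := IH (ltnW jN).
  have -> : (j.+1%:R * (A * Num.sqrt h)) = j%:R * (A * Num.sqrt h) + A * Num.sqrt h.
    by rewrite -natr1; ring.
  lra.
have [|j jN ju] := grid_cell R h u N h0 u0; first by lra.
have := osc j u jN ju; have := grid j jN; rewrite ler_norml => g1 /andP[g2 _].
have uj : u / h - 1 <= j%:R.
  by rewrite lerBlDr ler_pdivrMr// mulrDl mul1r; case/andP: ju.
have : (A * Num.sqrt h) * (u / h - 1) <= (A * Num.sqrt h) * j%:R by rewrite ler_wpM2l.
lra.
Qed.

(** Since h >= 1, a unit window meets at most two consecutive cells, and three oscillations bound
    the difference. *)
Lemma grid_controlled_window (R : realType) (A m h : R) (N : nat) (w : R -> R) :
  1 <= h -> grid_controlled R A m h N w ->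
  forall u v : R, 0 <= u -> u <= v <= u + 1 -> v <= N%:R * h + 1 -> `|w v - w u| <= 3 * m.
Proof.
move=> h1 [_ osc] u v u0 /andP[uv vu] vN.
have h0 : 0 < h by lra.
have m0 : 0 <= m.
  apply: le_trans (osc 0%N 0 isT _); first exact: normr_ge0.
  by rewrite mul0r add0r lexx ltW.
have [|j jN ju] := grid_cell R h u N h0 u0; first by lra.
have /andP[ju1 ju2] := ju.
have o1 := osc j u jN ju.
have [vj|vj] := lerP v (j%:R * h + h).
  have o2 := osc j v jN ltac:(by rewrite vj andbT; lra).
  have -> : w v - w u = (w v - w (j%:R * h)) - (w u - w (j%:R * h)) by ring.
  apply: le_trans (ler_normB _ _) _; lra.
have jh : j.+1%:R * h = j%:R * h + h by rewrite -natr1; ring.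
have j1N : (j.+1 <= N)%N.
  have : j.+1%:R * h < N.+1%:R * h.
    by rewrite jh (_ : N.+1%:R * h = N%:R * h + h) -?natr1; [lra|ring].
  by rewrite ltr_pM2r// ltr_nat ltnS.
have o2 := osc j.+1 v j1N ltac:(rewrite jh; apply/andP; split; lra).
have o3 := osc j (j.+1%:R * h) jN ltac:(rewrite jh; apply/andP; split; lra).
have -> : w v - w u = (w v - w (j.+1%:R * h)) + (w (j.+1%:R * h) - w (j%:R * h))
  - (w u - w (j%:R * h)) by ring.
apply: le_trans (ler_normB _ _) _.
have := ler_normD (w v - w (j.+1%:R * h)) (w (j.+1%:R * h) - w (j%:R * h)); lra.
Qed.

(** On each cell the noise gains (s0 + s1) A sqrt h and the drift takes at most F h, leaving at
    least 4 sqrt h. Within a cell Q may drop by the subtracted cost, and [theta] lies below that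
    level so that the bound on the force persists. *)
Lemma climb (R : realType) (alpha gamma s0 s1 A m h theta F : R) (N : nat) (f : R -> R)
    (w0 w1 p0 q0 p1 q1 : R -> R) :
  0 <= s0 -> 0 <= s1 -> 0 <= A -> 0 < h -> continuous f ->
  path_solution R alpha gamma s0 s1 f w0 w1 p0 q0 p1 q1 ->
  w0 0 = 0 -> w1 0 = 0 ->
  grid_controlled R A m h N w0 -> grid_controlled R A m h N w1 ->
  F * h + 4 * Num.sqrt h <= (s0 + s1) * (A * Num.sqrt h) ->
  (forall u : R, 0 <= u <= N%:R * h -> theta < gamma * q0 u + p0 u + p1 u ->
    `|f (q0 u)| + `|f (q1 u)| <= F) ->
  theta < gamma * q0 0 + p0 0 + p1 0 - (s0 + s1) * (A * Num.sqrt h + m) ->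
  gamma * q0 0 + p0 0 + p1 0 + 4 * N%:R * Num.sqrt h - (s0 + s1) * (A * Num.sqrt h + m)
    <= gamma * q0 (N%:R * h) + p0 (N%:R * h) + p1 (N%:R * h).
Proof.
move=> s00 s10 A0 h0 cf ps w00 w10 gc0 gc1 drift fF th.
have sh : 0 <= Num.sqrt h by exact: sqrtr_ge0.
have m0 : 0 <= m.
  have [_ osc] := gc0; apply: le_trans (osc 0%N 0 isT _); first exact: normr_ge0.
  by rewrite mul0r add0r lexx ltW.
have noise (u : R) : 0 <= u <= N%:R * h ->
    4 * Num.sqrt h * (u / h) - (s0 + s1) * (A * Num.sqrt h + m) <=
    s0 * w0 u + s1 * w1 u - F * u.
  move=> /andP[u0 uN].
  have g0 := grid_controlled_lower R A m h u N w0 A0 h0 w00 gc0 u0 uN.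
  have g1 := grid_controlled_lower R A m h u N w1 A0 h0 w10 gc1 u0 uN.
  have k0 := ler_wpM2l s00 g0; have k1 := ler_wpM2l s10 g1.
  have uh : 0 <= u / h by rewrite divr_ge0// ltW.
  have := ler_wpM2r uh drift.
  have -> : (F * h + 4 * Num.sqrt h) * (u / h) = F * u + 4 * Num.sqrt h * (u / h).
    by field; rewrite gt_eqF.
  lra.
have Nh0 : 0 <= N%:R * h by rewrite mulr_ge0// ltW.
have NhE : N%:R * h / h = N%:R by rewrite mulfK// gt_eqF.
have pos : 0 <= (s0 + s1) * (A * Num.sqrt h + m).
  by rewrite mulr_ge0 ?addr_ge0// mulr_ge0.
have := slow_variable_lower R alpha gamma s0 s1 f w0 w1 p0 q0 p1 q1 theta F (N%:R * h)
  cf ps Nh0 fF.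
have -> : theta < gamma * q0 0 + p0 0 + p1 0 by lra.
move=> /(_ isT) H; apply: le_trans (H _ w00 w10).
  have := noise (N%:R * h); rewrite Nh0 lexx NhE => /(_ isT); lra.
move=> u uN; have := noise u uN.
have : 0 <= 4 * Num.sqrt h * (u / h).
  by rewrite !mulr_ge0 ?invr_ge0 ?(ltW h0)//; case/andP: uN.
lra.
Qed.

(** The bound on the fast energy belongs to the set because it is what turns a lower bound on Q into
    lower bounds on both positions, and it must be available again for the next climb. *)
Definition front (R : realType) (alpha gamma a : R) (Q S : R) : set (state R) :=
  [set x | Q <= slow R gamma x /\ fast_energy R alpha a x <= S].

Lemma measurable_slow (R : realType) (gamma : R) : measurable_fun setT (slow R gamma).
Proof.
apply: measurable_funD; last exact: (measurableT_comp measurable_snd measurable_fst).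
apply: measurable_funD; last exact: (measurableT_comp measurable_fst
  (measurableT_comp measurable_fst measurable_fst)).
apply: measurable_funM => //.
exact: (measurableT_comp measurable_snd (measurableT_comp measurable_fst measurable_fst)).
Qed.

Lemma measurable_fast_energy (R : realType) (alpha a : R) :
  measurable_fun setT (fast_energy R alpha a).
Proof.
have m0 : measurable_fun setT (fun x : state R => x.1.1.1).
  exact: (measurableT_comp measurable_fst (measurableT_comp measurable_fst measurable_fst)).
have m1 : measurable_fun setT (fun x : state R => x.1.2).
  exact: (measurableT_comp measurable_snd measurable_fst).
have m2 : measurable_fun setT (fun x : state R => x.2 - x.1.1.2).
  apply: measurable_funB => //.
  exact: (measurableT_comp measurable_snd (measurableT_comp measurable_fst measurable_fst)).
rewrite /fast_energy /lyapunov.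
apply: measurable_funB; last by apply: measurable_funM => //; exact: measurable_funM.
apply: measurable_funB; last by apply: measurable_funM => //; exact: measurable_funM.
apply: measurable_funD; first apply: measurable_funD.
- by apply: measurable_funM => //; exact: measurable_funX.
- by apply: measurable_funM => //; exact: measurable_funX.
- by apply: measurable_funM => //; apply: measurable_funM => //; exact: measurable_funX.
Qed.

Lemma measurable_slow_ge (R : realType) (gamma r : R) :
  measurable [set x : state R | r <= slow R gamma x].
Proof.
rewrite (_ : [set x | _] = setT `&` slow R gamma @^-1` `[r, +oo[%classic).
  exact: (measurable_slow R gamma).
by rewrite setTI; apply/seteqP; split => x /=; rewrite in_itv/= andbT.
Qed.

Lemma measurable_front (R : realType) (alpha gamma a Q S : R) :
  measurable (front R alpha gamma a Q S).
Proof.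
have -> : front R alpha gamma a Q S = [set x | Q <= slow R gamma x] `&`
    [set x | fast_energy R alpha a x <= S] by [].
apply: measurableI; first exact: measurable_slow_ge.
rewrite (_ : [set x | fast_energy R alpha a x <= S] = setT `&` fast_energy R alpha a @^-1` `]-oo, S]%classic).
  exact: (measurable_fast_energy R alpha a).
by rewrite setTI; apply/seteqP; split => x /=; rewrite in_itv.
Qed.

(** This is the climb read through invariance, with free cell length and force bound: doubling uses
    h = r^(2 - 4k) and a decaying force, the initial step uses h = 1 and a force that is merely
    bounded. *)
Lemma front_step (R : realType) (alpha gamma T Tinf k L M A l kappa a C : R) (V1 : R -> R)
    (mustar : probability (state R) R) (s0 s1 : R) :
  s0 = Num.sqrt (2 * gamma * T) -> s1 = Num.sqrt (2 * gamma * Tinf) ->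
  0 < alpha -> 0 < gamma -> 0 < L -> 0 <= A -> 0 < kappa ->
  (forall x, `|derive1 V1 x| <= M) ->
  (forall x y, `|derive1 V1 x - derive1 V1 y| <= L * `|x - y|) ->
  continuous (derive1 V1) ->
  invariant_measure alpha gamma T Tinf V1 mustar ->
  (forall (f w0 w1 p0 q0 p1 q1 : R -> R) (tau m : R),
    continuous f -> (forall x, `|f x| <= M) ->
    path_solution R alpha gamma s0 s1 f w0 w1 p0 q0 p1 q1 ->
    0 <= m ->
    (forall u v : R, 0 <= u -> u <= v <= u + 1 -> v <= tau + 1 ->
      `|w0 v - w0 u| <= m /\ `|w1 v - w1 u| <= m) ->
    forall t : R, 0 <= t <= tau ->
      lyapunov R alpha a (p0 t) (p1 t) (q1 t - q0 t) <=
      9 / 4 * lyapunov R alpha a (p0 0) (p1 0) (q1 0 - q0 0) + C * (1 + m) ^+ 2) ->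
  forall (d : measure_display) (Omega : measurableType d) (P : probability Omega R)
    (x0 : state R) (xi : Omega -> state R) (w0 w1 : R -> Omega -> R)
    (N : nat) (h theta F Q S m : R) (E : set Omega),
  driving_noise P (@dirac _ (state R) x0 R) xi w0 w1 ->
  1 <= h -> measurable E -> ((expR (- (l * N%:R)))%:E <= P E)%E ->
  (forall om, E om -> grid_controlled R A m h N (w0 ^~ om) /\
                      grid_controlled R A m h N (w1 ^~ om)) ->
  F * h + 4 * Num.sqrt h <= (s0 + s1) * (A * Num.sqrt h) ->
  (forall p0 q0 p1 q1 : R,
    lyapunov R alpha a p0 p1 (q1 - q0) <= 9 / 4 * S + C * (1 + 3 * m) ^+ 2 ->
    theta < gamma * q0 + p0 + p1 ->
    `|derive1 V1 q0| + `|derive1 V1 q1| <= F) ->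
  theta < Q - (s0 + s1) * (A * Num.sqrt h + m) ->
  (mustar (front R alpha gamma a Q S) * (expR (- (l * N%:R)))%:E <=
   mustar (front R alpha gamma a
     (Q + 4 * N%:R * Num.sqrt h - (s0 + s1) * (A * Num.sqrt h + m))
     (9 / 4 * S + C * (1 + 3 * m) ^+ 2)))%E.
Proof.
move=> s0E s1E al0 g0 L0 A0 kap0 fM fL cf inv stab d Omega P x0 xi w0 w1 N h theta F Q S m E.
move=> noise h1 mE PE gcE drift fF th.
have h0 : 0 < h by lra.
have s00 : 0 <= s0 by rewrite s0E.
have s10 : 0 <= s1 by rewrite s1E.
have Nh : 0 <= N%:R * h by rewrite mulr_ge0// ltW.
apply: (@le_trans _ _ (mustar (front R alpha gamma a Q S) * P E)%E).
  by apply: lee_wpmul2l.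
apply: (invariant_transfer R alpha gamma T Tinf L V1 mustar d Omega P x0 xi w0 w1
  _ _ E (N%:R * h)) => //; try exact: measurable_front.
move=> om p0 q0 p1 q1 Eom [/= Q0 S0]; rewrite -s0E -s1E => ps.
have [gc0 gc1] := gcE om Eom.
have [_ [_ [_ [w00 _]]]] := noise; have [w00' w10'] := w00 om.
rewrite /slow /fast_energy /= in Q0 S0 *.
have m0 : 0 <= m.
  have [_ osc] := gc0; apply: le_trans (osc 0%N 0 isT _); first exact: normr_ge0.
  by rewrite mul0r add0r lexx ltW.
have win (u v : R) : 0 <= u -> u <= v <= u + 1 -> v <= N%:R * h + 1 ->
    `|w0 v om - w0 u om| <= 3 * m /\ `|w1 v om - w1 u om| <= 3 * m.
  move=> u0 uv vN; split.
    exact: (grid_controlled_window R A m h N (w0 ^~ om) h1 gc0 u v u0 uv vN).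
  exact: (grid_controlled_window R A m h N (w1 ^~ om) h1 gc1 u v u0 uv vN).
have m3 : 0 <= 3 * m by rewrite mulr_ge0.
have SB (u : R) : 0 <= u <= N%:R * h ->
    lyapunov R alpha a (p0 u) (p1 u) (q1 u - q0 u) <= 9 / 4 * S + C * (1 + 3 * m) ^+ 2.
  move=> uN.
  apply: (le_trans (stab _ _ _ _ _ _ _ _ _ cf fM ps m3 win u uN)).
  by rewrite lerD2r ler_pM2l.
split; last by rewrite SB// Nh lexx.
have := climb R alpha gamma s0 s1 A m h theta F N (derive1 V1) (w0 ^~ om) (w1 ^~ om)
  p0 q0 p1 q1 s00 s10 A0 h0 cf ps w00' w10' gc0 gc1 drift.
have fF' (u : R) : 0 <= u <= N%:R * h -> theta < gamma * q0 u + p0 u + p1 u ->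
    `|derive1 V1 (q0 u)| + `|derive1 V1 (q1 u)| <= F.
  by move=> uN; apply: fF; exact: SB.
move=> /(_ fF'); have -> : theta < gamma * q0 0 + p0 0 + p1 0 - (s0 + s1) * (A * Num.sqrt h + m).
  lra.
move=> /(_ isT); rewrite /slow /=; lra.
Qed.

Lemma fast_bounds (R : realType) (alpha a B p0 p1 y : R) :
  0 < alpha -> 0 < a -> 2 * a <= 1 -> 4 * a <= alpha -> 0 <= B ->
  lyapunov R alpha a p0 p1 y <= B ^+ 2 ->
  [/\ `|p0| <= 2 * B, `|p1| <= 2 * B & Num.sqrt alpha * `|y| <= 2 * B].
Proof.
move=> al0 a0 a2 a4 B0 hB.
have [h _] := lyapunov_coercive R alpha a p0 p1 y al0 a0 a2 a4.
have h0 := sqr_ge0 p0; have h1 := sqr_ge0 p1; have h2 := sqr_ge0 y.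
have h3 : 0 <= alpha * y ^+ 2 by rewrite mulr_ge0// ltW.
have sq (x : R) : 0 <= x -> x ^+ 2 <= 4 * B ^+ 2 -> x <= 2 * B.
  move=> x0; have -> : 4 * B ^+ 2 = (2 * B) ^+ 2 by ring.
  by rewrite ler_pXn2r ?nnegrE ?mulr_ge0.
split; apply: sq; rewrite ?mulr_ge0 ?sqrtr_ge0//.
- by rewrite real_normK ?num_real//; lra.
- by rewrite real_normK ?num_real//; lra.
- by rewrite exprMn sqr_sqrtr ?(ltW al0)// real_normK ?num_real//; lra.
Qed.

(** * Scales of the climb and doubling of fronts *)

Lemma ge0_powR_anti (R : realType) (x y e : R) : 0 < x -> x <= y -> e <= 0 ->
  y `^ e <= x `^ e.
Proof.
move=> x0 xy e0; have y0 : 0 < y by exact: lt_le_trans xy.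
rewrite -[e]opprK !(powRN _ (- e)) lef_pV2 ?posrE ?powR_gt0//.
by apply: ge0_ler_powR; rewrite ?nnegrE ?oppr_ge0// ltW.
Qed.

Lemma sqrt_powR2 (R : realType) (r e : R) : 0 < r -> Num.sqrt (r `^ (2 * e)) = r `^ e.
Proof.
move=> r0; have -> : r `^ (2 * e) = (r `^ e) ^+ 2.
  by rewrite mulrC powRrM powR_mulrn// powR_ge0.
by rewrite sqrtr_sqr ger0_norm// powR_ge0.
Qed.

Lemma powR_mul (R : realType) (r e f g : R) : 0 < r -> e + f = g ->
  r `^ e * r `^ f = r `^ g.
Proof. by move=> r0 <-; rewrite powRD// (gt_eqF r0) implybT. Qed.

(** Here sqrt h = r^(1 - 2k), so r^(2k - 1) h = sqrt h exactly and the drift condition reduces to D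
    + 4 <= s A. Moreover N sqrt h >= r, while m = O(r^(1 - k)) is eventually below any multiple of
    r. *)
Lemma doubling_scales (R : realType) (k kappa s A C D delta b : R) :
  0 < k -> k < 1 / 2 -> 0 < kappa -> 0 < s -> 0 <= A -> 0 < C -> D + 4 <= s * A ->
  0 < delta -> 0 <= b ->
  exists rmin : R, [/\ 1 <= rmin, b <= rmin & forall r : R, rmin <= r ->
    let h := r `^ (2 - 4 * k) in
    let N := (Num.truncn (r `^ (2 * k))).+1 in
    let m := kappa * Num.sqrt N%:R * Num.sqrt h in
    [/\ 1 <= h, s * (A * Num.sqrt h + m) <= r / 4,
        C * (1 + 3 * m) ^+ 2 <= (delta * r) ^+ 2,
        D * r `^ (2 * k - 1) * h + 4 * Num.sqrt h <= s * (A * Num.sqrt h) &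
        r <= N%:R * Num.sqrt h /\ N%:R <= 2 * r `^ (2 * k)]].
Proof.
move=> hk hk2 hkap s0 A0 C0 drift d0 b0.
pose c1 : R := s * (A + kappa).
have c10 : 0 < c1 by rewrite mulr_gt0// ltr_wpDl.
pose K6 : R := Num.sqrt C * (1 + 6 * kappa) / delta.
have kap6 : 0 < 1 + 6 * kappa by clear - hkap; lra.
have sC0 : 0 < Num.sqrt C by rewrite sqrtr_gt0.
have K60 : 0 < K6 by apply: divr_gt0 => //; exact: mulr_gt0.
(* For r >= eps^(-1/k) one has r^(1 - k) <= eps r. The summand 8 c1 serves the cost of the climb, K6
   the growth of the energy. *)
pose eps : R := (8 * c1 + K6)^-1.
have e0 : 0 < 8 * c1 + K6 by rewrite addr_gt0// mulr_gt0.
have eps0 : 0 < eps by rewrite invr_gt0.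
have epsc : 8 * c1 * eps <= 1 by rewrite ler_pdivrMr// mul1r lerDl ltW.
have epsK : Num.sqrt C * (1 + 6 * kappa) * eps <= delta.
  have -> : Num.sqrt C * (1 + 6 * kappa) = delta * K6.
    by rewrite /K6 [RHS]mulrC divfK// gt_eqF.
  by rewrite ler_pdivrMr// ler_pM2l// lerDr mulr_ge0// ltW.
have rk0 : 0 <= eps^-1 `^ k^-1 by exact: powR_ge0.
exists (1 + b + eps^-1 `^ k^-1); split; [by clear - rk0 b0; lra..|].
move=> r rr h N m.
have [r1 rpow] : 1 <= r /\ eps^-1 `^ k^-1 <= r by clear - rk0 b0 rr; split; lra.
have r0 : 0 < r by exact: lt_le_trans r1.
pose rk : R := r `^ k; pose r1k : R := r `^ (1 - k); pose sh : R := r `^ (1 - 2 * k).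
have rkr1k : rk * r1k = r by rewrite /rk /r1k (powR_mul _ _ _ _ 1)// ?powRr1 ?ltW//; ring.
have rk_ge : eps^-1 <= rk.
  have e'0 : 0 <= eps^-1 by rewrite invr_ge0 ltW.
  have -> : eps^-1 = (eps^-1 `^ k^-1) `^ k by rewrite -powRrM mulVf ?gt_eqF// powRr1.
  by apply: ge0_ler_powR; rewrite ?nnegrE ?(ltW hk) ?(ltW r0).
have r1k0 : 0 < r1k by exact: powR_gt0.
have r1k_ge1 : 1 <= r1k by rewrite -[leLHS](powRr0 r) ler_powR//; clear - hk2; lra.
have r1k_le : r1k <= eps * r.
  by rewrite -ler_pdivrMl// -rkr1k ler_wpM2r// ltW.
have shE : Num.sqrt h = sh.
  rewrite /h (_ : 2 - 4 * k = 2 * (1 - 2 * k)); last by ring.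
  exact: sqrt_powR2.
have h1 : 1 <= h by rewrite -[leLHS](powRr0 r) ler_powR//; clear - hk2; lra.
have sh0 : 0 < sh by exact: powR_gt0.
have r2k1 : 1 <= r `^ (2 * k).
  by rewrite -[leLHS](powRr0 r) ler_powR// mulr_ge0// ltW.
have /andP[N1 N2] := truncn_itv (powR_ge0 r (2 * k)).
have Nup : N%:R <= 2 * r `^ (2 * k).
  by rewrite /N -natr1; clear - N1 r2k1; lra.
have Nlow : r `^ (2 * k) <= N%:R by exact: ltW.
have sN1 : 1 <= Num.sqrt (N%:R : R) by rewrite -[leLHS]sqrtr1 ler_sqrt// ler1n.
have sN : Num.sqrt N%:R <= 2 * rk.
  have rk20 : 0 <= 2 * rk by rewrite mulr_ge0// powR_ge0.
  rewrite -[leRHS](ger0_norm rk20) -sqrtr_sqr ler_sqrt ?sqr_ge0//.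
  have -> : (2 * rk) ^+ 2 = 4 * r `^ (2 * k).
    by rewrite [2 * k]mulrC powRrM powR_mulrn ?powR_ge0//; rewrite /rk; ring.
  by clear - Nup r2k1; lra.
have rksh : rk * sh = r1k by rewrite /rk /sh (powR_mul _ _ _ _ (1 - k))//; ring.
have sNsh : Num.sqrt N%:R * sh <= 2 * r1k by rewrite -rksh mulrA ler_pM2r.
have mle : m <= 2 * kappa * r1k.
  by rewrite /m shE -mulrA [2 * kappa]mulrC -mulrA ler_pM2l.
have m0 : 0 <= m by rewrite /m !mulr_ge0 ?sqrtr_ge0// ltW.
have shh : r `^ (2 * k - 1) * h = sh.
  by rewrite /h /sh (powR_mul _ _ _ _ (1 - 2 * k))//; ring.
split => //.
- have h2 : A * Num.sqrt h + m <= (A + kappa) * (Num.sqrt N%:R * sh).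
    rewrite /m shE mulrDl -[kappa * _ * sh]mulrA lerD2r ler_wpM2l//.
    by rewrite -[leLHS]mul1r ler_pM2r.
  have h3 : s * (A * Num.sqrt h + m) <= c1 * (Num.sqrt N%:R * sh).
    by rewrite /c1 -mulrA ler_pM2l.
  have h4 : c1 * (Num.sqrt N%:R * sh) <= c1 * (2 * (eps * r)).
    by rewrite ler_pM2l// (le_trans sNsh)// ler_pM2l.
  have h5 : 8 * c1 * eps * r <= 1 * r by rewrite ler_pM2r.
  by clear - h3 h4 h5; lra.
- rewrite -[C in leLHS](sqr_sqrtr (ltW C0)) -exprMn.
  have sC := sqrtr_ge0 C.
  have h2 : 1 + 3 * m <= (1 + 6 * kappa) * (eps * r).
    have h3 : 6 * kappa * r1k <= 6 * kappa * (eps * r) by rewrite ler_pM2l ?mulr_gt0.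
    by clear - h3 mle r1k_ge1 r1k_le; lra.
  rewrite ler_pXn2r ?nnegrE//; first last.
  + by rewrite mulr_ge0// ltW.
  + by rewrite mulr_ge0//; clear - m0; lra.
  apply: (le_trans (ler_wpM2l sC h2)).
  have h3 : Num.sqrt C * (1 + 6 * kappa) * eps * r <= delta * r by rewrite ler_pM2r.
  by clear - h3; lra.
- by rewrite shE -mulrA shh -mulrDl mulrA ler_pM2r.
split => //; have -> : r = r `^ (2 * k) * sh.
  by rewrite /sh (powR_mul _ _ _ _ 1) ?powRr1 ?(ltW r0)//; ring.
by rewrite shE ler_pM2r.
Qed.

(** The energy bound gives |p0|, |p1| <= 4 delta r <= r / 8, hence gamma q0 >= r / 4. With eta = 1 /
    (8 gamma) this reads q0 >= 2 eta r, and |q1 - q0| <= eta r / 2, so both positions exceed eta r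
    >= 1, where the decaying bound applies. *)
Lemma far_force_bound (R : realType) (alpha gamma k M a delta r : R) (f : R -> R) :
  0 < alpha -> 0 < gamma -> k < 1 / 2 -> 0 < M -> 0 < a -> 2 * a <= 1 -> 4 * a <= alpha ->
  (forall x, 1 <= x -> `|f x| <= M * x `^ (2 * k - 1)) ->
  0 < delta -> 32 * delta <= 1 -> 64 * gamma * delta <= Num.sqrt alpha -> 8 * gamma <= r ->
  forall p0 q0 p1 q1 : R,
    lyapunov R alpha a p0 p1 (q1 - q0) <= (2 * (delta * r)) ^+ 2 ->
    r / 2 < gamma * q0 + p0 + p1 ->
    `|f q0| + `|f q1| <= 2 * M * (8 * gamma)^-1 `^ (2 * k - 1) * r `^ (2 * k - 1).
Proof.
move=> al0 g0 hk2 M0 a0 a2 a4 f_decay d0 delta32 delta64 r8 p0 q0 p1 q1 lB Qr.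
pose eta : R := (8 * gamma)^-1.
have g8 : 0 < 8 * gamma by rewrite mulr_gt0.
have eta_gt0 : 0 < eta by rewrite invr_gt0.
have etar : 1 <= eta * r by rewrite /eta mulrC ler_pdivlMr// mul1r.
have r0 : 0 < r by exact: lt_le_trans r8.
have er0 : 0 < eta * r by rewrite mulr_gt0.
have sa_gt0 : 0 < Num.sqrt alpha by rewrite sqrtr_gt0.
have B0 : 0 <= 2 * (delta * r) by rewrite !mulr_ge0// ltW.
have [b0 b1 b2] := fast_bounds R alpha a _ p0 p1 (q1 - q0) al0 a0 a2 a4 B0 lB.
have dr : delta * r <= r / 32.
  have h : 32 * delta * r <= 1 * r by rewrite ler_pM2r.
  by clear - h; lra.
have yb : `|q1 - q0| <= eta * r / 2.
  rewrite -(ler_pM2l sa_gt0) (le_trans b2)//.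
  have h : 64 * gamma * delta * (eta * r) <= Num.sqrt alpha * (eta * r).
    by rewrite ler_pM2r.
  have e : 64 * gamma * delta * (eta * r) = 8 * (delta * r).
    by rewrite /eta; field; rewrite gt_eqF.
  by rewrite e in h; clear - h; lra.
move: b0 b1 yb; rewrite !ler_norml => /andP[_ b0] /andP[_ b1] /andP[yb _].
have q0b : 2 * (eta * r) <= q0.
  have : gamma * (2 * (eta * r)) <= gamma * q0.
    have -> : gamma * (2 * (eta * r)) = r / 4 by rewrite /eta; field; rewrite gt_eqF.
    by clear - b0 b1 dr Qr; lra.
  by rewrite ler_pM2l.
have fq (x : R) : eta * r <= x -> `|f x| <= M * (eta `^ (2 * k - 1) * r `^ (2 * k - 1)).
  move=> xe; apply: (le_trans (f_decay x (le_trans etar xe))); rewrite ler_pM2l//.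
  rewrite -powRM ?(ltW eta_gt0) ?(ltW r0)//.
  by apply: ge0_powR_anti => //; clear - hk2; lra.
have h1 := fq q0 ltac:(clear - q0b er0; lra).
have h2 := fq q1 ltac:(clear - q0b er0 yb; lra).
by clear - h1 h2; lra.
Qed.

Section Fronts.
Variables (R : realType) (alpha gamma T Tinf k L M A l kappa a C s0 s1 : R).
Variables (V1 : R -> R) (mustar : probability (state R) R).
Hypotheses (s0E : s0 = Num.sqrt (2 * gamma * T))
  (s1E : s1 = Num.sqrt (2 * gamma * Tinf)).
Hypotheses (alpha_gt0 : 0 < alpha) (gamma_gt0 : 0 < gamma) (k_gt0 : 0 < k)
  (k_lt : k < 1 / 2) (s0_gt0 : 0 < s0) (s1_gt0 : 0 < s1) (L_gt0 : 0 < L)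
  (M_gt0 : 0 < M) (l_gt0 : 0 < l) (kappa_gt0 : 0 < kappa) (C_gt0 : 0 < C).
Hypotheses (a_gt0 : 0 < a) (a_le : 2 * a <= 1) (a_le4 : 4 * a <= alpha).
Hypothesis f_bounded : forall x, `|derive1 V1 x| <= M.
Hypothesis f_decay : forall x, 1 <= x -> `|derive1 V1 x| <= M * x `^ (2 * k - 1).
Hypothesis f_lip : forall x y, `|derive1 V1 x - derive1 V1 y| <= L * `|x - y|.
Hypothesis f_cont : continuous (derive1 V1).
Hypothesis inv : invariant_measure alpha gamma T Tinf V1 mustar.
Hypothesis stab : forall (f w0 w1 p0 q0 p1 q1 : R -> R) (tau m : R),
  continuous f -> (forall x, `|f x| <= M) ->
  path_solution R alpha gamma s0 s1 f w0 w1 p0 q0 p1 q1 ->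
  0 <= m ->
  (forall u v : R, 0 <= u -> u <= v <= u + 1 -> v <= tau + 1 ->
    `|w0 v - w0 u| <= m /\ `|w1 v - w1 u| <= m) ->
  forall t : R, 0 <= t <= tau ->
    lyapunov R alpha a (p0 t) (p1 t) (q1 t - q0 t) <=
    9 / 4 * lyapunov R alpha a (p0 0) (p1 0) (q1 0 - q0 0) + C * (1 + m) ^+ 2.
Hypothesis noise_eventP : forall (d : measure_display) (Omega : measurableType d)
    (P : probability Omega R) (x0 : state R)
    (xi : Omega -> state R) (w0 w1 : R -> Omega -> R) (N : nat) (h : R),
  driving_noise P (@dirac _ (state R) x0 R) xi w0 w1 -> (0 < N)%N -> 0 < h ->
  exists E : set Omega, [/\ measurable E, ((expR (- (l * N%:R)))%:E <= P E)%E &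
    forall om, E om ->
      grid_controlled R A (kappa * Num.sqrt N%:R * Num.sqrt h) h N (w0 ^~ om) /\
      grid_controlled R A (kappa * Num.sqrt N%:R * Num.sqrt h) h N (w1 ^~ om)].

(* M1 r^(2k - 1) bounds the force when both positions exceed eta r; delta keeps
   the fast variables negligible against r. *)
Let eta : R := (8 * gamma)^-1.
Let M1 : R := 2 * M * eta `^ (2 * k - 1).
Let delta : R := (32 + 64 * gamma / Num.sqrt alpha)^-1.
Let c1 : R := (s0 + s1) * (A + kappa).
Hypothesis A_drift : M1 + 2 * M + 4 <= (s0 + s1) * A.

Let sa_gt0 : 0 < Num.sqrt alpha. Proof. by rewrite sqrtr_gt0. Qed.
Let eta_gt0 : 0 < eta. Proof. by rewrite invr_gt0 mulr_gt0. Qed.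
Let M1_gt0 : 0 < M1. Proof. by rewrite !mulr_gt0// powR_gt0. Qed.
Let s_gt0 : 0 < s0 + s1. Proof. by rewrite addr_gt0. Qed.
Let A_ge0 : 0 <= A.
Proof.
rewrite leNgt; apply/negP => A0.
have : (s0 + s1) * A < 0 by rewrite pmulr_rlt0.
by have := M1_gt0; have := M_gt0; have := A_drift; lra.
Qed.
Let D_gt0 : 0 < 32 + 64 * gamma / Num.sqrt alpha.
Proof. by rewrite addr_gt0// divr_gt0// mulr_gt0. Qed.
Let delta_gt0 : 0 < delta. Proof. by rewrite invr_gt0. Qed.
Let delta32 : 32 * delta <= 1.
Proof.
rewrite ler_pdivrMr// mul1r lerDl; apply: divr_ge0; last exact: ltW.
by rewrite mulr_ge0// ltW.
Qed.
Let delta64 : 64 * gamma * delta <= Num.sqrt alpha.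
Proof.
have -> : 64 * gamma * delta = Num.sqrt alpha *
    ((64 * gamma / Num.sqrt alpha) / (32 + 64 * gamma / Num.sqrt alpha)).
  by rewrite /delta; field; rewrite !gt_eqF//; have := sa_gt0; have := gamma_gt0; lra.
apply: ler_piMr; first exact: sqrtr_ge0.
by rewrite ler_pdivrMr// mul1r lerDr.
Qed.

(** The front reproduces its own shape: Q reaches at least r + 4 r - r / 4 >= 2 r, and the energy at
    most (9/4 + 1) (delta r)^2 <= (delta 2 r)^2. The probability exp (- l N) is bounded below
    through N <= 2 r^(2k). *)
Lemma front_doubling : exists rmin : R, 1 <= rmin /\
  forall r : R, rmin <= r ->
  forall (d : measure_display) (Omega : measurableType d) (P : probability Omega R)
    (x0 : state R) (xi : Omega -> state R) (w0 w1 : R -> Omega -> R),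
  driving_noise P (@dirac _ (state R) x0 R) xi w0 w1 ->
  (mustar (front R alpha gamma a r ((delta * r) ^+ 2)) * (expR (- (2 * l * r `^ (2 * k))))%:E
   <= mustar (front R alpha gamma a (2 * r) ((delta * (2 * r)) ^+ 2)))%E.
Proof.
have g8 : 0 < 8 * gamma by rewrite mulr_gt0.
have drift0 : M1 + 4 <= (s0 + s1) * A.
  by apply: le_trans A_drift; rewrite lerD2r lerDl mulr_ge0// ltW.
have [rmin [rmin1 rmin8 scales]] := doubling_scales R k kappa (s0 + s1) A C M1 delta (8 * gamma)
  k_gt0 k_lt kappa_gt0 s_gt0 A_ge0 C_gt0 drift0 delta_gt0 (ltW g8).
exists rmin; split => // r rr d Omega P x0 xi w0 w1 noise.
have r0 : 0 < r by exact: lt_le_trans (le_trans rmin1 rr).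
have [] := scales r rr.
set h : R := r `^ (2 - 4 * k).
pose N := (Num.truncn (r `^ (2 * k))).+1; rewrite -/N.
pose m : R := kappa * Num.sqrt N%:R * Num.sqrt h; rewrite -/m.
move=> h1 cost energy drift [gain Nup].
have [E [mE PE gE]] := noise_eventP d Omega P x0 xi w0 w1 N h noise isT (lt_le_trans ltr01 h1).
have fF (p0 q0 p1 q1 : R) :
    lyapunov R alpha a p0 p1 (q1 - q0) <= 9 / 4 * (delta * r) ^+ 2 + C * (1 + 3 * m) ^+ 2 ->
    r / 2 < gamma * q0 + p0 + p1 ->
    `|derive1 V1 q0| + `|derive1 V1 q1| <= M1 * r `^ (2 * k - 1).
  move=> lB; apply: (@far_force_bound R alpha gamma k M a delta r) => //.
    exact: le_trans rr.
  apply: (le_trans lB); have := sqr_ge0 (delta * r); rewrite (exprMn 2); lra.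
have th : r / 2 < r - (s0 + s1) * (A * Num.sqrt h + m) by lra.
have step := front_step R alpha gamma T Tinf k L M A l kappa a C V1 mustar s0 s1 s0E s1E
  alpha_gt0 gamma_gt0 L_gt0 A_ge0 kappa_gt0 f_bounded f_lip f_cont inv stab
  d Omega P x0 xi w0 w1 N h (r / 2) (M1 * r `^ (2 * k - 1)) r ((delta * r) ^+ 2) m E noise h1
  mE PE gE drift fF th.
apply: (@le_trans _ _ (mustar (front R alpha gamma a r ((delta * r) ^+ 2)) *
    (expR (- (l * N%:R)))%:E)%E).
  apply: lee_wpmul2l => //; rewrite lee_fin ler_expR lerN2.
  by have := ler_wpM2l (ltW l_gt0) Nup; rewrite mulrCA mulrA.
apply: (le_trans step); apply: le_measure; rewrite ?inE; try exact: measurable_front.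
move=> x [/= xQ xS]; split => /=; first by lra.
apply: (le_trans xS); have := sqr_ge0 (delta * r).
have -> : (delta * (2 * r)) ^+ 2 = 4 * (delta * r) ^+ 2 by ring.
lra.
Qed.

(** From a bounded front, N unit cells raise Q by 4 N minus O(sqrt N), while the fast energy grows
    only like N, below (delta N)^2 for large N. This places the mass in a front from which doubling
    can begin. *)
Lemma front_start (rho rmin : R) : exists N : nat, (0 < N)%N /\ rmin <= N%:R /\
  forall (d : measure_display) (Omega : measurableType d) (P : probability Omega R)
    (x0 : state R) (xi : Omega -> state R) (w0 w1 : R -> Omega -> R),
  driving_noise P (@dirac _ (state R) x0 R) xi w0 w1 ->
  (mustar (front R alpha gamma a (- rho) rho) * (expR (- (l * N%:R)))%:E
   <= mustar (front R alpha gamma a N%:R ((delta * N%:R) ^+ 2)))%E.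
Proof.
(* [b1] pays for the starting level and for the cost c1 sqrt N <= N + c1^2 / 4; [b2] makes delta^2 N
   dominate the coefficient of N in the energy bound. *)
pose b1 : R := `|rho| + c1 ^+ 2 / 4.
pose b2 : R := (9 / 4 * `|rho| + C * (1 + 3 * kappa) ^+ 2) / delta ^+ 2.
have b10 : 0 <= b1 by rewrite addr_ge0// divr_ge0// sqr_ge0.
have b20 : 0 <= b2.
  rewrite /b2; apply: divr_ge0; last exact: sqr_ge0.
  by apply: addr_ge0; apply: mulr_ge0; rewrite ?sqr_ge0 ?(ltW C_gt0)//; lra.
pose N := (Num.truncn (b1 + b2 + `|rmin|)).+1.
have bb : 0 <= b1 + b2 + `|rmin| by apply: addr_ge0 => //; exact: addr_ge0.
have /andP[_ N2] := truncn_itv bb.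
have Nb : b1 + b2 + `|rmin| <= N%:R by exact: ltW.
have NR1 : 1 <= (N%:R : R) by rewrite ler1n.
exists N; split => //; split; first by have := ler_norm rmin; lra.
move=> d Omega P x0 xi w0 w1 noise.
have sq1 : Num.sqrt 1 = 1 :> R by exact: sqrtr1.
have [E [mE PE gE]] := noise_eventP d Omega P x0 xi w0 w1 N 1 noise isT ltr01.
pose m : R := kappa * Num.sqrt N%:R * Num.sqrt 1.
have mE' : m = kappa * Num.sqrt N%:R by rewrite /m sq1 mulr1.
have sN1 : 1 <= Num.sqrt (N%:R : R) by rewrite -[leLHS]sqrtr1 ler_sqrt.
have sN2 : Num.sqrt (N%:R : R) ^+ 2 = N%:R by rewrite sqr_sqrtr.
have cost : (s0 + s1) * (A * Num.sqrt 1 + m) <= N%:R + c1 ^+ 2 / 4.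
  have h2 : A * Num.sqrt 1 + m <= (A + kappa) * Num.sqrt N%:R.
    by rewrite sq1 mulr1 mE' mulrDl lerD2r ler_peMr.
  apply: (@le_trans _ _ (c1 * Num.sqrt N%:R)).
    by rewrite /c1 -mulrA ler_pM2l.
  have := young_sqr R 1 (Num.sqrt N%:R) c1 ltr01.
  by rewrite sN2 mul1r mulr1 mulrC.
have drift : 2 * M * 1 + 4 * Num.sqrt 1 <= (s0 + s1) * (A * Num.sqrt 1).
  by rewrite sq1 !mulr1; have := A_drift; have := M1_gt0; lra.
pose theta : R := - rho - (s0 + s1) * (A * Num.sqrt 1 + m) - 1.
have fF (p0 q0 p1 q1 : R) :
    lyapunov R alpha a p0 p1 (q1 - q0) <= 9 / 4 * rho + C * (1 + 3 * m) ^+ 2 ->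
    theta < gamma * q0 + p0 + p1 -> `|derive1 V1 q0| + `|derive1 V1 q1| <= 2 * M.
  by move=> _ _; have := f_bounded q0; have := f_bounded q1; lra.
have th : theta < - rho - (s0 + s1) * (A * Num.sqrt 1 + m) by rewrite /theta; lra.
have step := front_step R alpha gamma T Tinf k L M A l kappa a C V1 mustar s0 s1 s0E s1E
  alpha_gt0 gamma_gt0 L_gt0 A_ge0 kappa_gt0 f_bounded f_lip f_cont inv stab
  d Omega P x0 xi w0 w1 N 1 theta (2 * M) (- rho) rho m E noise (lexx 1) mE PE gE drift fF th.
apply: (le_trans step); apply: le_measure; rewrite ?inE; try exact: measurable_front.
have rn := ler_norm rho.
move=> x [/= xQ xS]; split => /=.
  apply: le_trans xQ; rewrite sq1 !mulr1 in cost *.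
  by have := b20; have := normr_ge0 rmin; rewrite /b1 in Nb; lra.
apply: (le_trans xS).
have d20 : 0 < delta ^+ 2 by rewrite exprn_gt0.
have h2 : 9 / 4 * `|rho| + C * (1 + 3 * kappa) ^+ 2 <= delta ^+ 2 * N%:R.
  rewrite -ler_pdivrMl// mulrC; apply: le_trans Nb.
  by rewrite -/b2; have := normr_ge0 rmin; lra.
have h3 : (1 + 3 * m) ^+ 2 <= (1 + 3 * kappa) ^+ 2 * N%:R.
  rewrite -sN2 -exprMn ler_pXn2r ?nnegrE.
  - by rewrite mE' mulrDl mul1r; lra.
  - by [].
  - by rewrite mE'; have := mulr_ge0 (ltW kappa_gt0) (sqrtr_ge0 N%:R); lra.
  - by rewrite mulr_ge0 ?sqrtr_ge0//; have := kappa_gt0; lra.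
have h4 : C * (1 + 3 * m) ^+ 2 <= C * ((1 + 3 * kappa) ^+ 2 * N%:R) by rewrite ler_pM2l.
have h5 : (9 / 4 * `|rho| + C * (1 + 3 * kappa) ^+ 2) * N%:R <= delta ^+ 2 * N%:R * N%:R.
  by rewrite ler_pM2r//; lra.
have h6 : `|rho| <= `|rho| * N%:R by rewrite ler_peMr.
rewrite exprMn; lra.
Qed.

End Fronts.

Lemma powR2_gt1 (R : realType) (e : R) : 0 < e -> 1 < 2 `^ e :> R.
Proof.
move=> e0; have {1}<- : 1 `^ e = 1 :> R by rewrite powR1.
by apply: gt0_ltr_powR; rewrite ?nnegrE//; lra.
Qed.

(** These sets cover the state space, so by countable subadditivity not all of them are null. *)
Lemma front_exhaust (R : realType) (alpha gamma a : R) (mu : probability (state R) R) :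
  exists n : nat, (0 < mu (front R alpha gamma a (- n%:R) n%:R))%E.
Proof.
apply: contrapT => /forallNP h.
have z (n : nat) : mu (front R alpha gamma a (- n%:R) n%:R) = 0%E.
  by apply/eqP; rewrite eq_le measure_ge0 andbT leNgt; apply/negP/h.
have cov : setT = \bigcup_n front R alpha gamma a (- n%:R) n%:R.
  apply/seteqP; split => // x _.
  have [n hn] : exists n : nat, `|slow R gamma x| + `|fast_energy R alpha a x| <= n%:R.
    exists (Num.truncn (`|slow R gamma x| + `|fast_energy R alpha a x|)).+1.
    have h0 : 0 <= `|slow R gamma x| + `|fast_energy R alpha a x| by rewrite addr_ge0.
    by have /andP[_ /ltW] := truncn_itv h0.
  exists n => //; split.
    have := ler_norm (- slow R gamma x); rewrite normrN.
    by have := normr_ge0 (fast_energy R alpha a x); lra.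
  have := ler_norm (fast_energy R alpha a x).
  by have := normr_ge0 (slow R gamma x); lra.
have : (mu setT <= 0)%E.
  rewrite {1}cov; apply: le_trans (generalized_Boole_inequality _ _ _) _.
  - by move=> n; exact: measurable_front.
  - by apply: bigcup_measurable => n _; exact: measurable_front.
  - by rewrite eseries0// => n _ _; exact: z.
by rewrite probability_setT lee_fin ler10.
Qed.

(** The constant 2 l / (2^(2k) - 1) is the solution of Cst 2^(2k) = Cst + 2 l: the costs 2 l r^(2k)
    along the doublings add up geometrically. *)
Lemma iterated_doubling (R : realType) (k l r0 kap0 : R) (m : R -> \bar R) :
  0 < k -> 0 < l -> 0 < r0 -> 0 <= kap0 -> (kap0%:E <= m r0)%E ->
  (forall r : R, r0 <= r ->
    (m r * (expR (- (2 * l * r `^ (2 * k))))%:E <= m (2 * r)%R)%E) ->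
  forall n : nat,
    ((kap0 * expR (- (2 * l / (2 `^ (2 * k) - 1) * (2 ^+ n * r0) `^ (2 * k))))%:E
      <= m (2 ^+ n * r0)%R)%E.
Proof.
move=> k0 l0 r00 kap00 m0 step.
have k2 : 0 < 2 * k by rewrite mulr_gt0.
have p1 : 1 < 2 `^ (2 * k) :> R by apply: powR2_gt1; lra.
set D : R := 2 `^ (2 * k) - 1.
have D0 : 0 < D by rewrite /D; lra.
pose Cst : R := 2 * l / D.
have C0 : 0 < Cst by rewrite divr_gt0// mulr_gt0.
elim => [|n IH].
  rewrite expr0 mul1r; apply: le_trans m0; rewrite lee_fin ler_piMr//.
  by rewrite -[leRHS]expR0 ler_expR oppr_le0 mulr_ge0 ?powR_ge0// ltW.
set r := 2 ^+ n * r0 in IH *.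
have r0r : r0 <= r by rewrite /r ler_peMl ?(ltW r00)// exprn_ege1// ler1n.
have rp : 0 <= r by rewrite (le_trans (ltW r00)).
have -> : 2 ^+ n.+1 * r0 = 2 * r by rewrite exprS mulrA.
apply: le_trans (step r r0r).
apply: (@le_trans _ _ ((kap0 * expR (- (Cst * r `^ (2 * k))))%:E *
   (expR (- (2 * l * r `^ (2 * k))))%:E)%E); last first.
  by apply: lee_wpmul2r => //; rewrite lee_fin expR_ge0.
rewrite -EFinM lee_fin -[leRHS]mulrA -expRD.
apply: ler_wpM2l; first exact: kap00.
rewrite ler_expR powRM; [|by []|exact: rp].
rewrite -/D -/Cst -opprD lerN2.
have -> : Cst * (2 `^ (2 * k) * r `^ (2 * k)) =
  Cst * r `^ (2 * k) + Cst * D * r `^ (2 * k) by rewrite /D; ring.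
by rewrite lerD2l /Cst divfK ?gt_eqF.
Qed.

(** The constants depend on mu and the parameters and are fixed before the probability space; the
    noise given afterwards only realises the dynamics through which invariance acts. *)
Lemma invariant_tail_lower (R : realType) (alpha gamma T Tinf : R) (k : R)
    (V1 : R -> R) (mustar : probability (state R) R) :
  0 < alpha -> 0 < gamma -> 0 < T -> 0 < Tinf -> 0 < k -> k < 1 / 2 ->
  potential_hyp k V1 -> invariant_measure alpha gamma T Tinf V1 mustar ->
  exists Cst r0 kap0 : R, [/\ 0 < Cst, 1 <= r0, 0 < kap0 &
  forall (d : measure_display) (Omega : measurableType d) (P : probability Omega R)
    (x0 : state R) (xi : Omega -> state R) (w0 w1 : R -> Omega -> R),
  driving_noise P (@dirac _ (state R) x0 R) xi w0 w1 -> forall n : nat,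
    ((kap0 * expR (- (Cst * (2 ^+ n * r0) `^ (2 * k))))%:E
      <= mustar [set x : state R | (2 ^+ n * r0 <= slow R gamma x)%R])%E].
Proof.
move=> al0 g0 T0 Tinf0 k0 k1 pot inv.
have [M [L [q [M0 L0 _ [fM fdec] [_ fL]]]]] := potential_facts R k V1 k0 k1 pot.
have cf : continuous (derive1 V1).
  move=> x; apply: (is_derive_continuous_at _ _ _ (derive1 (derive1 V1) x)).
  by apply: derivable1_is_derive; case: pot => _ [_ []].
pose s0 : R := Num.sqrt (2 * gamma * T); pose s1 : R := Num.sqrt (2 * gamma * Tinf).
have s00 : 0 < s0 by rewrite sqrtr_gt0 !mulr_gt0.
have s10 : 0 < s1 by rewrite sqrtr_gt0 !mulr_gt0.
have sp : 0 < s0 + s1 by rewrite addr_gt0.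
have [a [C [a0 a2 a4 C0 stab]]] := stable_bound R alpha gamma _ _ M al0 g0 s00 s10 M0.
pose M1 : R := 2 * M * (8 * gamma)^-1 `^ (2 * k - 1).
have M10 : 0 < M1 by rewrite !mulr_gt0// powR_gt0// invr_gt0 mulr_gt0.
(* M1 is the force constant of the doubling climbs, 2 M that of the initial climb, and 4 the net
   gain per cell. *)
pose A : R := (M1 + 2 * M + 4) / (s0 + s1).
have A0 : 0 <= A by rewrite divr_ge0 ?(ltW sp)//; lra.
have Ad : M1 + 2 * M + 4 <= (s0 + s1) * A by rewrite /A [leRHS]mulrC divfK// gt_eqF.
have [l [kappa [l0 kappa0 ev]]] := noise_event R A A0.
have evP (d : measure_display) (Omega : measurableType d)
    (P : probability Omega R) (x0 : state R)
    (xi : Omega -> state R) (w0 w1 : R -> Omega -> R) (N : nat) (h : R) :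
  driving_noise P (@dirac _ (state R) x0 R) xi w0 w1 -> (0 < N)%N -> 0 < h ->
  exists E : set Omega, [/\ measurable E, ((expR (- (l * N%:R)))%:E <= P E)%E &
    forall om, E om ->
      grid_controlled R A (kappa * Num.sqrt N%:R * Num.sqrt h) h N (w0 ^~ om) /\
      grid_controlled R A (kappa * Num.sqrt N%:R * Num.sqrt h) h N (w1 ^~ om)].
  move=> noise N0 h0; have [E [mE PE hE]] := ev _ _ _ _ _ _ _ N h noise N0 h0.
  exists E; split => // om Eom; have [inc osc] := hE om Eom.
  split; split.
  - by move=> i iN; have [] := inc i iN.
  - by move=> j u jN ju; have [] := osc j u jN ju.
  - by move=> i iN; have [] := inc i iN.
  - by move=> j u jN ju; have [] := osc j u jN ju.
have [rmin [rmin1 doub]] := front_doubling R alpha gamma T Tinf k L M A l kappa a C _ _ V1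
  mustar erefl erefl al0 g0 k0 k1 s00 s10 L0 M0 l0 kappa0 C0 a0 a2 a4 fM fdec fL cf inv
  stab evP Ad.
have [rho Krho] := front_exhaust R alpha gamma a mustar.
have [N [N0 [Nmin start]]] := front_start R alpha gamma T Tinf k L M A l kappa a C _ _ V1
  mustar erefl erefl al0 g0 s00 s10 L0 M0 kappa0 C0 fM fL cf inv stab evP Ad rho%:R rmin.
have fK : mustar (front R alpha gamma a (- rho%:R) rho%:R) \is a fin_num.
  by apply: fin_num_measure; exact: measurable_front.
pose K : R := fine (mustar (front R alpha gamma a (- rho%:R) rho%:R)).
have KE : mustar (front R alpha gamma a (- rho%:R) rho%:R) = K%:E by rewrite fineK.
have K0 : 0 < K by rewrite -lte_fin -KE.
pose kap0 : R := K * expR (- (l * N%:R)).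
have kap00 : 0 < kap0 by rewrite mulr_gt0// expR_gt0.
have p1 : 1 < 2 `^ (2 * k) :> R by apply: powR2_gt1; lra.
exists (2 * l / (2 `^ (2 * k) - 1)), N%:R, kap0; split => //.
- by rewrite divr_gt0 ?subr_gt0// mulr_gt0.
- by rewrite ler1n.
move=> d Omega P x0 xi w0 w1 noise n.
set delta := (32 + 64 * gamma / Num.sqrt alpha)^-1 in doub start.
apply: (@le_trans _ _ (mustar (front R alpha gamma a (2 ^+ n * N%:R) ((delta * (2 ^+ n * N%:R)) ^+ 2)))).
  apply: (@iterated_doubling R k l N%:R kap0
    (fun r => mustar (front R alpha gamma a r ((delta * r) ^+ 2)))) => //.
  - by rewrite ltr0n.
  - exact: ltW.
  - by rewrite EFinM -KE; exact: start noise.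
  - by move=> r Nr; apply: doub noise; exact: le_trans Nr.
apply: le_measure; rewrite ?inE; [exact: measurable_front|exact: measurable_slow_ge|].
by move=> x [].
Qed.

(** * Tail of the law at time t *)

(** Oscillations at most eps r over unit windows keep the fast variables below a small multiple of
    r; then [slow_variable_upper] applies at level r / 2. The starting energy is compared for every
    [a] because the weight of the Lyapunov function is chosen inside the proof. *)
Lemma slow_upper_of_oscillation (R : realType) (alpha gamma s0 s1 M q : R) (f : R -> R) :
  0 < alpha -> 0 < gamma -> 0 < s0 -> 0 < s1 -> 0 < M -> continuous f ->
  (forall x, `|f x| <= M) -> (forall x, q <= x -> 0 <= f x) ->
  exists2 eps : R, 0 < eps & forall x0 : state R, exists2 rho : R, 0 < rho &
    forall (r t : R) (N : nat) (w0 w1 p0 q0 p1 q1 : R -> R),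
    rho <= r -> 0 <= t -> t <= N%:R ->
    path_solution R alpha gamma s0 s1 f w0 w1 p0 q0 p1 q1 ->
    slow R gamma (p0 0, q0 0, p1 0, q1 0) = slow R gamma x0 ->
    (forall a, fast_energy R alpha a (p0 0, q0 0, p1 0, q1 0) = fast_energy R alpha a x0) ->
    (forall (j : nat) (u : R), (j <= N)%N -> j%:R <= u <= j%:R + 1 ->
      `|w0 u - w0 j%:R| <= eps * r /\ `|w1 u - w1 j%:R| <= eps * r) ->
    (forall u : R, 0 <= u <= t ->
      `|w0 u| <= r / (8 * (s0 + s1)) /\ `|w1 u| <= r / (8 * (s0 + s1))) ->
    slow R gamma (p0 t, q0 t, p1 t, q1 t) < r.
Proof.
move=> al0 g0 s00 s10 M0 cf fM fpos.
have [a [C [a0 a2 a4 C0 stab]]] := stable_bound R alpha gamma s0 s1 M al0 g0 s00 s10 M0.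
have sp : 0 < s0 + s1 by rewrite addr_gt0.
have sa : 0 < Num.sqrt alpha by rewrite sqrtr_gt0.
pose c2 : R := 2 * (1 + (Num.sqrt alpha)^-1).
have c20 : 0 < c2 by rewrite /c2 mulr_gt0// addr_gt0// invr_gt0.
pose c3 : R := Num.sqrt (1 + 16 * C).
have c30 : 0 < c3 by rewrite sqrtr_gt0; lra.
(* c3 m is the square root of the energy bound and c2 turns it into a bound zeta on the fast
   variables; eps is fixed so that (gamma + 2) zeta = r / 4. *)
pose eps : R := (4 * (gamma + 2) * c2 * c3)^-1.
have den : 0 < 4 * (gamma + 2) * c2 * c3 by rewrite !mulr_gt0//; lra.
have eps0 : 0 < eps by rewrite invr_gt0.
exists eps => // x0.
pose S0 : R := fast_energy R alpha a x0.
(* The terms ensure in turn gamma q <= r / 4, a start below r / 2, and eps r >= 1 + 9/4 |S0|, by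
   which the initial energy is absorbed. *)
pose rho : R := 1 + 4 * gamma * `|q| + 2 * `|slow R gamma x0| + (1 + 9 / 4 * `|S0|) / eps.
have gq : 0 <= 4 * gamma * `|q| by rewrite mulr_ge0// mulr_ge0// ltW.
have sl : 0 <= `|slow R gamma x0| by [].
have e1 : 0 < 1 + 9 / 4 * `|S0| by have := normr_ge0 S0; lra.
have e2 : 0 < (1 + 9 / 4 * `|S0|) / eps by rewrite divr_gt0.
exists rho; first by rewrite /rho; lra.
move=> r t N w0 w1 p0 q0 p1 q1 rr t0 tN ps Q0E S0E osc glob.
rewrite {}/rho in rr.
have r0 : 0 < r by clear - rr gq sl e2; lra.
pose m : R := eps * r.
have m1 : 1 + 9 / 4 * `|S0| <= m.
  by rewrite /m -ler_pdivrMl// mulrC; clear - rr gq sl; lra.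
have m0 : 0 <= m by clear - m1 e1; lra.
have gcP (w : R -> R) : (forall (j : nat) (u : R), (j <= N)%N -> j%:R <= u <= j%:R + 1 ->
    `|w u - w j%:R| <= m) -> forall u v : R, 0 <= u -> u <= v <= u + 1 -> v <= t + 1 ->
    `|w v - w u| <= 3 * m.
  move=> ow u v u0 uv vt.
  have [|j jN] := grid_cell R 1 u N ltr01 u0; first by rewrite mulr1; have /andP[uv1 _] := uv; clear - uv1 vt tN; lra.
  rewrite mulr1 => /andP[ju uj].
  have o1 := ow j u jN ltac:(by rewrite ju).
  have /andP[uv1 uv2] := uv.
  have [vj|vj] := lerP v (j%:R + 1).
    have o2 := ow j v jN ltac:(by rewrite vj andbT; clear - ju uv1; lra).
    have -> : w v - w u = (w v - w j%:R) - (w u - w j%:R) by ring.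
    by apply: le_trans (ler_normB _ _) _; clear - o1 o2 m0; lra.
  have jh : (j.+1%:R : R) = j%:R + 1 by rewrite -natr1.
  have j1N : (j.+1 <= N)%N.
    have : (j.+1%:R : R) < N.+1%:R by rewrite jh -(natr1 N); clear - vj vt tN; lra.
    by rewrite ltr_nat ltnS.
  have o2 := ow j.+1 v j1N ltac:(rewrite jh; clear - vj uv2 uj; apply/andP; split; lra).
  have o3 := ow j j.+1%:R jN ltac:(by rewrite jh lerDl ler01 lexx).
  have -> : w v - w u = (w v - w j.+1%:R) + (w j.+1%:R - w j%:R) - (w u - w j%:R) by ring.
  apply: le_trans (ler_normB _ _) _.
  by have := ler_normD (w v - w j.+1%:R) (w j.+1%:R - w j%:R); clear - o1 o2 o3; lra.
have win (u v : R) : 0 <= u -> u <= v <= u + 1 -> v <= t + 1 ->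
    `|w0 v - w0 u| <= 3 * m /\ `|w1 v - w1 u| <= 3 * m.
  move=> u0 uv vt; split.
    by apply: (gcP w0) => // j z jN jz; have [] := osc j z jN jz.
  by apply: (gcP w1) => // j z jN jz; have [] := osc j z jN jz.
pose B : R := c3 * m.
have B0 : 0 <= B by rewrite mulr_ge0// ltW.
have SB (u : R) : 0 <= u <= t -> lyapunov R alpha a (p0 u) (p1 u) (q1 u - q0 u) <= B ^+ 2.
  move=> ut; have m30 : 0 <= 3 * m by rewrite mulr_ge0.
  have h := stab f w0 w1 p0 q0 p1 q1 t (3 * m) cf fM ps m30 win u ut.
  apply: (le_trans h).
  have -> : lyapunov R alpha a (p0 0) (p1 0) (q1 0 - q0 0) = S0 by rewrite /S0 -S0E.
  rewrite /B exprMn sqr_sqrtr; last by clear - C0; lra.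
  have h1 : 9 / 4 * S0 <= m ^+ 2.
    apply: (@le_trans _ _ m); first by have := ler_norm S0; clear - m1; lra.
    by rewrite expr2 ler_peMr//; have := normr_ge0 S0; clear - m1; lra.
  have h2 : (1 + 3 * m) ^+ 2 <= 16 * m ^+ 2.
    have -> : 16 * m ^+ 2 = (4 * m) ^+ 2 by ring.
    by rewrite ler_pXn2r ?nnegrE//; have := normr_ge0 S0; clear - m1; lra.
  have h3 : C * (1 + 3 * m) ^+ 2 <= C * (16 * m ^+ 2) by rewrite ler_pM2l.
  clear - h1 h3; lra.
pose zeta : R := c2 * B.
have zE : (gamma + 2) * zeta = r / 4.
  by rewrite /zeta /B /m /eps; field; rewrite !gt_eqF//; clear - g0; lra.
have Zb (u : R) : 0 <= u <= t ->
    [/\ `|p0 u| <= zeta, `|p1 u| <= zeta & `|q1 u - q0 u| <= zeta].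
  move=> ut; have [b0 b1 b2] := fast_bounds R alpha a B _ _ _ al0 a0 a2 a4 B0 (SB u ut).
  have zz : zeta = 2 * B + 2 * B / Num.sqrt alpha by rewrite /zeta /c2; ring.
  have bs : 0 <= 2 * B / Num.sqrt alpha by rewrite divr_ge0 ?mulr_ge0// ltW.
  have b3 : `|q1 u - q0 u| <= 2 * B / Num.sqrt alpha by rewrite ler_pdivlMr// mulrC.
  by rewrite zz; clear - b0 b1 b3 bs B0; split; lra.
rewrite /slow /=.
have -> : r = 2 * (r / 2) by field.
apply: (slow_variable_upper R alpha gamma s0 s1 f w0 w1 p0 q0 p1 q1 q zeta) => //.
- have := ler_norm q; have : gamma * q <= gamma * `|q| by rewrite ler_pM2l// ler_norm.
  by rewrite mulrDr; clear - rr gq sl e2 zE; lra.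
- have := ler_norm (slow R gamma x0); rewrite -Q0E /slow /= => h.
  by rewrite -Q0E /slow /= in rr sl; clear - h rr sl gq e2; lra.
move=> u ut; have [g1 g2] := glob u ut.
apply: le_lt_trans (ler_normD _ _) _.
have k0 := norm_mulr_le R s0 _ _ (ltW s00) g1; have k1 := norm_mulr_le R s1 _ _ (ltW s10) g2.
apply: le_lt_trans (lerD k0 k1) _; rewrite -mulrDl.
have -> : (s0 + s1) * (r / (8 * (s0 + s1))) = r / 8 by field; rewrite gt_eqF.
clear - r0 zE; lra.
Qed.

Lemma oscillation_cells_tail (R : realType) (d : measure_display)
    (Omega : measurableType d) (P : probability Omega R) (w : R -> Omega -> R)
    (m : R) (N : nat) :
  gaussian_increments R d Omega P w -> 0 <= m -> 1024 <= m ^+ 2 ->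
  exists E : set Omega, [/\ measurable E,
    (P E <= (4 * expR (- (m ^+ 2 / 64)) * N.+1%:R)%:E)%E &
    forall om, ~ E om -> forall (j : nat) (u : R), (j <= N)%N -> j%:R <= u <= j%:R + 1 ->
      `|w u om - w j%:R om| <= m].
Proof.
move=> gi m0 m2.
have /choice[E hE] : forall j : nat, exists E : set Omega, [/\ measurable E,
    (P E <= (4 * expR (- (m ^+ 2 / 64)))%:E)%E &
    forall om, ~ E om -> forall u : R, j%:R <= u <= j%:R + 1 ->
      `|w u om - w j%:R om| <= m].
  move=> j; have -> : m ^+ 2 / 64 = m ^+ 2 / (64 * 1) by rewrite mulr1.
  by apply: oscillation_tail; rewrite ?ler0n ?mulr1.
exists (\big[setU/set0]_(j < N.+1) E j); split.
- by apply: bigsetU_measurable => j _; case: (hE j).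
- apply: (@le_trans _ _ (\sum_(j < N.+1) P (E j))%E).
    by apply: (@Boole_inequality _ _ _ P E) => j _; case: (hE j).
  apply: (@le_trans _ _ (\sum_(j < N.+1) (4 * expR (- (m ^+ 2 / 64)))%:E)%E).
    by apply: lee_sum => j _; case: (hE j).
  by rewrite sumEFin sumr_const card_ord mulr_natr.
- move=> om nE j u jN ju; have [_ _ h] := hE j; apply: h => // Ej; apply: nE.
  by rewrite -(bigcup_mkord _ E); exists j.
Qed.

(** The product rule on a grid with no cells reduces to the law of xi, so xi = x0 outside a null
    event. *)
Lemma driving_noise_initial (R : realType) (d : measure_display)
    (Omega : measurableType d) (P : probability Omega R)
    (x0 : state R) (xi : Omega -> state R) (w0 w1 : R -> Omega -> R) :
  driving_noise P (@dirac _ (state R) x0 R) xi w0 w1 ->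
  measurable (xi @^-1` ~` [set x0]) /\ P (xi @^-1` ~` [set x0]) = 0%E.
Proof.
move=> [mxi [_ [_ [_ [_ law]]]]].
have mx0 : measurable (~` [set x0]).
  apply: measurableC.
  have -> : [set x0] = (([set x0.1.1.1] `*` [set x0.1.1.2]) `*` [set x0.1.2]) `*` [set x0.2].
    apply/seteqP; split; first by move=> _ ->.
    by case: x0 {law} => [[[x1 x2] x3] x4] [[[y1 y2] y3] y4] /= [[[-> ->] ->] ->].
  by do 3 (apply: measurableX => //).
split; first by rewrite -[X in measurable X]setTI; exact: mxi.
have d0 : @dirac _ (state R) x0 R (~` [set x0]) = 0%E.
  rewrite diracE; have /negbTE -> // : x0 \notin ~` [set x0].
  by rewrite notin_setE /= => /(_ erefl).
have := law 0%N (fun=> 0) _ (fun=> setT) (fun=> setT) erefl _ mx0 (fun=> measurableT)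
  (fun=> measurableT).
rewrite big_ord0 mule1 => H.
have {}H := H _; move: H; rewrite [X in P X](_ : _ = xi @^-1` ~` [set x0]).
  by move=> HH; rewrite HH// d0.
by apply/seteqP; split => om /=; [case|split].
Qed.

(** Write X = r^(2k) and Y = r^(2 - 2k), so that X Y = r^2 and t = Y / Theta. The choice of Theta,
    with 4096 = 64 * 64, makes the exponent of the displacement exactly (Cst + 1) X; the spare exp
    (- X) absorbs the prefactors. The exponent of the unit-window oscillations is of order X Y,
    which beats both X and the number of cells. *)
Lemma tail_budget (R : realType) (k Cst sg eps rho1 kap0 Theta : R) :
  0 < k -> k < 1 / 2 -> 0 < Cst -> 0 < sg -> 0 < eps -> 0 < rho1 -> 0 < kap0 ->
  Theta = 4096 * sg ^+ 2 * (Cst + 1) ->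
  exists2 rho : R, 1 <= rho & forall r : R, rho <= r ->
    let t := r `^ (2 - 2 * k) / Theta in
    [/\ rho1 <= r, 0 < t, 1024 <= (eps * r) ^+ 2,
        1024 * t <= (r / (8 * sg)) ^+ 2 &
        8 * expR (- ((eps * r) ^+ 2 / 64)) * (Num.truncn t).+2%:R +
          8 * expR (- ((r / (8 * sg)) ^+ 2 / (64 * t))) <=
        kap0 * expR (- (Cst * r `^ (2 * k)))].
Proof.
move=> k0 k1 Cst0 sg0 eps0 rho10 kap00 ThE.
have Cst1 : 0 < Cst + 1 by rewrite addr_gt0.
have Th0 : 0 < Theta.
  by rewrite ThE; exact: (mulr_gt0 (mulr_gt0 (ltr0Sn _ _) (exprn_gt0 2 sg0)) Cst1).
have T8 : 0 < 8 / Theta by rewrite divr_gt0.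
pose X2 : R := 64 * (8 / Theta + 17 + Cst) / eps ^+ 2.
have k9 : 0 < 9 / kap0 by rewrite divr_gt0.
have X20 : 0 < X2 by rewrite divr_gt0 ?exprn_gt0// mulr_gt0//; lra.
(* 16 meets the requirement of [oscillation_tail], [X2] makes the unit-window term at most exp (-
   (Cst + 1) X), and 9 / kap0 gives exp (- X) <= kap0 / 9 for the total weight 1 + 8. *)
pose Xmin : R := 16 + X2 + 9 / kap0.
have Xm0 : 0 < Xmin by rewrite /Xmin; lra.
have [XmX2 [Xm16 Xm9]] : X2 <= Xmin /\ 16 <= Xmin /\ 9 / kap0 <= Xmin.
  by rewrite /Xmin; repeat split; lra.
have ee : 0 < 1024 / eps ^+ 2 by exact: (divr_gt0 (ltr0Sn _ _) (exprn_gt0 2 eps0)).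
have pp : 0 <= Xmin `^ (2 * k)^-1 by exact: powR_ge0.
exists (rho1 + 1 + 1024 / eps ^+ 2 + Xmin `^ (2 * k)^-1).
  by clear - rho10 ee pp; lra.
move=> r rr t.
have [r1 [rrho1 [rep rX]]] : 1 <= r /\ rho1 <= r /\ 1024 / eps ^+ 2 <= r /\ Xmin `^ (2 * k)^-1 <= r.
  by clear - rho10 ee pp rr; repeat split; lra.
have r0 : 0 < r by exact: lt_le_trans r1.
have k2 : 0 < 2 * k by rewrite mulr_gt0.
have k3 : 0 <= 2 - 2 * k by clear - k1; lra.
have k4 : 2 * k <= 2 - 2 * k by clear - k1; lra.
clear rr ee pp.
pose X : R := r `^ (2 * k); pose Y : R := r `^ (2 - 2 * k).
have XY : X * Y = r ^+ 2.
  by rewrite /X /Y -powRD ?(gt_eqF r0) ?implybT// -(powR_mulrn 2) ?(ltW r0)//; congr powR; ring.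
have XX : Xmin <= X.
  rewrite -[leLHS](powRr1 (ltW Xm0)) -[X in _ `^ X <= _](mulVf (lt0r_neq0 k2)) powRrM.
  by apply: ge0_ler_powR; rewrite ?nnegrE ?(ltW k2) ?(ltW r0) ?powR_ge0.
have X0 : 0 < X by exact: lt_le_trans XX.
have Y1 : 1 <= Y by rewrite /Y -[leLHS](powRr0 r) ler_powR.
have Y0 : 0 < Y by exact: lt_le_trans Y1.
have XleY : X <= Y by rewrite /X /Y ler_powR.
have t0 : 0 < t by rewrite divr_gt0.
have /andP[N1 _] := truncn_itv (ltW t0).
have m2 : 1024 <= (eps * r) ^+ 2.
  rewrite exprMn mulrC -ler_pdivrMr ?exprn_gt0// (le_trans rep)// expr2.
  by rewrite ler_peMr// ltW.
pose b : R := r / (8 * sg).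
have b2E : b ^+ 2 / (64 * t) = (Cst + 1) * X.
  have -> : b ^+ 2 = X * Y / (64 * sg ^+ 2).
    by rewrite XY /b; field; rewrite gt_eqF.
  rewrite /t -/Y; clearbody Y X; rewrite ThE; field.
  by rewrite !gt_eqF.
have b2 : 1024 * t <= b ^+ 2.
  have : 16 <= b ^+ 2 / (64 * t).
    rewrite b2E; have h := mulr_gt0 Cst0 X0; have h' := le_trans Xm16 XX.
    by clear - h h'; lra.
  have t64 : 0 < 64 * t by exact: (mulr_gt0 (ltr0Sn _ _) t0).
  move=> h; have {h} := ler_wpM2r (ltW t64) h.
  by rewrite divfK ?gt_eqF// => h; clear - h; lra.
split => //.
rewrite -/b b2E.
pose z : R := expR (- (Cst * X)).
have z0 : 0 < z by exact: expR_gt0.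
have zX : expR (- ((Cst + 1) * X)) = z * expR (- X).
  by rewrite /z -expRD; congr expR; ring.
have eX : expR (- X) <= kap0 / 9.
  have h1 : 9 / kap0 <= 1 + X by have := le_trans Xm9 XX; clear; lra.
  have h2 := le_trans h1 (expR_ge1Dx X).
  rewrite expRN -[kap0 / 9]invrK lef_pV2 ?posrE ?expR_gt0 ?invr_gt0 ?divr_gt0//.
  by rewrite invf_div.
have loc : 8 * expR (- ((eps * r) ^+ 2 / 64)) * (Num.truncn t).+2%:R <= z * expR (- X).
  rewrite -zX.
  have n1 : 8 * (Num.truncn t).+2%:R <= expR (8 * t + 16) :> R.
    apply: le_trans (expR_ge1Dx _); rewrite -!natr1; clear - N1; lra.
  have -> (u n : R) : 8 * u * n = (8 * n) * u by ring.
  apply: (le_trans (ler_wpM2r (expR_ge0 _) n1)).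
  rewrite -expRD ler_expR.
  have t8 : 8 * t = 8 / Theta * Y by rewrite /t -/Y; field; rewrite gt_eqF.
  have h1 : 64 * (8 / Theta + 17 + Cst) <= X * eps ^+ 2.
    by rewrite -ler_pdivrMr ?exprn_gt0//; exact: le_trans XX.
  have h2 : 64 * (8 / Theta + 17 + Cst) * Y <= X * eps ^+ 2 * Y.
    by rewrite ler_wpM2r// ltW.
  have h3 : (eps * r) ^+ 2 = X * eps ^+ 2 * Y by rewrite exprMn -XY; ring.
  have h4 : (Cst + 1) * X <= (Cst + 1) * Y by rewrite ler_wpM2l// ltW.
  rewrite h3 t8; clear - h2 h4 Y1; lra.
rewrite zX -/X -/z.
have fin : z * expR (- X) <= z * (kap0 / 9) by rewrite ler_pM2l.
by clear - fin loc; lra.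
Qed.

(** Theta is fixed before x0 and kap0, and only the threshold [rho] depends on them; this makes the
    final rate uniform in the starting point. *)
Lemma law_tail_upper (R : realType) (alpha gamma T Tinf k Cst : R) (V1 : R -> R) :
  0 < alpha -> 0 < gamma -> 0 < T -> 0 < Tinf -> 0 < k -> k < 1 / 2 ->
  potential_hyp k V1 -> 0 < Cst ->
  exists2 Theta : R, 0 < Theta & forall (x0 : state R) (kap0 : R), 0 < kap0 ->
  exists2 rho : R, 1 <= rho & forall r : R, rho <= r ->
  forall (d : measure_display) (Omega : measurableType d) (P : probability Omega R)
    (xi : Omega -> state R) (w0 w1 p0 q0 p1 q1 : R -> Omega -> R),
  driving_noise P (@dirac _ (state R) x0 R) xi w0 w1 ->
  is_solution alpha gamma T Tinf V1 xi w0 w1 p0 q0 p1 q1 ->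
  (law_at P p0 q0 p1 q1 (r `^ (2 - 2 * k) / Theta) [set x : state R | (r <= slow R gamma x)%R]
   <= (kap0 * expR (- (Cst * r `^ (2 * k))))%:E)%E.
Proof.
move=> al0 g0 T0 Tinf0 k0 k1 pot Cst0.
have [M [L [q [M0 L0 _ [fM fdec] [fpos fL]]]]] := potential_facts R k V1 k0 k1 pot.
have cf : continuous (derive1 V1).
  move=> x; apply: (is_derive_continuous_at _ _ _ (derive1 (derive1 V1) x)).
  by apply: derivable1_is_derive; case: pot => _ [_ []].
pose s0 : R := Num.sqrt (2 * gamma * T); pose s1 : R := Num.sqrt (2 * gamma * Tinf).
have s00 : 0 < s0 by rewrite sqrtr_gt0 !mulr_gt0.
have s10 : 0 < s1 by rewrite sqrtr_gt0 !mulr_gt0.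
pose sg : R := s0 + s1.
have sg0 : 0 < sg by rewrite addr_gt0.
have [eps eps0 upper] := slow_upper_of_oscillation R alpha gamma s0 s1 M q _ al0 g0 s00 s10 M0 cf fM fpos.
pose Theta : R := 4096 * sg ^+ 2 * (Cst + 1).
have Th0 : 0 < Theta.
  exact: (mulr_gt0 (mulr_gt0 (ltr0Sn _ _) (exprn_gt0 2 sg0)) (addr_gt0 Cst0 ltr01)).
refine (@ex_intro2 R _ _ Theta Th0 _).
move=> x0 kap0 kap00.
have [rho1 rho10 up] := upper x0.
have [rho rhoge bud] := tail_budget R k Cst sg eps rho1 kap0 Theta k0 k1 Cst0 sg0 eps0
  rho10 kap00 erefl.
refine (@ex_intro2 R _ _ rho rhoge _).
move=> r rr d Omega P xi w0 w1 p0 q0 p1 q1 noise sol.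
have [rrho1 t0 m2 b2 budget] := bud r rr.
set t := r `^ (2 - 2 * k) / Theta in t0 b2 budget *.
have r0 : 0 <= r by rewrite (le_trans _ (le_trans rhoge rr)).
pose N := (Num.truncn t).+1.
have tN : t <= N%:R by have /andP[_ /ltW] := truncn_itv (ltW t0).
have [gi0 gi1] := driving_noise_increments R d Omega P x0 xi w0 w1 noise.
pose m : R := eps * r.
have m0 : 0 <= m by rewrite mulr_ge0// ltW.
have [E0 [mE0 PE0 hE0]] := oscillation_cells_tail R d Omega P w0 m N gi0 m0 m2.
have [E1 [mE1 PE1 hE1]] := oscillation_cells_tail R d Omega P w1 m N gi1 m0 m2.
pose b : R := r / (8 * sg).
have b0 : 0 <= b by rewrite divr_ge0 ?mulr_ge0// ltW.
have [G0 [mG0 PG0 hG0]] := oscillation_tail R d Omega P w0 0 t b gi0 (lexx _) t0 b0 b2.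
have [G1 [mG1 PG1 hG1]] := oscillation_tail R d Omega P w1 0 t b gi1 (lexx _) t0 b0 b2.
have [mI PI] := driving_noise_initial R d Omega P x0 xi w0 w1 noise.
set I := xi @^-1` _ in mI PI.
have PI' : (P I <= 0)%E by rewrite PI.
rewrite /law_at.
set Ev := (X in P X).
have mEv : measurable Ev.
  have [mp0 [mq0 [mp1 mq1]]] := sol.1 t.
  have mm : measurable_fun setT (fun z => (p0 t z, q0 t z, p1 t z, q1 t z)).
    by do 3 (apply: measurable_fun_pair => //).
  rewrite /Ev -[X in measurable X]setTI; apply: mm => //.
  exact: measurable_slow_ge.
(* Reaching r forces a wrong start, a large oscillation of one noise over some unit cell, or a large
   displacement of one noise before t. *)
have sub : Ev `<=` I `|` (E0 `|` E1 `|` (G0 `|` G1)).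
  move=> om evom; apply: contrapT => /not_orP[nI /not_orP[/not_orP[nE0 nE1] /not_orP[nG0 nG1]]].
  have xom : xi om = x0 by apply: contrapT.
  have path := is_solution_path R alpha gamma T Tinf V1 _ _ P _ _ _ _ _ _ _ _ noise sol om.
  have [_ [_ [_ [_ [i1 [i2 [i3 [i4 _]]]]]]]] := sol.2 om.
  have [_ [_ [_ [w00 _]]]] := noise; have [w00' w10'] := w00 om.
  have := up r t N (w0 ^~ om) (w1 ^~ om) (p0 ^~ om) (q0 ^~ om) (p1 ^~ om) (q1 ^~ om)
    rrho1 (ltW t0) tN path.
  rewrite /= i1 i2 i3 i4 xom => H.
  suff : slow R gamma (p0 t om, q0 t om, p1 t om, q1 t om) < r.
    by rewrite ltNge => /negP; apply.
  apply: H.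
  - by [].
  - by [].
  - move=> j u jN ju; split; [exact: hE0|exact: hE1].
  - move=> u ut; split.
      by have := hG0 om nG0 u; rewrite add0r w00' subr0; exact.
    by have := hG1 om nG1 u; rewrite add0r w10' subr0; exact.
have mU : measurable (E0 `|` E1 `|` (G0 `|` G1)).
  by apply: measurableU; exact: measurableU.
apply: (@le_trans _ _ (P (I `|` (E0 `|` E1 `|` (G0 `|` G1))))).
  by apply: le_measure; rewrite ?inE//; exact: measurableU.
apply: (le_trans (@measureU2 _ _ _ P _ _ mI mU)); 
apply: (le_trans (leeD PI' (lexx _))); rewrite add0e.
apply: (le_trans (@measureU2 _ _ _ P _ _ (measurableU _ _ mE0 mE1) (measurableU _ _ mG0 mG1))).
apply: (le_trans (leeD (@measureU2 _ _ _ P _ _ mE0 mE1) (@measureU2 _ _ _ P _ _ mG0 mG1))).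
apply: (le_trans (leeD (leeD PE0 PE1) (leeD PG0 PG1))).
rewrite -!EFinD lee_fin; apply: le_trans budget.
rewrite -/b -/m.
have -> (u v n : R) : 4 * u * n + 4 * u * n + (4 * v + 4 * v) = 8 * u * n + 8 * v by ring.
by [].
Qed.

(** * Comparison *)

Lemma le_tv_dist (R : realType) (d : measure_display) (S : measurableType d)
    (mu nu : set S -> \bar R) (A : set S) (x : R) :
  measurable A -> ((2 * x)%:E <= mu A)%E -> (nu A <= x%:E)%E -> (x%:E <= tv_dist mu nu)%E.
Proof.
move=> mA muA nuA.
apply: (@le_trans _ _ `|mu A - nu A|%E); last first.
  by apply: ereal_sup_ubound; exists A.
apply: (@le_trans _ _ (mu A - nu A)%E); last exact: lee_abs.
apply: (@le_trans _ _ ((2 * x)%:E - x%:E)%E).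
  by rewrite -EFinB lee_fin; lra.
exact: leeB.
Qed.

Theorem theorem7p8 (R : realType) (alpha gamma T Tinf : R) (k : R)
  (V1 : R -> R) (mustar : probability (state R) R) :
  0 < alpha -> 0 < gamma -> 0 < T -> 0 < Tinf ->
  0 < k -> k < 1 / 2 ->
  potential_hyp k V1 ->
  invariant_measure alpha gamma T Tinf V1 mustar ->
  exists c : R, 0 < c /\
    forall x0 : state R, exists C : R, 0 < C /\
      exists tn : nat -> R,
        (forall n, 0 <= tn n) /\ (forall n, tn n < tn n.+1) /\
        tn @ \oo --> +oo /\
        forall (n : nat) (d : measure_display) (Omega : measurableType d)
               (P : probability Omega R) (xi : Omega -> state R)
               (w0 w1 p0 q0 p1 q1 : R -> Omega -> R),
          driving_noise P (@dirac _ (state R) x0 R) xi w0 w1 ->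
          is_solution alpha gamma T Tinf V1 xi w0 w1 p0 q0 p1 q1 ->
          ((C * expR (- c * tn n `^ (k / (1 - k))))%:E
             <= tv_dist mustar (law_at P p0 q0 p1 q1 (tn n)))%E.
Proof.
move=> al0 g0 T0 Tinf0 k0 k1 pot inv.
have [Cst [r0 [kap0 [Cst0 r01 kap00 lower]]]] :=
  invariant_tail_lower R alpha gamma T Tinf k V1 mustar al0 g0 T0 Tinf0 k0 k1 pot inv.
have [theta Th0 upper] :=
  law_tail_upper R alpha gamma T Tinf k Cst V1 al0 g0 T0 Tinf0 k0 k1 pot Cst0.
have r00 : 0 < r0 by exact: lt_le_trans r01.
have e0 : 0 < 2 - 2 * k by clear - k1; lra.
have e1 : 1 <= 2 - 2 * k by clear - k1; lra.
exists (Cst * theta `^ (k / (1 - k))); split; first by rewrite mulr_gt0// powR_gt0.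
move=> x0.
(* Half of the lower bound for the invariant measure is granted to the law at time t; the other half
   is the separation. *)
have [rho rho1 up] := upper x0 (kap0 / 2) (divr_gt0 kap00 (ltr0Sn _ _)).
exists (kap0 / 2); split; first by rewrite divr_gt0.
have grow (n : nat) : n%:R <= 2 ^+ n :> R.
  by rewrite -natrX ler_nat ltnW// ltn_expl.
(* The shift by n0 puts every r n beyond rho, the first one included. *)
pose n0 := (Num.truncn rho).+1.
pose r (n : nat) : R := 2 ^+ (n + n0) * r0.
have rge (n : nat) : (n + n0)%:R <= r n.
  by apply: le_trans (grow _) _; rewrite ler_peMr ?exprn_ge0.
have rrho (n : nat) : rho <= r n.
  apply: le_trans (rge n); have /andP[_ h] := truncn_itv (le_trans ler01 rho1).
  by apply: (le_trans (ltW h)); rewrite ler_nat leq_addl.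
have r1 (n : nat) : 1 <= r n by exact: le_trans (rrho n).
have rp (n : nat) : 0 <= r n by exact: le_trans (r1 n).
exists (fun n => r n `^ (2 - 2 * k) / theta); split; last split; last split.
- by move=> n; rewrite divr_ge0 ?powR_ge0// ltW.
- move=> n; rewrite ltr_pM2r ?invr_gt0//.
  apply: gt0_ltr_powR => //; rewrite ?nnegrE//.
  by rewrite /r addSn exprS -mulrA ltr_pMl ?ltr1n// mulr_gt0 ?exprn_gt0.
- apply/cvgryPge => B.
  exists (Num.truncn (`|B| * theta)).+1 => // n /= hn.
  rewrite ler_pdivlMr//.
  apply: (@le_trans _ _ (r n)); last first.
    by rewrite -[leLHS](powRr1 (rp n)) ler_powR.
  apply: le_trans (rge n).
  have BT : 0 <= `|B| * theta by rewrite mulr_ge0 ?(ltW Th0).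
  apply: (@le_trans _ _ (`|B| * theta)); first by rewrite ler_pM2r ?ler_norm.
  have /andP[_ h] := truncn_itv BT.
  by apply: (le_trans (ltW h)); rewrite ler_nat (leq_trans hn)// leq_addr.
move=> n d Omega P xi w0 w1 p0 q0 p1 q1 noise sol.
have -> : - (Cst * theta `^ (k / (1 - k))) * (r n `^ (2 - 2 * k) / theta) `^ (k / (1 - k)) =
  - (Cst * r n `^ (2 * k)).
  rewrite mulNr -mulrA -powRM ?(ltW Th0) ?divr_ge0 ?powR_ge0 ?(ltW Th0)//.
  rewrite [theta * _]mulrC divfK ?gt_eqF// -powRrM.
  by congr (- (_ * _ `^ _)); field; rewrite gt_eqF// subr_gt0; clear - k1; lra.
apply: (@le_tv_dist _ _ _ _ _ [set x : state R | (r n <= slow R gamma x)%R]).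
- exact: measurable_slow_ge.
- have -> (u : R) : 2 * (kap0 / 2 * u) = kap0 * u by field.
  exact: lower noise _.
- exact: (up _ (rrho n) _ _ _ _ _ _ _ _ _ _ noise sol).
Qed.
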